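(* If $A=\{x,\;x-1,\;x-2,\;x^2-3x+1,\;x^3-5x^2+6x-1\}$, then $$|\lambda_A-1.7998|\le 10^{-4}.$$
   Context: $\mathbb{R}^+=[0,\infty)$, and $I(\mu)=\iint\log|x_1-x_2|\,d\mu(x_1)\,d\mu(x_2)$ is the logarithmic energy. For a finite set $A\subset\mathbb{Z}[x]$ of nonzero polynomials with only real roots, $\lambda_A=\inf_\mu\int x\,d\mu(x)$, where $\mu$ ranges over the Borel probability measures supported on $\mathbb{R}^+$ with $I(\mu)\ge 0$ and $\int\log|Q(x)|\,d\mu(x)\ge0$ for every $Q\in A$. *)

(* Defs.v *)
From HB Require Import structures.
From mathcomp Require Import all_boot all_order all_algebra.
From mathcomp Require Import finmap.
From mathcomp Require Import all_classical all_reals all_analysis.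

Set Implicit Arguments.
Unset Strict Implicit.
Unset Printing Implicit Defensive.

Import Order.TTheory GRing.Theory Num.Theory.
Import numFieldNormedType.Exports.

Local Open Scope classical_set_scope.
Local Open Scope ring_scope.
Local Open Scope ereal_scope.

(* Logarithms are taken with the extended-real [lne], for which log 0 = -oo
   (the real-valued [ln] has the junk value ln 0 = 0).  In particular a
   measure with an atom has energy -oo.  An integral whose positive and
   negative parts are both infinite has the value -oo.  For measures on
   [0, +oo[ this can happen below only when the mean is +oo, so it does not
   affect the infimum [lambda]. *)

Definition log_energy (R : realType)
    (mu : probability (measurableTypeR R) R) : \bar R :=
  \int[mu \x mu]_z lne `|z.1 - z.2|%:E.

Definition log_integral (R : realType)
    (mu : probability (measurableTypeR R) R) (Q : {poly int}) : \bar R :=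
  \int[mu]_x lne `|(map_poly intr Q).[x]|%:E.

(* Since [0, +oo[ is closed, the support of mu lies in it iff its complement
   is mu-null. *)
Definition supported_on_nonneg (R : realType)
    (mu : probability (measurableTypeR R) R) : Prop :=
  mu (~` [set x : R | (0 <= x)%R]) = 0.

Definition admissible (R : realType) (A : {fset {poly int}})
    (mu : probability (measurableTypeR R) R) : Prop :=
  [/\ supported_on_nonneg mu,
      0 <= log_energy mu
    & forall Q : {poly int}, Q \in A -> 0 <= log_integral mu Q].

(* Total in A; the intended A are the finite sets of nonzero polynomials all
   of whose complex roots are real. *)
Definition lambda (R : realType) (A : {fset {poly int}}) : \bar R :=
  ereal_inf [set \int[mu]_x x%:E |
    mu in [set mu : probability (measurableTypeR R) R | admissible A mu]].

(* Main.v *)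
(* TODO *)
From Stdlib Require Import ZArith.
Require Import Defs.
From HB Require Import structures.
From mathcomp Require Import all_boot all_order all_algebra.
From mathcomp Require Import finmap.
From mathcomp Require Import all_classical all_reals all_analysis.
From mathcomp Require Import measurable_realfun ring lra ssrZ zify.
Set Implicit Arguments.
Unset Strict Implicit.
Unset Printing Implicit Defensive.
Import Order.TTheory GRing.Theory Num.Theory.
Import numFieldNormedType.Exports.
Local Open Scope classical_set_scope.
Local Open Scope ring_scope.
Local Open Scope ereal_scope.

(** The argument is duality for an infinite linear program. Let [mu] be a probability measure,
    [U(x)] the integral of [log |x - y|] over [mu(dy)], and let [l0] and [l_Q] (for [Q] in [A]) be
    positive multipliers. Put [Phi(y) = y - sum_Q l_Q log |Q(y)| - l0 U(y)].

    Lower bound ([lambda_ge]). Suppose that [Phi >= c] on the nonnegative reals off the roots.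
    Integrating against an admissible [nu] bounds its mean below by [c + sum_Q l_Q int log |Q| dnu +
    l0 I(nu, mu)]. The middle terms are nonnegative by admissibility. So is the mutual energy
    [I(nu, mu)] once [I(mu) >= 0], because [- log |x - y|] is positive definite on differences of
    probability measures: [2 I(nu, mu) >= I(nu) + I(mu)] ([log_gap_cross_le]). Hence the mean of
    [nu] is at least [c].

    Upper bound ([lambda_le]). It suffices that [mu] itself be admissible, with mean [m]. Its energy
    is never computed as a double integral. If [Phi <= K] wherever [mu] has mass, integration
    against [mu] gives [m - sum_Q l_Q int log |Q| dmu - l0 I(mu) <= K], and the numerical inequality
    [K <= m - sum_Q l_Q int log |Q| dmu] then forces [I(mu) >= 0] ([log_energy_pl_ge0]). At the
    optimum [Phi] is constant on the support, so a good approximation of the optimal measure leaves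
    little room between [c] and [m].

    The chosen [mu] has a piecewise linear density made of eight bumps, one to the right of each of
    the eight roots of the polynomials of [A]. Its mean and its potential are then finite sums over
    the knots ([integral_log_weight]). On the support of a bump [Phi] is enclosed, cell by cell, by
    Taylor polynomials with interval coefficients in fixed-point integer arithmetic; logarithms come
    from a table with a proved error bound ([log_tableP], [phi_poly_encl]). Between a bump and a
    neighbouring root, or beyond the last bump, [Phi] is convex, so it is enough that it has begun
    to grow near the bump ([pl_gap_le]). All these verifications form one boolean,
    [certificate_check], whose truth implies the two bounds ([certificate_bounds]) and which is
    evaluated on the data with [c = 1.7997] and [m <= 1.7999].

    To keep infinite values harmless, the energy estimates are phrased with the nonnegative
    functions [log_gap] and [log_kernel], to which Tonelli's theorem applies. *)

(** * Positive definiteness of the tent kernel *)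

Section TentKernel.
Context (R : realType).
Notation T := (measurableTypeR R).
Implicit Types (mu nu : probability T R) (r s u : R).
Let leb : {sigma_finite_measure set T -> \bar R} := @lebesgue_measure R.

Let sprod nu mu : probability (T * T)%type R := (nu \x mu)%E.

Definition window r s : set T := `]s, (s + r)%R]%classic.

Definition tent r u : R := Num.max 0%R (r - `|u|)%R.

Lemma tent_ge0 r u : (0 <= tent r u)%R.
Proof. by rewrite /tent le_max lexx. Qed.

Let overlap r : set ((T * T) * T) :=
  [set p | (p.2 < p.1.1)%R /\ (p.1.1 <= p.2 + r)%R] `&`
  [set p | (p.2 < p.1.2)%R /\ (p.1.2 <= p.2 + r)%R].

Let measurable_overlap r : measurable (overlap r).
Proof.
have h (f : (T * T) * T -> T) : measurable_fun setT f ->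
    measurable [set p : (T * T) * T | (p.2 < f p)%R /\ (f p <= p.2 + r)%R].
  move=> mf.
  have m2 : measurable_fun setT (fun p : (T * T) * T => p.2) by exact: measurable_snd.
  have m2r : measurable_fun setT (fun p : (T * T) * T => (p.2 + r)%R : T).
    by apply: measurable_funD => //; exact: measurable_cst.
  have := measurable_fun_ltr m2 mf; have := measurable_fun_ler mf m2r.
  move=> /(_ measurableT [set true] I); rewrite setTI => h1.
  move=> /(_ measurableT [set true] I); rewrite setTI => h2.
  rewrite [X in measurable X](_ : _ = [set p : (T * T) * T | (p.2 < f p)%R] `&`
     [set p : (T * T) * T | (f p <= p.2 + r)%R]) //.
  exact: measurableI.
apply: measurableI; apply: h.
- by apply: (measurableT_comp measurable_fst); exact: measurable_fst.
- by apply: (measurableT_comp measurable_snd); exact: measurable_fst.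
Qed.

(** The windows of length [r] containing both points are those whose left end ranges over an
    interval of length [r - |z.1 - z.2|], if this is positive. *)
Let overlap_int r (z : T * T) : (0 < r)%R ->
  \int[leb]_s (\1_(overlap r) (z, s))%:E = (tent r (z.1 - z.2))%:E.
Proof.
move=> r0.
have E s : \1_(overlap r) (z, s) =
    \1_(`[(Num.max z.1 z.2 - r)%R, Num.min z.1 z.2[%classic : set T) s :> R.
  rewrite !indicE; congr (GRing.natmul 1%R (nat_of_bool _)); apply/idP/idP; rewrite !inE /overlap /= in_itv /=.
  - move=> [[a b] [c d]]; rewrite lt_min a c lerBlDr ge_max b d //.
  - by rewrite lt_min lerBlDr ge_max => /andP[/andP[a b] /andP[c d]].
under eq_integral do rewrite E.
rewrite integral_indic//= setIT /leb lebesgue_measure_itv/= lte_fin.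
rewrite /tent; case: ifPn => [h|h].
  rewrite -EFinB; congr (_%:E).
  case: (leP z.1 z.2) h => [h1|h1] h.
    rewrite ler0_norm ?subr_le0// max_r; last by lra.
    lra.
  rewrite ger0_norm ?subr_ge0//; last by lra.
  rewrite max_r; last by lra.
  lra.
congr (_%:E).
case: (leP z.1 z.2) h => [h1|h1]; rewrite -leNgt => h.
  by rewrite ler0_norm ?subr_le0// max_l//; lra.
by rewrite ger0_norm ?subr_ge0//; [rewrite max_l//; lra | lra].
Qed.

Let measurable_window nu r : measurable_fun setT (fun s : T => nu (window r s)).
Proof.
pose W := [set p : T * T | (p.2 < p.1)%R /\ (p.1 <= p.2 + r)%R].
have mW : measurable W.
  have m1 : measurable_fun setT (fun p : T * T => p.1) by exact: measurable_fst.
  have m2 : measurable_fun setT (fun p : T * T => p.2) by exact: measurable_snd.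
  have m2r : measurable_fun setT (fun p : T * T => (p.2 + r)%R : T).
    by apply: measurable_funD => //; exact: measurable_cst.
  have := measurable_fun_ltr m2 m1; have := measurable_fun_ler m1 m2r.
  move=> /(_ measurableT [set true] I); rewrite setTI => h1.
  move=> /(_ measurableT [set true] I); rewrite setTI => h2.
  rewrite [W](_ : _ = [set p : T * T | (p.2 < p.1)%R] `&`
     [set p : T * T | (p.1 <= p.2 + r)%R]) //.
  exact: measurableI.
have -> : (fun s : T => nu (window r s)) = nu \o ysection W.
  apply/funext => s /=; congr (nu _); apply/seteqP; split => x /=;
    rewrite /window /= in_itv /= /ysection /= inE /W /=.
  - by move=> /andP[].
  - by move=> [-> ->].
exact: measurable_fun_ysection.
Qed.

(** The tent is the autocorrelation of a window, so exchanging integrals turns the double integral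
    into a product of window masses. *)
Lemma tent_energyE nu mu r : (0 < r)%R ->
  \int[nu \x mu]_z (tent r (z.1 - z.2))%:E =
  \int[leb]_s (nu (window r s) * mu (window r s)).
Proof.
move=> r0.
under eq_integral do rewrite -overlap_int//.
pose f := fun p : (T * T) * T => (\1_(overlap r) p : R)%:E.
have mf : measurable_fun setT f.
  by apply/measurable_EFinP; exact: measurable_indic.
transitivity (\int[leb]_s \int[(nu \x mu)%E]_z f (z, s)).
  have f0 x : 0 <= f x by rewrite lee_fin.
  exact: (@fubini_tonelli _ _ _ _ R (sprod nu mu) leb f mf f0).
apply: eq_integral => s _.
have -> : (fun z : T * T => (\1_(overlap r) (z, s) : R)%:E) =
          (fun z : T * T => (\1_(window r s `*` window r s) z : R)%:E).
  apply/funext => -[x y]; congr (_%:E); rewrite !indicE; congr (GRing.natmul 1%R (nat_of_bool _)).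
  apply/idP/idP; rewrite !inE /overlap /window /= !in_itv /=.
    by move=> [[-> ->] [-> ->]].
  by move=> [/andP[-> ->] /andP[-> ->]].
rewrite integral_indic//.
- by rewrite setIT; apply: (@product_measure1E _ _ _ _ R nu mu); exact: measurable_itv.
- by apply: measurableX; exact: measurable_itv.
Qed.

(** Pointwise [2 a b <= a ^ 2 + b ^ 2] for the two window masses. *)
Lemma tent_energy_pd nu mu r : (0 < r)%R ->
  2%:E * \int[nu \x mu]_z (tent r (z.1 - z.2))%:E <=
  \int[nu \x nu]_z (tent r (z.1 - z.2))%:E +
  \int[mu \x mu]_z (tent r (z.1 - z.2))%:E.
Proof.
move=> r0; rewrite !tent_energyE//.
have mnu := measurable_window nu r; have mmu := measurable_window mu r.
rewrite -ge0_integralZl//; [|exact: emeasurable_funM|by move=> *; exact: mule_ge0].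
rewrite -ge0_integralD//; [|by move=> *; exact: mule_ge0|exact: emeasurable_funM
  |by move=> *; exact: mule_ge0|exact: emeasurable_funM].
apply: ge0_le_integral => //.
- by move=> s _; rewrite !mule_ge0.
- by apply: measurable_funeM; exact: emeasurable_funM.
- by apply: emeasurable_funD; exact: emeasurable_funM.
move=> s _.
have [fa fb] : nu (window r s) \is a fin_num /\ mu (window r s) \is a fin_num.
  by split; apply: fin_num_measure; exact: measurable_itv.
rewrite -(fineK fa) -(fineK fb) -!EFinM -EFinD lee_fin.
set a := fine _; set b := fine _.
have := sqr_ge0 (a - b); nra.
Qed.

End TentKernel.

(** * The logarithm as a superposition of tents over all scales *)

Section LogKernel.
Context (R : realType).
Notation T := (measurableTypeR R).
Implicit Types (mu nu : probability T R) (L s u x : R).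
Let leb : {sigma_finite_measure set T -> \bar R} := @lebesgue_measure R.
Let sprod nu mu : probability (T * T)%type R := (nu \x mu)%E.

(** The tent of height 1 and half-width [exp (- s)]. *)
Definition bump s u : R := Num.max 0%R (1 - `|u| * expR s)%R.

Lemma bump_ge0 s u : (0 <= bump s u)%R.
Proof. by rewrite /bump le_max lexx. Qed.

Lemma bumpE s u : bump s u = (expR s * tent (expR (- s)) u)%R.
Proof.
rewrite /bump /tent; have e0 := expR_gt0 s.
rewrite maxr_pMr ?ltW// mulr0 mulrBr expRN mulfV ?gt_eqF//.
by rewrite mulrC.
Qed.

(* [log_kernel L] equals [L - 1 - ln |u|] up to an error [|u| exp (-L)]; being a
   superposition of the kernels [tent], it is positive definite. *)
Definition log_kernel L u : \bar R :=
  \int[leb]_(s in `[(- L)%R, +oo[) (bump s u)%:E.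

Lemma log_kernel_ge0 L u : 0 <= log_kernel L u.
Proof. by apply: integral_ge0 => s _; rewrite lee_fin bump_ge0. Qed.

Lemma measurable_bump u : measurable_fun [set: T] (fun s : T => bump s u).
Proof.
apply: measurable_maxr; first exact: measurable_cst.
apply: measurable_funB; first exact: measurable_cst.
by apply: measurable_funM; [exact: measurable_cst | exact: measurable_expR].
Qed.

(** The integrand vanishes beyond [s = - ln |u|], and up to there it has the primitive
    [s - |u| exp s]. *)
Lemma log_kernel_near L u : u != 0%R -> (`|u| < expR L)%R ->
  log_kernel L u = (L - 1 - ln `|u| + `|u| * expR (- L))%:E.
Proof.
move=> u0 uL; have au0 : (0 < `|u|)%R by rewrite normr_gt0.
pose b := (- ln `|u|)%R.
have Lb : (- L < b)%R by rewrite ltrN2 -ltr_expR lnK.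
have E : log_kernel L u = \int[leb]_(s in `[(- L)%R, b]) (1 - `|u| * expR s)%:E.
  rewrite /log_kernel integral_mkcond [RHS]integral_mkcond.
  apply: eq_integral => s _; rewrite !patchE.
  have ub : (1 - `|u| * expR s < 0)%R = (b < s)%R.
    rewrite subr_lt0 -{1}(lnK au0) -expRD -{1}expR0 ltr_expR.
    by rewrite -ltrBlDl sub0r.
  rewrite !mem_setE !in_itv /= andbT; case: (leP (- L)%R s) => //= _.
  by rewrite leNgt -ub /bump; case: ltP => h /=; rewrite ?max_l ?max_r// ltW.
rewrite E (@continuous_FTC2 _ _ (fun s => (s - `|u| * expR s)%R))//.
- rewrite -EFinB; congr (_%:E); rewrite /b expRN lnK// mulfV ?gt_eqF//.
  by rewrite opprB opprK; lra.
- apply: continuous_subspaceT => s; apply: cvgB; first exact: cvg_cst.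
  by apply: cvgM; [exact: cvg_cst|exact: continuous_expR].
- have c : continuous (fun s : R => (s - `|u| * expR s)%R).
    move=> s; apply: cvgB; first exact: cvg_id.
    by apply: cvgM; [exact: cvg_cst|exact: continuous_expR].
  split; [move=> s _| |].
  + exact: derivableB.
  + exact/cvg_at_right_filter/c.
  + exact/cvg_at_left_filter/c.
- move=> s _; rewrite derive1E; exact: derive_val.
Qed.

Lemma log_kernel0 L : log_kernel L 0 = +oo.
Proof.
rewrite /log_kernel.
under eq_integral do rewrite /bump normr0 mul0r subr0 max_r ?ler01//.
by rewrite integral_cst//= lebesgue_measure_itv/= ltry mul1e.
Qed.

(** The tangent at [exp L] lies above the concave logarithm. *)
Lemma ln_le_line L u : u != 0%R ->
  (ln `|u| <= L - 1 + `|u| * expR (- L))%R.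
Proof.
move=> u0; have au0 : (0 < `|u|)%R by rewrite normr_gt0.
have h : (0 < `|u| * expR (- L))%R by rewrite mulr_gt0// expR_gt0.
have := @le_ln1Dx R (`|u| * expR (- L) - 1)%R.
rewrite ltrBrDl subrr h addrC subrK => /(_ isT).
rewrite lnM ?posrE// ?expR_gt0// expRK; lra.
Qed.

(** For [|u| >= exp L] the kernel is 0 and the tangent line gives the bound; at [u = 0] the
    right-hand side is [+oo]. *)
Lemma log_kernel_le L u :
  log_kernel L u <= (L - 1 + `|u| * expR (- L))%:E - lne (`|u|%:E).
Proof.
have [->|u0] := eqVneq u 0%R.
  by rewrite normr0 /= lexx mul0r /= ?addey// leey.
have au0 : (0 < `|u|)%R by rewrite normr_gt0.
rewrite lne_EFin// -EFinB.
have [uL|Lu] := ltP (`|u|)%R (expR L).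
  by rewrite log_kernel_near// lee_fin; lra.
apply: (@le_trans _ _ 0); last by rewrite lee_fin subr_ge0; exact: ln_le_line.
rewrite /log_kernel integral0_eq// => s /=; rewrite in_itv/= andbT => Ls.
rewrite /bump max_l// subr_le0.
have : (expR L * expR (- L) <= `|u| * expR s)%R by rewrite ler_pM ?expR_ge0// ler_expR.
by rewrite -expRD subrr expR0.
Qed.

Lemma log_kernel_ge L u :
  (L - 1)%:E - lne (`|u|%:E) <= log_kernel L u.
Proof.
have [->|u0] := eqVneq u 0%R; first by rewrite log_kernel0 leey.
have au0 : (0 < `|u|)%R by rewrite normr_gt0.
rewrite lne_EFin// -EFinB.
have [uL|Lu] := ltP (`|u|)%R (expR L).
  rewrite log_kernel_near// lee_fin lerDl mulr_ge0 ?expR_ge0//.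
apply: (@le_trans _ _ 0); last exact: log_kernel_ge0.
rewrite lee_fin subr_le0; apply: (@le_trans _ _ L); first by lra.
by rewrite -(expRK L) ler_ln// posrE expR_gt0.
Qed.

Lemma measurable_log_abs_sub :
  measurable_fun [set: T * T] (fun z : T * T => lne (`|z.1 - z.2|%:E)).
Proof.
have mB : measurable_fun [set: T * T] (fun z : T * T => (z.1 - z.2)%R).
  by apply: measurable_funB; [exact: measurable_fst|exact: measurable_snd].
rewrite (_ : (fun z => _) = (fun z : T * T =>
   if (z.1 - z.2 == 0)%R then -oo else (ln `|z.1 - z.2|)%:E)); last first.
  apply/funext => z; case: ifPn => [/eqP ->|h]; first by rewrite normr0 /= lexx.
  by rewrite lne_EFin// normr_gt0.
apply: measurable_fun_ifT => //.
- by apply: measurable_fun_eqr => //; exact: measurable_cst.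
- apply/measurable_EFinP; apply: (measurableT_comp (@measurable_ln R)).
  exact: measurableT_comp.
Qed.

Let measurable_bump2 : measurable_fun [set: (T * T) * T]
  (fun p : (T * T) * T => bump p.2 (p.1.1 - p.1.2)).
Proof.
have mB : measurable_fun [set: (T * T) * T] (fun p : (T * T) * T => (p.1.1 - p.1.2)%R).
  apply: measurable_funB.
  - by apply: (measurableT_comp measurable_fst); exact: measurable_fst.
  - by apply: (measurableT_comp measurable_snd); exact: measurable_fst.
apply: measurable_maxr; first exact: measurable_cst.
apply: measurable_funB; first exact: measurable_cst.
apply: measurable_funM; first exact: measurableT_comp.
by apply: (measurableT_comp (@measurable_expR R)); exact: measurable_snd.
Qed.

Let bump_energy nu mu s : \bar R := \int[nu \x mu]_z (bump s (z.1 - z.2))%:E.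

Let bump_energy_pd nu mu s :
  2%:E * bump_energy nu mu s <= bump_energy nu nu s + bump_energy mu mu s.
Proof.
have E nu' mu' : bump_energy nu' mu' s = (expR s)%:E *
    \int[nu' \x mu']_z (tent (expR (- s)) (z.1 - z.2))%:E.
  rewrite /bump_energy; under eq_integral do rewrite bumpE EFinM.
  rewrite ge0_integralZl ?lee_fin ?expR_ge0//.
  - apply/measurable_EFinP.
    apply: measurable_maxr; first exact: measurable_cst.
    apply: measurable_funB; first exact: measurable_cst.
    apply: measurableT_comp => //.
    by apply: measurable_funB; [exact: measurable_fst|exact: measurable_snd].
  - by move=> z _; rewrite lee_fin tent_ge0.
rewrite !E muleCA -ge0_muleDr; last 2 first.
- by apply: integral_ge0 => z _; rewrite lee_fin tent_ge0.
- by apply: integral_ge0 => z _; rewrite lee_fin tent_ge0.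
by apply: lee_wpmul2l; [rewrite lee_fin expR_ge0|exact: tent_energy_pd (expR_gt0 _)].
Qed.

Let mbump_energy nu mu : measurable_fun [set: T] (fun s : T => bump_energy nu mu s).
Proof.
pose f := fun p : (T * T) * T => (bump p.2 (p.1.1 - p.1.2))%:E.
have mf : measurable_fun setT f by exact/measurable_EFinP.
have f0 p : 0 <= f p by rewrite lee_fin bump_ge0.
exact: (@measurable_fun_fubini_tonelli_G _ _ _ _ R (sprod nu mu) f mf f0).
Qed.

(** Exchanging the integrals reduces positive definiteness of the kernel to that of the bump at each
    scale. *)
Lemma log_kernel_energyE nu mu L :
  \int[nu \x mu]_z log_kernel L (z.1 - z.2) =
  \int[leb]_(s in `[(- L)%R, +oo[) bump_energy nu mu s.
Proof.
pose D : set T := `[(- L)%R, +oo[%classic.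
pose f := fun p : (T * T) * T => (bump p.2 (p.1.1 - p.1.2) * \1_D p.2)%:E.
have mf : measurable_fun setT f.
  apply/measurable_EFinP; apply: measurable_funM => //.
  by apply: measurableT_comp; [apply: measurable_indic; exact: measurable_itv|exact: measurable_snd].
have f0 p : 0 <= f p by rewrite lee_fin mulr_ge0// bump_ge0.
transitivity (\int[(nu \x mu)%E]_z \int[leb]_s f (z, s)).
  apply: eq_integral => z _; rewrite /log_kernel integral_mkcond.
  by apply: eq_integral => s _; rewrite epatch_indic /f EFinM.
transitivity (\int[leb]_s \int[(nu \x mu)%E]_z f (z, s)).
  exact: (@fubini_tonelli _ _ _ _ R (sprod nu mu) leb f mf f0).
rewrite [RHS]integral_mkcond; apply: eq_integral => s _.
rewrite epatch_indic /f /=.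
under eq_integral do rewrite EFinM.
rewrite ge0_integralZr//.
- by apply/measurable_EFinP; exact: (measurableT_comp measurable_bump2 (measurable_pair2 _)).
- by move=> z _; rewrite lee_fin bump_ge0.
Qed.

Lemma log_kernel_pd nu mu L :
  2%:E * \int[nu \x mu]_z log_kernel L (z.1 - z.2) <=
  \int[nu \x nu]_z log_kernel L (z.1 - z.2) +
  \int[mu \x mu]_z log_kernel L (z.1 - z.2).
Proof.
rewrite !log_kernel_energyE.
have ge0 nu' mu' s : 0 <= bump_energy nu' mu' s.
  by apply: integral_ge0 => z _; rewrite lee_fin bump_ge0.
have m0 nu' mu' : measurable_fun `[(- L)%R, +oo[ (fun s : T => bump_energy nu' mu' s).
  by apply: measurable_funTS; exact: mbump_energy.
rewrite -ge0_integralZl//; last exact: m0.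
rewrite -ge0_integralD//; [|exact: m0|exact: m0].
apply: ge0_le_integral => //.
- by move=> s _; rewrite mule_ge0.
- by apply: measurable_funeM; exact: m0.
- by apply: emeasurable_funD; exact: m0.
Qed.

Lemma measurable_log_kernel L :
  measurable_fun [set: T * T] (fun z : T * T => log_kernel L (z.1 - z.2)).
Proof.
pose D : set T := `[(- L)%R, +oo[%classic.
pose f := fun p : (T * T) * T => (bump p.2 (p.1.1 - p.1.2) * \1_D p.2)%:E.
have mf : measurable_fun setT f.
  apply/measurable_EFinP; apply: measurable_funM => //.
  by apply: measurableT_comp; [apply: measurable_indic; exact: measurable_itv|exact: measurable_snd].
have f0 p : 0 <= f p by rewrite lee_fin mulr_ge0// bump_ge0.
have := measurable_fun_fubini_tonelli_F (m2 := leb) f mf f0.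
congr (measurable_fun _ _); apply/funext => z; rewrite /fubini_F /log_kernel.
by rewrite [RHS]integral_mkcond; apply: eq_integral => s _; rewrite epatch_indic /f EFinM.
Qed.

End LogKernel.

(** * Mutual energy of two measures of nonnegative energy *)

Section CrossEnergy.
Context (R : realType).
Notation T := (measurableTypeR R).
Implicit Types (mu nu : probability T R) (L s u x m n c : R).
Let leb : {sigma_finite_measure set T -> \bar R} := @lebesgue_measure R.
Let sprod nu mu : probability (T * T)%type R := (nu \x mu)%E.

Lemma integral_prob_cst d (U : measurableType d) (P : probability U R) c :
  \int[P]_x c%:E = c%:E.
Proof.
rewrite integral_cst// [X in _ * X](_ : _ = 1) ?mule1//.
exact: (probability_setT P).
Qed.

(** Nonnegative because [log |a - b| <= |a| + |b|]. When the means are finite, an upper bound by the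
    sum of the means on the integral of this function expresses that the energy is nonnegative,
    without any difference of infinities. *)
Definition log_gap (z : T * T) : \bar R :=
  (`|z.1| + `|z.2|)%:E - lne (`|z.1 - z.2|%:E).

Lemma lne_abs_le u : lne (`|u|%:E) <= `|u|%:E.
Proof.
have [->|u0] := eqVneq u 0%R; first by rewrite normr0 /= lexx leNye.
have au0 : (0 < `|u|)%R by rewrite normr_gt0.
by rewrite lne_EFin// lee_fin ltW// ln_sublinear.
Qed.

Lemma lne_le_norms (z : T * T) : lne (`|z.1 - z.2|%:E) <= (`|z.1| + `|z.2|)%:E.
Proof. by apply: (le_trans (lne_abs_le _)); rewrite lee_fin ler_normB. Qed.

Lemma log_gap_ge0 z : 0 <= log_gap z.
Proof. by rewrite /log_gap sube_ge0 ?lne_le_norms//= orbT. Qed.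

Let mnorms : measurable_fun [set: T * T] (fun z : T * T => (`|z.1| + `|z.2|)%:E).
Proof.
apply/measurable_EFinP; apply: measurable_funD; exact: measurableT_comp.
Qed.

Lemma measurable_log_gap : measurable_fun [set: T * T] log_gap.
Proof. by apply: emeasurable_funB => //; exact: measurable_log_abs_sub. Qed.

Lemma integral_norms nu mu m n :
  \int[nu]_x `|x|%:E = m%:E -> \int[mu]_x `|x|%:E = n%:E ->
  \int[nu \x mu]_z (`|z.1| + `|z.2|)%:E = (m + n)%:E.
Proof.
move=> hm hn.
rewrite (@fubini_tonelli1 _ _ _ _ R nu mu (fun z => (`|z.1| + `|z.2|)%:E))//.
rewrite /fubini_F /=.
have mabs : measurable_fun [set: T] (fun y : T => `|y|%:E).
  by apply/measurable_EFinP; exact: normr_measurable.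
have E x : \int[mu]_y (`|x| + `|y|)%:E = `|x|%:E + n%:E.
  under eq_integral do rewrite EFinD.
  rewrite ge0_integralD//=.
  by rewrite hn; congr (_ + _); exact: integral_prob_cst.
under eq_integral do rewrite E.
have n0 : 0 <= n%:E by rewrite -hn; apply: integral_ge0 => *; rewrite lee_fin.
rewrite ge0_integralD//=.
by rewrite hm EFinD; congr (_ + _); exact: integral_prob_cst.
Qed.

(** The positive part of [f] is dominated by [N], hence has a finite integral, so nonnegativity of
    the integral of [f] means that the negative part integrates to no more. Now integrate the
    identity [(N - f) + f^+ = N + f^-], all of whose terms are nonnegative. *)
Lemma integral_sub_le d (U : measurableType d) (P : probability U R)
    (f : U -> \bar R) (N : U -> R) (n : R) :
  measurable_fun [set: U] f -> measurable_fun [set: U] N ->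
  (forall z, (0 <= N z)%R) -> (forall z, f z <= (N z)%:E) ->
  \int[P]_z (N z)%:E = n%:E -> 0 <= \int[P]_z f z ->
  \int[P]_z ((N z)%:E - f z) <= n%:E.
Proof.
move=> mf mN N0 fN hn; rewrite integralE => If.
have mNE : measurable_fun [set: U] (fun z => (N z)%:E) by exact/measurable_EFinP.
have mfp : measurable_fun setT f^\+ by exact: measurable_funepos.
have mfn : measurable_fun setT f^\- by exact: measurable_funeneg.
have g0 z : 0 <= (N z)%:E - f z by rewrite sube_ge0 ?fN//= orbT.
have mg : measurable_fun [set: U] (fun z => (N z)%:E - f z) by exact: emeasurable_funB.
have fp_le z : f^\+ z <= (N z)%:E by rewrite funeposE ge_max fN lee_fin N0.
have Ip : \int[P]_z f^\+ z <= n%:E by rewrite -hn; apply: ge0_le_integral.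
have Ip0 : 0 <= \int[P]_z f^\+ z by apply: integral_ge0 => z _; exact: funepos_ge0.
have Ifin : \int[P]_z f^\+ z \is a fin_num.
  by rewrite ge0_fin_numE// (le_lt_trans Ip)// ltry.
move: If; rewrite sube_ge0; last by rewrite Ifin orbT.
move=> In.
have E : \int[P]_z ((N z)%:E - f z) + \int[P]_z f^\+ z =
    n%:E + \int[P]_z f^\- z.
  rewrite -hn -!ge0_integralD//.
  all: try (by move=> z _; rewrite ?lee_fin ?N0 ?g0 ?funepos_ge0 ?funeneg_ge0).
  apply: eq_integral => z _; rewrite funeposE funenegE.
  have := fN z; case: (f z) => [r| |] //= h.
  - rewrite -[maxe r%:E 0]/(maxe r%:E 0%:E) -[maxe (- r)%:E 0]/(maxe (- r)%:E 0%:E).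
    rewrite -!EFin_max; congr (_%:E); rewrite /Order.max /=.
    by case: ifPn; rewrite -?leNgt => h1; case: ifPn; rewrite -?leNgt => h2; lra.
  - by rewrite maxNye maxye adde0.
rewrite -(leeD2rE _ _ Ifin) E; apply: leeD2l; exact: In.
Qed.

Lemma log_gap_self_le nu m : \int[nu]_x `|x|%:E = m%:E -> 0 <= log_energy nu ->
  \int[nu \x nu]_z log_gap z <= (m + m)%:E.
Proof.
move=> hm Inu.
apply: (@integral_sub_le _ _ (sprod nu nu) _ (fun z : T * T => (`|z.1| + `|z.2|)%R)) => //.
- exact: measurable_log_abs_sub.
- exact/measurable_EFinP.
- exact: lne_le_norms.
- exact: (integral_norms hm hm).
Qed.

(* With [N z = |z.1| + |z.2|], so that [log_gap = N - log] is nonnegative, the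
   positive definite kernel [log_kernel L] lies between [L - 1 - log] and
   [L - 1 - log + exp (-L) N]; let [L] tend to infinity. *)
Lemma log_gap_cross_le nu mu m n :
  \int[nu]_x `|x|%:E = m%:E -> \int[mu]_x `|x|%:E = n%:E ->
  0 <= log_energy nu -> 0 <= log_energy mu ->
  \int[nu \x mu]_z log_gap z <= (m + n)%:E.
Proof.
move=> hm hn Inu Imu.
have m0 : (0 <= m)%R by rewrite -lee_fin -hm; apply: integral_ge0 => *; rewrite lee_fin.
have n0 : (0 <= n)%R by rewrite -lee_fin -hn; apply: integral_ge0 => *; rewrite lee_fin.
(* The upper half of the sandwich, for the energy of a single measure; nonnegativity of that energy
   enters through [log_gap_self_le]. The condition [1 <= L] keeps the constant [L - 1]
   nonnegative. *)
have kern (rho : probability T R) (r : R) L : (1 <= L)%R ->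
    \int[rho]_x `|x|%:E = r%:E -> 0 <= log_energy rho ->
    \int[rho \x rho]_z log_kernel L (z.1 - z.2) <= (L - 1 + (r + r) * expR (- L))%:E.
  move=> L1 hr Irho.
  have := log_gap_self_le hr Irho => gle.
  have r0 : (0 <= r)%R by rewrite -lee_fin -hr; apply: integral_ge0 => *; rewrite lee_fin.
  have nfin : ((r + r)%:E : \bar R) \is a fin_num by [].
  rewrite -(leeD2rE _ _ nfin) -{1}(integral_norms hr hr) -ge0_integralD//; last 2 first.
  - by move=> z _; exact: log_kernel_ge0.
  - exact: measurable_log_kernel.
  apply: (@le_trans _ _ (\int[rho \x rho]_z ((L - 1)%:E +
      ((expR (- L))%:E * (`|z.1| + `|z.2|)%:E + log_gap z)))).
    apply: ge0_le_integral => //.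
    - by move=> z _; rewrite adde_ge0// log_kernel_ge0.
    - by apply: emeasurable_funD => //; exact: measurable_log_kernel.
    - apply: emeasurable_funD; first exact: measurable_cst.
      by apply: emeasurable_funD; [apply: measurable_funeM; exact: mnorms|exact: measurable_log_gap].
    move=> z _; rewrite /log_gap.
    have := log_kernel_le L (z.1 - z.2); set k := log_kernel _ _.
    have := lne_le_norms z; have := ler_normB z.1 z.2; have := expR_gt0 (- L).
    case: (lne _) => [a| |] e0 tri h kle; [| by rewrite leye_eq in h |by rewrite -EFinM; exact: leey].
    rewrite -EFinB -EFinM -!EFinD.
    apply: (@le_trans _ _ (((L - 1 + `|z.1 - z.2| * expR (- L))%:E - a%:E) + (`|z.1| + `|z.2|)%:E)).
      exact: leeD2r.
    rewrite -EFinB -EFinD lee_fin.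
    have : (`|z.1 - z.2| * expR (- L) <= (`|z.1| + `|z.2|) * expR (- L))%R.
      by rewrite ler_pM2r.
    lra.
  rewrite ge0_integralD//; last 3 first.
  - by move=> z _; rewrite lee_fin subr_ge0.
  - by move=> z _; rewrite adde_ge0 ?log_gap_ge0// mule_ge0// lee_fin ?expR_ge0 ?addr_ge0.
  - by apply: emeasurable_funD; [apply: measurable_funeM; exact: mnorms|exact: measurable_log_gap].
  rewrite ge0_integralD//.
  all: try (by move=> z _; exact: log_gap_ge0).
  all: try exact: measurable_log_gap.
  all: try (by move=> z _; rewrite mule_ge0// lee_fin ?expR_ge0 ?addr_ge0).
  all: try (by apply: measurable_funeM; exact: mnorms).

  rewrite ge0_integralZl// ?lee_fin ?expR_ge0//.
  rewrite (integral_norms hr hr) (_ : \int[_]_z _ = (L - 1)%:E); last exact: (integral_prob_cst (sprod rho rho)).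
  rewrite -EFinM addeA -EFinD [leRHS]EFinD.
  by rewrite [((r + r) * _)%R]mulrC; apply: leeD2l.
apply/lee_addgt0Pr => e e0.
have [L [L1 Le]] : exists L : R, (1 <= L)%R /\ ((m + n) * expR (- L) <= e)%R.
  (* Large enough because [exp L >= 1 + L >= (m + n) / e]. *)
  exists (1 + (m + n) / e)%R; split; first by rewrite lerDl divr_ge0 ?addr_ge0// ltW.
  rewrite expRN ler_pdivrMr ?expR_gt0//.
  have := expR_ge1Dx (1 + (m + n) / e)%R; set E := expR _ => h.
  have -> : (m + n = e * ((m + n) / e))%R by rewrite mulrC divfK// gt_eqF.
  by rewrite ler_pM2l//; lra.
have K1 := kern nu m L L1 hm Inu; have K2 := kern mu n L L1 hn Imu.
have K3 := log_kernel_pd nu mu L.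
have K4 : 2%:E * \int[nu \x mu]_z log_kernel L (z.1 - z.2) <=
    2%:E * (L - 1 + (m + n) * expR (- L))%:E.
  apply: (le_trans K3); apply: (le_trans (leeD K1 K2)).
  by rewrite -EFinM -EFinD lee_fin; lra.
rewrite lee_pmul2l// in K4.
have nfin : ((L - 1)%:E : \bar R) \is a fin_num by [].
rewrite -(leeD2lE _ _ nfin).
have <- : \int[nu \x mu]_z (L - 1)%:E = (L - 1)%:E.
  exact: (integral_prob_cst (sprod nu mu)).
rewrite -ge0_integralD//; last 3 first.
- by move=> z _; rewrite lee_fin subr_ge0.
- by move=> z _; exact: log_gap_ge0.
- exact: measurable_log_gap.
apply: (@le_trans _ _ (\int[nu \x mu]_z (log_kernel L (z.1 - z.2) + (`|z.1| + `|z.2|)%:E))).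
  apply: ge0_le_integral => //.
  - by move=> z _; rewrite adde_ge0 ?log_gap_ge0// lee_fin subr_ge0.
  - by apply: emeasurable_funD; [exact: measurable_cst|exact: measurable_log_gap].
  - by apply: emeasurable_funD => //; exact: measurable_log_kernel.
  move=> z _; rewrite /log_gap.
  have := log_kernel_ge L (z.1 - z.2); set k := log_kernel _ _.
  by rewrite addeCA [k + _]addeC => h; apply: leeD2l.
rewrite ge0_integralD//; last 2 first.
- by move=> z _; exact: log_kernel_ge0.
- exact: measurable_log_kernel.
rewrite (integral_norms hm hn).
rewrite [\int[_]_z (L - 1)%:E](_ : _ = (L - 1)%:E); last first.
  exact: (integral_prob_cst (sprod nu mu)).
apply: (le_trans (leeD2r _ K4)).
by rewrite -!EFinD lee_fin; lra.
Qed.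

End CrossEnergy.

(** * Probability measures given by a density *)

Section Density.
Context (R : realType).
Notation T := (measurableTypeR R).
Let leb : {sigma_finite_measure set T -> \bar R} := @lebesgue_measure R.
Variable p : T -> R.
Hypothesis mp : measurable_fun [set: T] p.
Hypothesis p0 : forall y, (0 <= p y)%R.
Hypothesis p1 : \int[leb]_y (p y)%:E = 1.

Let P (A : set T) : \bar R := \int[leb]_(y in A) (p y)%:E.

Let mpE (A : set T) : measurable_fun A (fun y => (p y)%:E).
Proof. by apply: measurable_funTS; exact/measurable_EFinP. Qed.

Let P0 : P set0 = 0.
Proof. by rewrite /P integral_set0. Qed.

Let Pge0 A : 0 <= P A.
Proof. by apply: integral_ge0 => y _; rewrite lee_fin. Qed.

Let Psigma : semi_sigma_additive P.
Proof.
move=> /= A mA tA mUA; rewrite /P /= ge0_integral_bigcup//=; last first.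
  by move=> y _; rewrite lee_fin.
apply: is_cvg_ereal_nneg_natsum_cond => n _ _.
by apply: integral_ge0 => y _; rewrite lee_fin.
Qed.

Let PM : {measure set T -> \bar R} :=
  HB.pack P (isMeasure.Build _ T R P P0 Pge0 Psigma).

Let PT : PM [set: T] = 1.
Proof. exact: p1. Qed.

Let PP : probability T R :=
  HB.pack (PM : set T -> \bar R) (Measure.class PM)
    (Measure_isProbability.Build _ T R PM PT).

Import HBNNSimple.

Let simple_density (g : {nnsfun T >-> R}) :
  \int[PP]_y (g y)%:E = \int[leb]_y ((g y)%:E * (p y)%:E).
Proof.
rewrite integralT_nnsfun sintegralE.
pose h r (y : T) : \bar R := (r * \1_(g @^-1` [set r]) y)%:E.
have h0 r y : 0 <= h r y by exact: nnfun_muleindic_ge0.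
have mh r : measurable_fun [set: T] (h r).
  by apply/measurable_EFinP; exact: measurable_funM.
under [RHS]eq_integral => y _.
  rewrite fimfunE -fsumEFin// ge0_mule_fsuml; last by move=> r; exact: h0.
  over.
rewrite ge0_integral_fsum//; last 2 first.
- move=> r; apply: emeasurable_funM; [exact: mh|exact: mpE].
- by move=> r y _; rewrite mule_ge0// ?lee_fin//; exact: h0.
apply: eq_fsbigr => r; rewrite inE => -[y0 _ r0].
under eq_integral do rewrite EFinM -muleA.
rewrite ge0_integralZl//.
- congr (_ * _); rewrite [LHS]integral_mkcond; apply: eq_integral => y _.
  by rewrite epatch_indic muleC.
- by apply: emeasurable_funM; [exact/measurable_EFinP|exact: mpE].
- by move=> y _; rewrite mule_ge0 ?lee_fin.
- by rewrite -r0 lee_fin.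
Qed.

(** Monotone convergence from simple functions. *)
Let integral_density (f : T -> \bar R) : measurable_fun [set: T] f ->
  (forall y, 0 <= f y) -> \int[PP]_y f y = \int[leb]_y (f y * (p y)%:E).
Proof.
move=> mf f0; pose h := nnsfun_approx measurableT mf.
have fE y : f y = lim ((h n y)%:E @[n --> \oo]).
  by apply/esym/cvg_lim => //; exact: cvg_nnsfun_approx.
have fpE y : f y * (p y)%:E = lim ((h n y)%:E * (p y)%:E @[n --> \oo]).
  apply/esym/cvg_lim => //; apply: cvgeZr => //; exact: cvg_nnsfun_approx.
have nd y : {homo (fun n => (h n y)%:E) : a b / (a <= b)%N >-> a <= b}.
  by move=> a b ab; rewrite lee_fin; exact/lefP/nd_nnsfun_approx.
under eq_integral do rewrite fE.
under [RHS]eq_integral do rewrite fpE.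
rewrite !monotone_convergence//.
all: try (by move=> n; apply: emeasurable_funM; [exact/measurable_EFinP|exact: mpE]).
all: try (by move=> n y _; rewrite mule_ge0 ?lee_fin).
all: try (by move=> y _ a b ab; rewrite lee_wpmul2r ?lee_fin ?p0//; exact: nd).
all: try (by move=> n; exact/measurable_EFinP).
all: try (by move=> n y _; rewrite lee_fin).
all: try (by move=> y _ a b ab; exact: nd).
by apply: congr_lim; apply/funext => n; exact: simple_density.
Qed.

(** The measure enters the sequel only through this integration formula. *)
Lemma exists_probability_density :
  exists mu : probability T R, forall f : T -> \bar R,
    measurable_fun [set: T] f -> (forall y, 0 <= f y) ->
    \int[mu]_y f y = \int[leb]_y (f y * (p y)%:E).
Proof. by exists PP; exact: integral_density. Qed.

End Density.

(** * Fundamental theorem of calculus with singular endpoints *)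

Section SingularFTC.
Context (R : realType).
Notation T := (measurableTypeR R).
Let leb : {sigma_finite_measure set T -> \bar R} := @lebesgue_measure R.

(** The integrand may blow up at the ends, as a logarithm does. Exhaust the open interval by compact
    ones: the integrals converge because [f] is nonnegative, the increments of [F] because it is
    continuous at both ends. *)
Lemma ge0_continuous_FTC_oo (f F : R -> R) (a b : R) : (a < b)%R ->
  (forall y, (a < y < b)%R -> (0 <= f y)%R) ->
  (forall y, (a < y < b)%R -> {for y, continuous f}) ->
  (forall y, (a < y < b)%R -> is_derive y (1%R : R) F (f y)) ->
  {for a, continuous F} -> {for b, continuous F} ->
  \int[leb]_(y in `]a, b[) (f y)%:E = (F b - F a)%:E.
Proof.
move=> ab f0 cf dF ca cb.
(* The denominator starts at 3 so that [a + d n < b - d n] for every [n]. *)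
pose d (n : nat) := ((b - a) / n.+3%:R)%R.
have d0 n : (0 < d n)%R by rewrite divr_gt0 ?subr_gt0.
have dlt n : (a + d n < b - d n)%R.
  rewrite -subr_gt0 [X in (0 < X)%R](_ : _ = (b - a) - d n * 2)%R; last by ring.
  rewrite subr_gt0 /d mulrAC ltr_pdivrMr// ltr_pM2l ?subr_gt0//.
  by rewrite (ltr_nat R 2 n.+3).
have dcvg : d n @[n --> \oo] --> (0 : R)%R.
  rewrite -[X in _ --> X](mulr0 (b - a)%R); apply: cvgM; first exact: cvg_cst.
  have := @cvg_harmonic R; rewrite -(cvg_shiftn 2) /harmonic /=.
  by under eq_fun do rewrite addn2.
pose E (n : nat) : set T := `[(a + d n)%R, (b - d n)%R]%classic.
have nE : nondecreasing_seq E.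
  move=> n m nm; rewrite subsetEset => y; rewrite /E /= !in_itv /=.
  have dd : (d m <= d n)%R.
    by rewrite ler_pM2l ?subr_gt0// lef_pV2 ?posrE// ler_nat !ltnS.
  move=> /andP[h1 h2]; apply/andP; split.
    by apply: le_trans h1; rewrite lerD2l.
  by apply: (le_trans h2); rewrite lerD2l lerN2.
have UE : `]a, b[%classic = \bigcup_n E n :> set T.
  apply/seteqP; split => y; rewrite /= in_itv /=.
    move=> /andP[ay yb].
    have [n hn] : exists n, (d n <= Num.min (y - a) (b - y))%R.
      have m0 : (0 < Num.min (y - a) (b - y))%R by rewrite lt_min !subr_gt0 ay.
      have /cvgrPdist_le /(_ _ m0)[n _ /(_ n (leqnn n))] := dcvg.
      by rewrite sub0r normrN gtr0_norm// => h; exists n.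
    exists n => //; rewrite /E /= in_itv /=; move: hn; rewrite le_min => /andP[h1 h2].
    by apply/andP; split; lra.
  move=> [n _]; rewrite /E /= in_itv /= => /andP[h1 h2]; have := d0 n.
  by move=> h3; apply/andP; split; lra.
have sub n y : E n y -> (a < y < b)%R.
  rewrite /E /= in_itv /= => /andP[h1 h2]; have := d0 n.
  by move=> h3; apply/andP; split; lra.
have intE n : \int[leb]_(y in E n) (f y)%:E = (F (b - d n) - F (a + d n))%:E.
  have cF y : (a < y < b)%R -> {for y, continuous F}.
    move=> hy; apply: differentiable_continuous; apply/derivable1_diffP.
    exact: (@ex_derive _ _ _ _ _ _ _ (dF y hy)).
  have sa : (a < a + d n < b)%R by have := d0 n; have := dlt n => *; apply/andP; split; lra.
  have sb : (a < b - d n < b)%R by have := d0 n; have := dlt n => *; apply/andP; split; lra.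
  rewrite (@continuous_FTC2 _ f F)//.
  - apply: continuous_in_subspaceT => y /[!inE] hy; exact: cf (sub _ _ hy).
  - split.
    + move=> y /[!in_itv]/= hy; apply: (@ex_derive _ _ _ _ _ _ _ (dF y _)).
      by apply: (sub n); rewrite /E /= in_itv /=; case/andP: hy => *; apply/andP; split; exact: ltW.
    + exact: cvg_at_right_filter (cF _ sa).
    + exact: cvg_at_left_filter (cF _ sb).
  - move=> y /[!in_itv]/= hy; rewrite derive1E.
    apply: (@derive_val _ _ _ _ _ _ _ (dF y _)).
    by apply: (sub n); rewrite /E /= in_itv /=; case/andP: hy => *; apply/andP; split; exact: ltW.
have mf n : measurable_fun (E n) (fun y => (f y)%:E).
  apply/measurable_EFinP; apply: subspace_continuous_measurable_fun.
    exact: measurable_itv.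
  by apply: continuous_in_subspaceT => y /[!inE] hy; exact: cf (sub _ _ hy).
have c1 : \int[leb]_(y in E n) (f y)%:E @[n --> \oo] --> \int[leb]_(y in \bigcup_n E n) (f y)%:E.
  apply: ge0_nondecreasing_set_cvg_integral => //.
  - by move=> n; exact: measurable_itv.
  - by move=> n y hy; rewrite lee_fin f0//; exact: sub hy.
suff c2 : \int[leb]_(y in E n) (f y)%:E @[n --> \oo] --> (F b - F a)%:E.
  by rewrite UE; exact: (cvg_unique _ c1 c2).
rewrite (_ : (fun n => _) = (fun n => (F (b - d n) - F (a + d n))%:E)); last first.
  by apply/funext => n; exact: intE.
apply: cvg_EFin; first by near=> n.
have bd : (b - d n)%R @[n --> \oo] --> b.
  by rewrite -[X in _ --> X](subr0 b); apply: cvgB => //; exact: cvg_cst.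
have ad : (a + d n)%R @[n --> \oo] --> a.
  by rewrite -[X in _ --> X](addr0 a); apply: cvgD => //; exact: cvg_cst.
by apply: cvgB; [exact: (cvg_comp _ _ bd cb)|exact: (cvg_comp _ _ ad ca)].
Unshelve. all: by end_near.
Qed.

End SingularFTC.

(** * Iterated primitives of the logarithm *)

Section LogPrimitives.
Context (R : realType).
Notation T := (measurableTypeR R).
Implicit Types (u v x y t B al be ga : R).
Let leb : {sigma_finite_measure set T -> \bar R} := @lebesgue_measure R.
Local Open Scope ring_scope.

(** This and [log_prim2] are the first and second primitives of [ln |u|]. With [ln 0 = 0] both take
    at 0 the value 0 that makes them continuous. *)
Definition log_prim1 u : R := u * ln `|u| - u.
Definition log_prim2 u : R := u ^+ 2 / 2 * ln `|u| - 3 / 4 * u ^+ 2.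

Lemma log_prim2N u : log_prim2 (- u) = log_prim2 u.
Proof. by rewrite /log_prim2 normrN sqrrN. Qed.

Lemma is_derive_ln_abs u : u != 0 -> is_derive u (1 : R) (fun v => ln `|v|) u^-1.
Proof.
rewrite neq_lt => /orP[u0|u0].
- apply: (@near_eq_is_derive _ _ _ (@ln R \o -%R)) => /=.
    by near=> v; rewrite /= ltr0_norm//; near: v; exact: lt_nbhsl.
  have Nu0 : 0 < - u by rewrite oppr_gt0.
  have h1 := is_derive1_ln Nu0.
  have h2 : is_derive u (1 : R) (-%R : R -> R) (-1) by exact: is_deriveNid.
  by apply: is_derive_eq; rewrite invrN mulrN1 opprK.
- apply: (@near_eq_is_derive _ _ _ (@ln R)) => /=.
    by near=> v; rewrite gtr0_norm//; near: v; exact: lt_nbhsr.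
  exact: is_derive1_ln.
Unshelve. all: by end_near.
Qed.

(** From [ln v <= v] at [v = 1 / sqrt u]. *)
Lemma abs_ln_le u : 0 < u -> u <= 1 -> `|u * ln u| <= 2 * Num.sqrt u.
Proof.
move=> u0 u1; have s0 : 0 < Num.sqrt u by rewrite sqrtr_gt0.
have su : u = Num.sqrt u * Num.sqrt u by rewrite -expr2 sqr_sqrtr ?ltW.
have lu : ln u = 2 * ln (Num.sqrt u) by rewrite {1}su lnM ?posrE//; ring.
have l0 : ln u <= 0 by rewrite ln_le0.
rewrite ler0_norm; last by rewrite mulr_ge0_le0// ltW.
have h : - ln (Num.sqrt u) <= (Num.sqrt u)^-1.
  by rewrite -lnV ?posrE// ltW// ln_sublinear// invr_gt0.
rewrite lu -mulrN -mulrN mulrCA ler_pM2l// {1}su -mulrA.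
apply: (@le_trans _ _ (Num.sqrt u * (Num.sqrt u * (Num.sqrt u)^-1))).
  by rewrite ler_pM2l// ler_pM2l.
by rewrite mulfV ?gt_eqF// mulr1.
Qed.

Lemma continuous_mul_ln : {for 0, continuous (fun u : R => u * ln `|u|)}.
Proof.
rewrite /prop_for /continuous_at mul0r.
apply: (@squeeze_cvgr _ _ _ _ (fun u : R => - (2 * Num.sqrt `|u|))
                             (fun u : R => 2 * Num.sqrt `|u|)).
- near=> u; rewrite -ler_norml.
  have [->|u0] := eqVneq u 0; first by rewrite mul0r normr0 mulr_ge0// sqrtr_ge0.
  rewrite -[X in X <= _](_ : `| `|u| * ln `|u| | = _); last by rewrite !normrM normr_id.
  apply: abs_ln_le; first by rewrite normr_gt0.
  near: u; exists 1 => //= v; rewrite /ball /= sub0r normrN => h; exact: ltW.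
- rewrite -[X in _ --> X]oppr0; apply: cvgN.
  rewrite -[X in _ --> X](mulr0 (2:R)); apply: cvgM; first exact: cvg_cst.
  rewrite -[X in _ --> X](@sqrtr0 R) -[X in Num.sqrt X](@normr0 _ R).
  exact: (cvg_comp _ _ (@norm_continuous _ R 0) (@sqrt_continuous R _)).
- rewrite -[X in _ --> X](mulr0 (2:R)); apply: cvgM; first exact: cvg_cst.
  rewrite -[X in _ --> X](@sqrtr0 R) -[X in Num.sqrt X](@normr0 _ R).
  exact: (cvg_comp _ _ (@norm_continuous _ R 0) (@sqrt_continuous R _)).
Unshelve. all: by end_near.
Qed.

Lemma continuous_mul_ln_all : continuous (fun u : R => u * ln `|u|).
Proof.
move=> u; have [->|u0] := eqVneq u 0; first exact: continuous_mul_ln.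
have c : {for u, continuous (fun v : R => ln `|v|)}.
  apply: differentiable_continuous; apply/derivable1_diffP.
  exact: (@ex_derive _ _ _ _ _ _ _ (is_derive_ln_abs u0)).
by apply: cvgM; [exact: cvg_id|exact: c].
Qed.

Lemma continuous_log_prim1 : continuous log_prim1.
Proof. by move=> u; apply: cvgB; [exact: continuous_mul_ln_all|exact: cvg_id]. Qed.

Lemma continuous_log_prim2 : continuous log_prim2.
Proof.
have -> : log_prim2 = (fun u => (u / 2) * (u * ln `|u|) - 3 / 4 * u ^+ 2).
  by apply/funext => u; rewrite /log_prim2; ring.
move=> u; apply: cvgB.
- apply: cvgM; last exact: continuous_mul_ln_all.
  by apply: cvgM; [exact: cvg_id|exact: cvg_cst].
- apply: cvgM; first exact: cvg_cst; exact: exprn_continuous.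
Qed.

(* Primitive in [y] of [(y - t) * (al + be * y - ga * ln |y - x|)]. *)
Definition hat_prim al be ga x t y : R :=
  al * (y - t) ^+ 2 / 2 + be * (y ^+ 3 / 3 - t * y ^+ 2 / 2)
  - ga * ((y - t) * log_prim1 (y - x) - log_prim2 (y - x)).

Lemma continuous_hat_prim al be ga x t : continuous (hat_prim al be ga x t).
Proof.
move=> y.
have sB z : (fun y : R => y - z) @ y --> y - z.
  by apply: cvgB; [exact: cvg_id|exact: cvg_cst].
have X n : (fun y : R => y ^+ n) @ y --> y ^+ n by exact: exprn_continuous.
apply: cvgB; first apply: cvgD.
- apply: cvgM; last exact: cvg_cst.
  apply: cvgM; first exact: cvg_cst.
  exact: (cvg_comp _ _ (sB t) (@exprn_continuous R 2 _)).
- apply: cvgM; first exact: cvg_cst.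
  apply: cvgB; first by apply: cvgM; [exact: X|exact: cvg_cst].
  by apply: cvgM; [apply: cvgM; [exact: cvg_cst|exact: X]|exact: cvg_cst].
- apply: cvgM; first exact: cvg_cst.
  apply: cvgB.
    by apply: cvgM; [exact: sB|exact: (cvg_comp _ _ (sB x) (@continuous_log_prim1 _))].
  exact: (cvg_comp _ _ (sB x) (@continuous_log_prim2 _)).
Qed.

Lemma is_derive_hat_prim al be ga x t y : y != x ->
  is_derive y (1 : R) (hat_prim al be ga x t)
    ((y - t) * (al + be * y - ga * ln `|y - x|)).
Proof.
move=> yx; have u0 : y - x != 0 by rewrite subr_eq0.
have dl : is_derive y (1 : R) (fun y : R => ln `|y - x|) (y - x)^-1.
  have h1 := is_derive_ln_abs u0.
  have h2 : is_derive y (1 : R) (fun y : R => y - x) 1.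
    by apply: is_derive_eq; rewrite subr0.
  have := @is_derive1_comp R (fun v => ln `|v|) (fun y => y - x) y _ _ h1 h2.
  by rewrite mulr1.
rewrite /hat_prim /log_prim1 /log_prim2.
apply: is_derive_eq.
rewrite /GRing.scale /=.
by field.
Qed.
End LogPrimitives.

(** * Mass, mean and potential of a piecewise linear density *)

Section PiecewiseLinear.
Context (R : realType).
Notation T := (measurableTypeR R).
Implicit Types (x y t B al be ga : R) (ks : seq (R * R)).
Let leb : {sigma_finite_measure set T -> \bar R} := @lebesgue_measure R.
Local Open Scope ring_scope.

Lemma measurable_log_weight al be ga x :
  measurable_fun [set: T] (fun y : T => al + be * y - ga * ln `|y - x|).
Proof.
have mB : measurable_fun [set: T] (fun y : T => y - x).
  by apply: measurable_funB; [exact: measurable_id|exact: measurable_cst].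
apply: measurable_funB.
- apply: measurable_funD; first exact: measurable_cst.
  by apply: measurable_funM; [exact: measurable_cst|exact: measurable_id].
- apply: measurable_funM; first exact: measurable_cst.
  by apply: (measurableT_comp (@measurable_ln R)); exact: measurableT_comp.
Qed.

(** If the singularity [x] is interior, split there: the two values of the continuous primitive at
    [x] cancel. Nonnegativity of the weight is what the singular form of the fundamental theorem
    asks for. *)
Lemma integral_linear_log al be ga x t B : t < B ->
  (forall y, t < y < B -> 0 <= al + be * y - ga * ln `|y - x|) ->
  (\int[leb]_(y in `]t, B[) ((y - t) * (al + be * y - ga * ln `|y - x|))%:E =
  (hat_prim al be ga x t B - hat_prim al be ga x t t)%:E)%E.
Proof.
move=> tB w0; set f := fun y => (y - t) * (al + be * y - ga * ln `|y - x|).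
set F := hat_prim al be ga x t.
have mf : measurable_fun [set: T] (fun y : T => (f y)%:E).
  apply/measurable_EFinP; apply: measurable_funM; last exact: measurable_log_weight.
  by apply: measurable_funB; [exact: measurable_id|exact: measurable_cst].
have f0 y : t < y < B -> 0 <= f y.
  by move=> h; rewrite mulr_ge0 ?w0//; case/andP: h => h _; rewrite subr_ge0 ltW.
have cf y : y != x -> {for y, continuous f}.
  move=> yx; apply: cvgM.
    by apply: cvgB; [exact: cvg_id|exact: cvg_cst].
  apply: cvgB.
    apply: cvgD; first exact: cvg_cst.
    by apply: cvgM; [exact: cvg_cst|exact: cvg_id].
  apply: cvgM; first exact: cvg_cst.
  have u0 : y - x != 0 by rewrite subr_eq0.
  have c : {for (y - x), continuous (fun v : R => ln `|v|)}.
    apply: differentiable_continuous; apply/derivable1_diffP.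
    exact: (@ex_derive _ _ _ _ _ _ _ (is_derive_ln_abs u0)).
  have sB : (fun y : R => y - x) @ y --> y - x.
    by apply: cvgB; [exact: cvg_id|exact: cvg_cst].
  exact: (cvg_comp _ _ sB c).
have cF : continuous F by exact: continuous_hat_prim.
have piece a b : t <= a -> a < b -> b <= B -> (x <= a) || (b <= x) ->
    (\int[leb]_(y in `]a, b[) (f y)%:E = (F b - F a)%:E)%E.
  move=> ta ab bB hx.
  have ne y : a < y < b -> y != x.
    move=> /andP[h1 h2]; case/orP: hx => h.
      by rewrite gt_eqF// (le_lt_trans h).
    by rewrite lt_eqF// (lt_le_trans h2).
  have f1 y : a < y < b -> 0 <= f y.
    move=> /andP[h1 h2]; apply: f0; apply/andP; split.
      exact: le_lt_trans h1.
    exact: lt_le_trans bB.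
  have c1 y : a < y < b -> {for y, continuous f} by move=> /ne; exact: cf.
  have d1 y : a < y < b -> is_derive y (1 : R) F (f y).
    by move=> /ne; exact: is_derive_hat_prim.
  exact: (@ge0_continuous_FTC_oo R f F a b ab f1 c1 d1 (cF a) (cF b)).
have [xt|tx] := leP x t; first by rewrite piece// xt.
have [Bx|xB] := leP B x; first by rewrite piece// Bx orbT.
have U : `]t, B[%classic = `]t, x]%classic `|` `]x, B[%classic :> set T.
  apply/seteqP; split => y; rewrite /= !in_itv /=.
    by move=> /andP[h1 h2]; have [yx|xy] := leP y x; [left|right]; rewrite ?h1 ?h2.
  by move=> [/andP[h1 h2]|/andP[h1 h2]]; rewrite ?h1 ?h2 ?andbT//=;
    [exact: le_lt_trans xB|exact: lt_trans h1].
rewrite U ge0_integral_setU//.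
- rewrite -integral_itv_bndo_bndc; last exact: measurable_funTS.
  rewrite piece ?lexx ?orbT//; last exact: ltW.
  rewrite piece ?lexx//; last exact: ltW.
  by rewrite -EFinD; congr (_%:E); ring.
- exact: measurable_funTS.
- by move=> y; rewrite -U /= in_itv /= => h; rewrite lee_fin f0.
- apply/disj_setPS => y [] /=; rewrite !in_itv /= => /andP[_ h1] /andP[h2 _].
  by move: (lt_le_trans h2 h1); rewrite ltxx.
Qed.

(** A pair [(t, a)] in [ks] is a knot at [t] where the slope jumps by [a]. *)
Definition pl ks y : R := \sum_(k <- ks) k.2 * Num.max 0 (y - k.1).

(** Two integrations by parts replace the density by its slope jumps and [ln |y - x|] by its second
    primitive. In the same way [pl_mean] uses [y ^ 3 / 6], the second primitive of [y]. *)
Definition pl_potential ks x : R := \sum_(k <- ks) k.2 * log_prim2 (k.1 - x).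

Definition pl_mean ks : R := (\sum_(k <- ks) k.2 * k.1 ^+ 3) / 6.

Lemma measurable_pl ks : measurable_fun [set: T] (pl ks : T -> R).
Proof.
apply: (@measurable_sum _ _ _ _ _ _ (fun k (y : T) => k.2 * Num.max 0 (y - k.1))) => k.
apply: measurable_funM; first exact: measurable_cst.
apply: measurable_maxr; first exact: measurable_cst.
by apply: measurable_funB; [exact: measurable_id|exact: measurable_cst].
Qed.

(** The vanishing of the moments of order 0 and 1 of the slope jumps makes the function 0 to the
    right of all knots; the moment of order 2 is twice the total mass. *)
Record pl_density ks B : Prop := PlDensity {
  pl_knots : forall k, k \in ks -> 0 <= k.1 < B ;
  pl_sum0 : \sum_(k <- ks) k.2 = 0 ;
  pl_sum1 : \sum_(k <- ks) k.2 * k.1 = 0 ;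
  pl_sum2 : \sum_(k <- ks) k.2 * k.1 ^+ 2 = 2 ;
  pl_ge0 : forall y, 0 <= pl ks y }.

Lemma pl_left ks B y : pl_density ks B -> y <= 0 -> pl ks y = 0.
Proof.
move=> h y0; rewrite /pl big_seq big1// => k kk.
have /andP[k0 _] := pl_knots h kk.
by rewrite max_l ?mulr0// subr_le0 (le_trans y0).
Qed.

Lemma pl_right ks B y : pl_density ks B -> B <= y -> pl ks y = 0.
Proof.
move=> h By; rewrite /pl big_seq.
rewrite (eq_bigr (fun k => k.2 * y - k.2 * k.1)) => [|k kk]; last first.
  have /andP[_ kB] := pl_knots h kk.
  by rewrite max_r ?mulrBr// subr_ge0 (le_trans (ltW kB)).
by rewrite -big_seq sumrB -mulr_suml (pl_sum0 h) (pl_sum1 h) mul0r subr0.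
Qed.

(** Each hinge is integrated from its knot to the common bound [B]. The contributions of [B] come
    multiplied by the moments of order 0 and 1 of the slope jumps, hence disappear, and only values
    at the knots remain. *)
Lemma integral_log_weight ks B al be ga x : pl_density ks B ->
  (forall y, 0 < y < B -> 0 <= al + be * y - ga * ln `|y - x|) ->
  (\int[leb]_y ((al + be * y - ga * ln `|y - x|) * pl ks y)%:E =
   (al + be * pl_mean ks - ga * pl_potential ks x)%:E)%E.
Proof.
move=> h w0; set w := fun y => al + be * y - ga * ln `|y - x|.
have [k1 [k1in Bpos]] : exists k, k \in ks /\ 0 < B.
  case: ks h => [|k ks'] h.
    by have := pl_sum2 h; rewrite big_nil => /esym/eqP; rewrite pnatr_eq0.
  exists k; split; first exact: mem_head.
  by have /andP[a b] := pl_knots h (mem_head _ _); exact: le_lt_trans b.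
have mw : measurable_fun [set: T] (w : T -> R) by exact: measurable_log_weight.
pose D : set T := `]0, B[%classic.
have mD : measurable D by exact: measurable_itv.
have -> : (\int[leb]_y (w y * pl ks y)%:E = \int[leb]_(y in D) (w y * pl ks y)%:E)%E.
  rewrite [RHS]integral_mkcond; apply: eq_integral => y _.
  rewrite patchE mem_setE in_itv /=.
  have [y0|y0] /= := leP y 0; first by rewrite (pl_left h)// mulr0.
  by have [//|yB] := ltP y B; rewrite (pl_right h)// mulr0.
pose f (k : R * R) (y : T) : R := w y * Num.max 0 (y - k.1).
pose J (k : R * R) : R := hat_prim al be ga x k.1 B - hat_prim al be ga x k.1 k.1.
have mf k : measurable_fun D (fun y => (f k y)%:E).
  apply: measurable_funTS; apply/measurable_EFinP; apply: measurable_funM => //.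
  apply: measurable_maxr; first exact: measurable_cst.
  by apply: measurable_funB; [exact: measurable_id|exact: measurable_cst].
have f0 k y : D y -> 0 <= f k y.
  by rewrite /D /= in_itv /= => hy; rewrite mulr_ge0 ?w0// le_max lexx.
have fJ k : k \in ks -> (\int[leb]_(y in D) (f k y)%:E = (J k)%:E)%E.
  move=> kk; have /andP[k0 kB] := pl_knots h kk.
  rewrite -integral_linear_log//; last first.
    by move=> y /andP[h1 h2]; apply: w0; rewrite h2 (le_lt_trans k0).
  rewrite integral_mkcond [RHS]integral_mkcond; apply: eq_integral => y _.
  rewrite !patchE !mem_setE !in_itv /=.
  have [yk|ky] := leP y k.1.
    rewrite /f max_l ?subr_le0// mulr0 /=; by case: ifP.
  by rewrite (le_lt_trans k0 ky) /= /f max_r ?subr_ge0 ?(ltW ky)// mulrC.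
have fI k : k \in ks -> leb.-integrable D (fun y => (f k y)%:E).
  move=> kk; apply/integrableP; split; first exact: mf.
  rewrite (_ : (\int[_]_(y in D) _ = \int[leb]_(y in D) (f k y)%:E)%E).
    by rewrite fJ// ltry.
  by apply: eq_integral => y /[!inE] Dy; rewrite gee0_abs// lee_fin f0.
have S (s : seq (R * R)) : {subset s <= ks} ->
    leb.-integrable D (fun y => (\sum_(k <- s) k.2 * f k y)%:E) /\
    (\int[leb]_(y in D) (\sum_(k <- s) k.2 * f k y)%:E =
     (\sum_(k <- s) k.2 * J k)%:E)%E.
  elim: s => [|k s IH] sub.
    split; first by under eq_fun do rewrite big_nil; exact: integrable0.
    by under eq_integral do rewrite big_nil; rewrite integral0 big_nil.
  have kk : k \in ks by apply: sub; exact: mem_head.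
  have [I1 E1] : leb.-integrable D (fun y => (\sum_(k <- s) k.2 * f k y)%:E) /\
    (\int[leb]_(y in D) (\sum_(k <- s) k.2 * f k y)%:E =
     (\sum_(k <- s) k.2 * J k)%:E)%E.
    by apply: IH => z zs; apply: sub; rewrite inE zs orbT.
  have I2 : leb.-integrable D (fun y => (k.2%:E * (f k y)%:E)%E).
    exact: integrableZl (fI _ kk).
  have eqf : (fun y => (\sum_(j <- k :: s) j.2 * f j y)%:E) =
     (fun y => (k.2%:E * (f k y)%:E + (\sum_(j <- s) j.2 * f j y)%:E)%E).
    by apply/funext => y; rewrite big_cons -EFinM -EFinD.
  split; first by rewrite eqf; exact: integrableD.
  rewrite eqf integralD//= integralZl ?fJ//; last exact: fI.
  by rewrite E1 -EFinM -EFinD big_cons.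
have [_ E] := S ks (fun z hz => hz).
rewrite (_ : (\int[_]_(y in D) _ = \int[leb]_(y in D) (\sum_(k <- ks) k.2 * f k y)%:E)%E); last first.
  apply: eq_integral => y _; congr (_%:E); rewrite /pl mulr_sumr; apply: eq_bigr => k _.
  by rewrite /f mulrCA.
rewrite E; congr (_%:E).
(* Grouped by moments of the slope jumps; after summation the first two groups vanish and the third
   equals [al]. *)
have JE k : k.2 * J k = (al / 2 * B ^+ 2 + be * B ^+ 3 / 3 - ga * (B * log_prim1 (B - x) - log_prim2 (B - x))) * k.2
    + (- al * B - be * B ^+ 2 / 2 + ga * log_prim1 (B - x)) * (k.2 * k.1)
    + al / 2 * (k.2 * k.1 ^+ 2) + be / 6 * (k.2 * k.1 ^+ 3)
    - ga * (k.2 * log_prim2 (k.1 - x)).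
  by rewrite /J /hat_prim; field.
under eq_bigr do rewrite JE.
rewrite sumrB !big_split /= -!mulr_sumr (pl_sum0 h) (pl_sum1 h) (pl_sum2 h).
by rewrite /pl_mean /pl_potential; field.
Qed.

End PiecewiseLinear.

(** * Duality: the bounds on [lambda] given by a dual certificate *)

Section Certificate.
Context (R : realType).
Notation T := (measurableTypeR R).
Implicit Types (nu : probability T R) (x y r : R).
Let leb : {sigma_finite_measure set T -> \bar R} := @lebesgue_measure R.
Let sprod (nu mu : probability T R) : probability (T * T)%type R := (nu \x mu)%E.

Definition root_poly (rs : seq R) x : R := (\prod_(r <- rs) (x - r))%R.

Definition log_root_sum (rs : seq R) x : R := (\sum_(r <- rs) ln `|x - r|)%R.

(** Valid at the roots too: the logarithms involved are finite or [-oo], so that one vanishing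
    factor makes both sides [-oo]. *)
Lemma lne_root_poly rs x : lne (`|root_poly rs x|%:E) =
  \sum_(r <- rs) lne (`|x - r|%:E).
Proof.
rewrite /root_poly; elim: rs => [|r rs IH].
  by rewrite !big_nil normr1 lne1.
rewrite !big_cons normrM -IH.
set a := `|x - r|%R; set b := `|_|%R.
have [a0 b0] : (0 <= a)%R /\ (0 <= b)%R by split; exact: normr_ge0.
case: (eqVneq a 0%R) => [->|an0].
  by rewrite mul0r /= lexx addNye//; case: ifP.
case: (eqVneq b 0%R) => [->|bn0].
  by rewrite mulr0 /= lexx addeC addNye//; case: ifP.
have a1 : (0 < a)%R by rewrite lt_neqAle eq_sym an0.
have b1 : (0 < b)%R by rewrite lt_neqAle eq_sym bn0.
by rewrite !lne_EFin ?mulr_gt0// lnM ?posrE// EFinD.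
Qed.

Lemma lne_root_polyE rs x : (forall r, r \in rs -> x != r) ->
  lne (`|root_poly rs x|%:E) = (log_root_sum rs x)%:E.
Proof.
move=> h; rewrite lne_root_poly /log_root_sum.
rewrite -sumEFin big_seq [RHS]big_seq; apply: eq_bigr => r rr.
by rewrite lne_EFin// normr_gt0 subr_eq0 h.
Qed.

Lemma measurable_lne_abs (f : T -> R) : measurable_fun [set: T] f ->
  measurable_fun [set: T] (fun x => lne (`|f x|%:E)).
Proof.
move=> mf; rewrite (_ : (fun x => _) = (fun x =>
   if (f x == 0)%R then -oo else (ln `|f x|)%:E)); last first.
  apply/funext => x; case: ifPn => [/eqP ->|h]; first by rewrite normr0 /= lexx.
  by rewrite lne_EFin// normr_gt0.
apply: measurable_fun_ifT => //.
- by apply: measurable_fun_eqr => //; exact: measurable_cst.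
- apply/measurable_EFinP; apply: (measurableT_comp (@measurable_ln R)).
  exact: measurableT_comp.
Qed.

Lemma measurable_root_poly rs : measurable_fun [set: T] (root_poly rs : T -> R).
Proof.
rewrite /root_poly; elim: rs => [|r rs IH].
  by under eq_fun do rewrite big_nil; exact: measurable_cst.
under eq_fun do rewrite big_cons.
apply: measurable_funM => //.
by apply: measurable_funB; [exact: measurable_id|exact: measurable_cst].
Qed.

Lemma measurable_log_poly rs :
  measurable_fun [set: T] (fun x => lne (`|root_poly rs x|%:E)).
Proof. by apply: measurable_lne_abs; exact: measurable_root_poly. Qed.

(** A majorant of [log |root_poly rs|], as [|z.1| + |z.2|] is one of the logarithm in [log_gap]. *)
Definition root_norms (rs : seq R) x : R := (\sum_(r <- rs) (`|x| + `|r|))%R.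

Lemma root_norms_ge0 rs x : (0 <= root_norms rs x)%R.
Proof. by apply: sumr_ge0 => r _; rewrite addr_ge0. Qed.

Lemma lne_le_root_norms rs x : lne (`|root_poly rs x|%:E) <= (root_norms rs x)%:E.
Proof.
rewrite lne_root_poly -sumEFin; apply: lee_sum => r _.
exact: (lne_le_norms (x, r)).
Qed.

Variables (ks : seq (R * R)) (B : R).
Hypothesis hks : pl_density ks B.
Variable mu : probability T R.
Hypothesis muE : forall f : T -> \bar R, measurable_fun [set: T] f ->
  (forall y, 0 <= f y) ->
  \int[mu]_y f y = \int[leb]_y (f y * (pl ks y)%:E).

Let m : R := pl_mean ks.
Let U := pl_potential ks.

Lemma pl_outside y : ~~ (0 < y < B)%R -> pl ks y = 0%R.
Proof.
rewrite negb_and -!leNgt => /orP[h|h]; first exact: pl_left hks h.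
exact: pl_right hks h.
Qed.

Lemma integral_abs_pl : \int[mu]_y `|y|%:E = m%:E.
Proof.
rewrite muE//; last by apply/measurable_EFinP; exact: normr_measurable.
have := @integral_log_weight R ks B 0 1 0 0 hks.
rewrite add0r mul1r mul0r subr0 => <-.
  apply: eq_integral => y _; rewrite -EFinM mul0r subr0 add0r mul1r; congr (_%:E).
  have [/andP[y0 _]|h] := boolP (0 < y < B)%R; first by rewrite gtr0_norm.
  by rewrite pl_outside// !mulr0.
by move=> y /andP[y0 _]; rewrite mul0r subr0 add0r mul1r ltW.
Qed.

Lemma pl_mean_ge0 : (0 <= m)%R.
Proof. by rewrite -lee_fin -integral_abs_pl integral_ge0. Qed.

(** On the support, the real [ln] and the extended [lne] of [|x - y|] differ only at [y = x], a null
    set for a measure with density. *)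
Lemma integral_log_gap_pl x : \int[mu]_y log_gap (x, y) = (`|x| + m - U x)%:E.
Proof.
have mg : measurable_fun [set: T] (fun y : T => log_gap (x, y)).
  exact: (measurableT_comp (@measurable_log_gap R) (measurable_pair1 x)).
rewrite muE//; last by move=> y; exact: log_gap_ge0.
have := @integral_log_weight R ks B `|x|%R 1 1 x hks.
rewrite !mul1r => <-; last first.
  move=> y /andP[y0 _]; rewrite !mul1r subr_ge0.
  have : lne (`|x - y|%:E) <= (`|x| + `|y|)%:E := lne_le_norms (x, y).
  rewrite distrC.
  have [E|yx] := eqVneq y x.
    by rewrite E in y0 *; rewrite subrr normr0 ln0// => _; rewrite addr_ge0// ltW.
  by rewrite lne_EFin ?normr_gt0 ?subr_eq0// lee_fin (gtr0_norm y0).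
have ae : leb [set x] = 0 by exact: lebesgue_measure_set1.
apply: ae_eq_integral => //.
- by apply: emeasurable_funM => //; apply/measurable_EFinP; exact: measurable_pl.
- apply/measurable_EFinP; apply: measurable_funM; last exact: measurable_pl.
  have := measurable_log_weight `|x|%R 1 1 x.
  by congr (measurable_fun _ _); apply/funext => y; rewrite !mul1r.
- exists [set x]; split => //.
  move=> y /= hy; apply: contrapT => /eqP yx; apply: hy => _.
  have [/andP[y0 _]|h] := boolP (0 < y < B)%R; last first.
    by rewrite pl_outside// mule0 mulr0.
  rewrite -[log_gap _]/((`|x| + `|y|)%:E - lne (`|x - y|%:E)).
  rewrite lne_EFin; last by rewrite normr_gt0 subr_eq0 eq_sym.
  by rewrite -EFinB -EFinM distrC mul1r mul1r (gtr0_norm y0).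
Qed.


Lemma integrable_abs_pl : mu.-integrable [set: T] (fun y : T => `|y|%:E).
Proof.
apply/integrableP; split; first by apply/measurable_EFinP; exact: normr_measurable.
under eq_integral do rewrite gee0_abs ?lee_fin//.
by rewrite integral_abs_pl ltry.
Qed.

(** The logarithm is the difference of the integrable functions [|r| + |y|] and [log_gap (r, y)]. *)
Lemma lne_abs_sub_pl r :
  mu.-integrable [set: T] (fun y : T => lne (`|y - r|%:E)) /\
  \int[mu]_y lne (`|y - r|%:E) = (U r)%:E.
Proof.
pose g := fun y : T => log_gap (r, y); pose N := fun y : T => `|r|%:E + `|y|%:E.
have mg : measurable_fun [set: T] g.
  exact: (measurableT_comp (@measurable_log_gap R) (measurable_pair1 r)).
have Ig : mu.-integrable [set: T] g.
  apply/integrableP; split => //.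
  rewrite (_ : \int[mu]_y _ = \int[mu]_y g y).
    by rewrite integral_log_gap_pl ltry.
  by apply: eq_integral => y _; rewrite gee0_abs// log_gap_ge0.
have Ic : mu.-integrable [set: T] (fun _ : T => `|r|%:E).
  by apply: finite_measure_integrable_cst.
have IN : mu.-integrable [set: T] N by apply: integrableD => //; exact: integrable_abs_pl.
have E : (fun y : T => lne (`|y - r|%:E)) = (fun y => N y - g y).
  apply/funext => y.
  rewrite /N /g -[log_gap _]/((`|r| + `|y|)%:E - lne (`|r - y|%:E)) distrC -EFinD.
  have := lne_abs_le (r - y).
  by case: (lne _) => [a| |] // _; rewrite -!EFinB; congr (_%:E); lra.
rewrite E; split; first exact: integrableB.
rewrite integralB// integral_log_gap_pl integralD//=; last exact: integrable_abs_pl.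
rewrite (integral_prob_cst mu) integral_abs_pl -?EFinD -?EFinB; congr (_%:E); lra.
Qed.

Definition root_potential (rs : seq R) : R := (\sum_(r <- rs) U r)%R.

Lemma lne_root_poly_pl rs :
  mu.-integrable [set: T] (fun y : T => lne (`|root_poly rs y|%:E)) /\
  \int[mu]_y lne (`|root_poly rs y|%:E) = (root_potential rs)%:E.
Proof.
rewrite /root_potential; elim: rs => [|r rs [I1 E1]].
  have E : (fun y : T => lne (`|root_poly [::] y|%:E)) = (fun _ => 0).
    by apply/funext => y; rewrite lne_root_poly big_nil.
  by rewrite E big_nil integral0; split => //; exact: integrable0.
have [I2 E2] := lne_abs_sub_pl r.
have E : (fun y : T => lne (`|root_poly (r :: rs) y|%:E)) =
    (fun y => lne (`|y - r|%:E) + lne (`|root_poly rs y|%:E)).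
  by apply/funext => y; rewrite !lne_root_poly big_cons.
rewrite E; split; first exact: integrableD.
by rewrite integralD// E1 E2 big_cons EFinD.
Qed.

(** A member [(l, rs)] is a monic polynomial, given by its roots [rs], with its dual multiplier
    [l]. *)
Variable fam : seq (R * seq R).
Variables (l0 K c : R).
Hypothesis l0_gt0 : (0 < l0)%R.
Hypothesis fam_gt0 : forall q, q \in fam -> (0 < q.1)%R.

Definition log_fam y : R := (\sum_(q <- fam) q.1 * log_root_sum q.2 y)%R.

Hypothesis fam_root : forall q r, q \in fam -> r \in q.2 -> pl ks r = 0%R.
Hypothesis fam_ge0 : forall q, q \in fam -> (0 <= root_potential q.2)%R.
(** In terms of [Phi y = y - log_fam y - l0 * U y] this reads [Phi <= K] where the density is
    positive. Together with [K_le] it yields nonnegative energy of [mu]. *)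
Hypothesis on_support : forall y, (0 < pl ks y)%R -> (y <= K + l0 * U y + log_fam y)%R.
Hypothesis K_le : (K <= m - \sum_(q <- fam) q.1 * root_potential q.2)%R.

Let fam_norms y : R := (\sum_(q <- fam) q.1 * root_norms q.2 y)%R.

(* [fam_gap] plays for the polynomials the role of [log_gap] for the energy. *)
Let fam_gap y : \bar R := \sum_(q <- fam)
  (q.1%:E * ((root_norms q.2 y)%:E - lne (`|root_poly q.2 y|%:E))).

Let gap_ge0 rs y : 0 <= (root_norms rs y)%:E - lne (`|root_poly rs y|%:E).
Proof. by rewrite sube_ge0 ?lne_le_root_norms//= orbT. Qed.

Let fam_gap_ge0 y : 0 <= fam_gap y.
Proof.
rewrite /fam_gap big_seq; apply: sume_ge0 => q qf.
by rewrite mule_ge0 ?gap_ge0// lee_fin ltW// fam_gt0.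
Qed.

Let fam_gapE y : (forall q r, q \in fam -> r \in q.2 -> y != r) ->
  fam_gap y = (fam_norms y - log_fam y)%:E.
Proof.
move=> h; rewrite /fam_gap /fam_norms /log_fam.
rewrite (_ : (_ - _)%R = \sum_(q <- fam) (q.1 * (root_norms q.2 y - log_root_sum q.2 y)))%R.
  rewrite -sumEFin big_seq [RHS]big_seq; apply: eq_bigr => q qf.
  by rewrite lne_root_polyE// => r; exact: h.
by rewrite -sumrB; apply: eq_bigr => q _; rewrite mulrBr.
Qed.

Let measurable_root_norms rs : measurable_fun [set: T] (root_norms rs : T -> R).
Proof.
apply: (@measurable_sum _ _ _ _ _ _ (fun r (y : T) => `|y| + `|r|)%R) => r.
by apply: measurable_funD; [exact: normr_measurable|exact: measurable_cst].
Qed.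

Let mgap rs : measurable_fun [set: T]
  (fun y : T => (root_norms rs y)%:E - lne (`|root_poly rs y|%:E)).
Proof.
apply: emeasurable_funB; last exact: measurable_log_poly.
exact/measurable_EFinP.
Qed.

Let measurable_fam_gap : measurable_fun [set: T] fam_gap.
Proof. by apply: emeasurable_sum => q; apply: measurable_funeM; exact: mgap. Qed.

Let integral_root_norms nu (e : R) rs : \int[nu]_y `|y|%:E = e%:E ->
  \int[nu]_y (root_norms rs y)%:E = (\sum_(r <- rs) (e + `|r|))%:E.
Proof.
move=> he; rewrite -sumEFin.
rewrite (_ : \int[nu]_y _ = \int[nu]_y \sum_(r <- rs) (`|y|%:E + `|r|%:E)); last first.
  by apply: eq_integral => y _; rewrite /root_norms -sumEFin.
have mabs : measurable_fun [set: T] (fun y : T => `|y|%:E).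
  by apply/measurable_EFinP; exact: normr_measurable.
rewrite ge0_integral_sum//.
all: try (by move=> r; apply: emeasurable_funD => //; exact: measurable_cst).
all: try (by move=> r y _; rewrite adde_ge0// lee_fin).
apply: eq_bigr => r _; rewrite ge0_integralD//.
by rewrite he EFinD (integral_prob_cst nu).
Qed.

Let integral_fam_gap nu : \int[nu]_y fam_gap y = \sum_(q <- fam) (q.1%:E *
   \int[nu]_y ((root_norms q.2 y)%:E - lne (`|root_poly q.2 y|%:E))).
Proof.
(* Integrating the sum termwise requires nonnegative terms for every index [q], not only for those
   in [fam]; hence the truncation of the multiplier. *)
pose F (q : R * seq R) (y : T) := (Num.max 0%R q.1)%:E *
   ((root_norms q.2 y)%:E - lne (`|root_poly q.2 y|%:E)).
have max_fam q : q \in fam -> Num.max 0%R q.1 = q.1.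
  by move=> qf; rewrite max_r// ltW// fam_gt0.
transitivity (\int[nu]_y \sum_(q <- fam) F q y).
  apply: eq_integral => y _; rewrite /fam_gap big_seq [RHS]big_seq.
  by apply: eq_bigr => q qf; rewrite /F max_fam.
have m0 q : 0 <= (Num.max 0%R q.1 : R)%:E by rewrite lee_fin le_max lexx.
rewrite ge0_integral_sum//.
all: try (by move=> q; apply: measurable_funeM; exact: mgap).
all: try (by move=> q y _; rewrite mule_ge0).
rewrite big_seq [RHS]big_seq; apply: eq_bigr => q qf.
by rewrite /F ge0_integralZl// max_fam.
Qed.

Let V y : \bar R := \int[mu]_z log_gap (y, z).

Let VE y : V y = (`|y| + m - U y)%:E.
Proof. exact: integral_log_gap_pl. Qed.

Let V_ge0 y : 0 <= V y.
Proof. by apply: integral_ge0 => z _; exact: log_gap_ge0. Qed.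

Let measurable_V : measurable_fun [set: T] V.
Proof.
have := @measurable_fun_fubini_tonelli_F _ _ T T R mu (@log_gap R)
  (@measurable_log_gap R) (@log_gap_ge0 R).
by [].
Qed.

Let mabs : measurable_fun [set: T] (fun y : T => `|y|%:E).
Proof. by apply/measurable_EFinP; exact: normr_measurable. Qed.

Let integral_V nu : \int[nu]_y V y = \int[nu \x mu]_z log_gap z.
Proof.
have := @fubini_tonelli1 _ _ T T R nu mu (@log_gap R) (@measurable_log_gap R) (@log_gap_ge0 R).
by move=> ->.
Qed.

Let norms_total (e : R) : R :=
  (\sum_(q <- fam) q.1 * \sum_(r <- q.2) (e + `|r|))%R.

Let fam_norms_ge0 y : (0 <= fam_norms y)%R.
Proof.
rewrite /fam_norms big_seq; apply: sumr_ge0 => q qf.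
by rewrite mulr_ge0 ?root_norms_ge0// ltW// fam_gt0.
Qed.

Let measurable_fam_norms : measurable_fun [set: T] (fam_norms : T -> R).
Proof.
apply: (@measurable_sum _ _ _ _ _ _ (fun q (y : T) => q.1 * root_norms q.2 y)%R) => q.
by apply: measurable_funM => //; exact: measurable_cst.
Qed.

Let integral_fam_norms nu (e : R) : \int[nu]_y `|y|%:E = e%:E ->
  \int[nu]_y (fam_norms y)%:E = (norms_total e)%:E.
Proof.
move=> he.
pose F (q : R * seq R) (y : T) := (Num.max 0%R q.1)%:E * (root_norms q.2 y)%:E.
have max_fam q : q \in fam -> Num.max 0%R q.1 = q.1.
  by move=> qf; rewrite max_r// ltW// fam_gt0.
have m0 q : 0 <= (Num.max 0%R q.1 : R)%:E by rewrite lee_fin le_max lexx.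
have mr rs : measurable_fun [set: T] (fun y : T => (root_norms rs y)%:E).
  exact/measurable_EFinP.
have r0 rs y : 0 <= (root_norms rs y)%:E by rewrite lee_fin root_norms_ge0.
transitivity (\int[nu]_y \sum_(q <- fam) F q y).
  apply: eq_integral => y _; rewrite /fam_norms -sumEFin big_seq [RHS]big_seq.
  by apply: eq_bigr => q qf; rewrite /F max_fam.
rewrite ge0_integral_sum//.
all: try (by move=> q; apply: measurable_funeM; exact: mr).
all: try (by move=> q y _; rewrite mule_ge0).
rewrite /norms_total -sumEFin big_seq [RHS]big_seq; apply: eq_bigr => q qf.
by rewrite /F ge0_integralZl// max_fam// (integral_root_norms _ he).
Qed.

Let integral_affine nu (e a : R) : (0 <= a)%R -> \int[nu]_y `|y|%:E = e%:E ->
  \int[nu]_y (a + l0 * (`|y| + m) + fam_norms y)%:E =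
  (a + l0 * (e + m) + norms_total e)%:E.
Proof.
move=> a0 he.
have m0 := pl_mean_ge0.
rewrite (_ : \int[nu]_y _ = \int[nu]_y ((a%:E + l0%:E * (`|y|%:E + m%:E)) + (fam_norms y)%:E))//.
have l0E : 0 <= l0%:E by rewrite lee_fin ltW.
have mabm : measurable_fun [set: T] (fun y : T => `|y|%:E + m%:E).
  by apply: emeasurable_funD => //; exact: measurable_cst.
have abm y : 0 <= `|y|%:E + m%:E by rewrite adde_ge0 ?lee_fin.
have mlabm : measurable_fun [set: T] (fun y : T => l0%:E * (`|y|%:E + m%:E)).
  exact: measurable_funeM.
have labm y : 0 <= l0%:E * (`|y|%:E + m%:E) by rewrite mule_ge0.
have mF : measurable_fun [set: T] (fun y : T => (fam_norms y)%:E).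
  exact/measurable_EFinP.
have F0 y : 0 <= (fam_norms y)%:E by rewrite lee_fin.
have a0E : 0 <= a%:E by rewrite lee_fin.
have malabm : measurable_fun [set: T] (fun y : T => a%:E + l0%:E * (`|y|%:E + m%:E)).
  by apply: emeasurable_funD => //; exact: measurable_cst.
rewrite ge0_integralD//; last by move=> y _; rewrite adde_ge0.
rewrite ge0_integralD// ge0_integralZl// ge0_integralD//.
by rewrite (integral_fam_norms he) he !(integral_prob_cst nu) -?EFinD -?EFinM.
Qed.

Hypothesis K_ge0 : (0 <= K)%R.

(** This is [I(mu) >= 0] in disguise. Integrating [on_support] against [mu] bounds [m] by
    [K + l0 I(mu) + sum_Q l_Q int log |Q| dmu], and [K_le] leaves [l0 I(mu) >= 0]. *)
Lemma log_gap_energy_pl : \int[mu \x mu]_z log_gap z <= (m + m)%:E.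
Proof.
have m0 := pl_mean_ge0.
have l0E : 0 <= l0%:E by rewrite lee_fin ltW.
rewrite -integral_V; set G := \int[mu]_y V y.
(* [Phi y <= K] with [l0 * (|y| + m) + fam_norms y] added to both sides, which makes every term
   nonnegative. *)
pose lhs y : \bar R := (l0%:E * V y + fam_gap y) + `|y|%:E.
pose rhs y : R := (K + l0 * (`|y| + m) + fam_norms y)%R.
have mlV : measurable_fun [set: T] (fun y => l0%:E * V y) by exact: measurable_funeM.
have lV0 y : 0 <= l0%:E * V y by rewrite mule_ge0.
have mlVf : measurable_fun [set: T] (fun y => l0%:E * V y + fam_gap y).
  exact: emeasurable_funD.
have lVf0 y : 0 <= l0%:E * V y + fam_gap y by rewrite adde_ge0.
have mlhs : measurable_fun [set: T] lhs by exact: emeasurable_funD.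
have lhs0 y : 0 <= lhs y by rewrite adde_ge0// lee_fin.
have mrhs : measurable_fun [set: T] (fun y => (rhs y)%:E).
  apply/measurable_EFinP; apply: measurable_funD => //.
  apply: measurable_funD; first exact: measurable_cst.
  apply: measurable_funM; first exact: measurable_cst.
  by apply: measurable_funD; [exact: normr_measurable|exact: measurable_cst].
have rhs0 y : 0 <= (rhs y)%:E.
  by rewrite lee_fin !addr_ge0// mulr_ge0 ?addr_ge0// ltW.
have mpl : measurable_fun [set: T] (fun y => (pl ks y)%:E).
  by apply/measurable_EFinP; exact: measurable_pl.
have I : \int[mu]_y lhs y <= \int[mu]_y (rhs y)%:E.
  rewrite !muE//; apply: ge0_le_integral => //.
  - by move=> y _; rewrite mule_ge0// lee_fin (pl_ge0 hks).
  - exact: emeasurable_funM.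
  - exact: emeasurable_funM.
  move=> y _; have := pl_ge0 hks y; rewrite le_eqVlt => /orP[/eqP <-|p0].
    by rewrite !mule0.
  rewrite lee_wpmul2r ?lee_fin ?(ltW p0)//.
  have y0 : (0 < y)%R by rewrite ltNge; apply/negP => y0; move: p0; rewrite (pl_left hks y0) ltxx.
  rewrite /lhs /rhs VE fam_gapE; last first.
    by move=> q r qf rq; apply/negP => /eqP yr; move: p0; rewrite yr (fam_root qf rq) ltxx.
  rewrite -EFinM -!EFinD lee_fin (gtr0_norm y0).
  by have := on_support p0; lra.
move: I; rewrite (integral_affine K_ge0 integral_abs_pl).
rewrite ge0_integralD// ge0_integralD// ge0_integralZl// -/G integral_abs_pl.
rewrite integral_fam_gap.
rewrite (_ : \sum_(q <- fam) _ =
    (norms_total m - \sum_(q <- fam) q.1 * root_potential q.2)%:E); last first.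
  rewrite /norms_total -sumrB -sumEFin; apply: eq_bigr => q _.
  have [I1 E1] := lne_root_poly_pl q.2.
  have IN : mu.-integrable [set: T] (fun y : T => (root_norms q.2 y)%:E).
    apply/integrableP; split; first exact/measurable_EFinP.
    rewrite (_ : \int[mu]_y _ = \int[mu]_y (root_norms q.2 y)%:E).
      by rewrite (integral_root_norms _ integral_abs_pl) ltry.
    by apply: eq_integral => y _; rewrite gee0_abs// lee_fin root_norms_ge0.
  by rewrite integralB// E1 (integral_root_norms _ integral_abs_pl) -EFinB -EFinM mulrBr.
rewrite -addeA -EFinD -leeBrDr// -EFinB => I.
rewrite -(@lee_pmul2l _ l0%:E)// ?lte_fin// (le_trans I)// -EFinM lee_fin.
by move: K_le; lra.
Qed.

Lemma log_energy_pl_ge0 : 0 <= log_energy mu.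
Proof.
have IG : (mu \x mu).-integrable [set: T * T] (log_gap (R := R)).
  apply/integrableP; split; first exact: measurable_log_gap.
  rewrite (_ : \int[_]_z _ = \int[mu \x mu]_z log_gap z).
    by rewrite (le_lt_trans log_gap_energy_pl)// ltry.
  by apply: eq_integral => z _; rewrite gee0_abs// log_gap_ge0.
have IN : (mu \x mu).-integrable [set: T * T] (fun z : T * T => (`|z.1| + `|z.2|)%:E).
  apply/integrableP; split.
    apply/measurable_EFinP; apply: measurable_funD; exact: measurableT_comp.
  rewrite (_ : \int[_]_z _ = \int[mu \x mu]_z (`|z.1| + `|z.2|)%:E).
    by rewrite (integral_norms integral_abs_pl integral_abs_pl) ltry.
  by apply: eq_integral => z _; rewrite gee0_abs// lee_fin addr_ge0.
rewrite /log_energy.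
rewrite (_ : \int[_]_z _ = \int[mu \x mu]_z ((`|z.1| + `|z.2|)%:E - log_gap z)).
  rewrite integralB// (integral_norms integral_abs_pl integral_abs_pl).
  by rewrite sube_ge0 ?log_gap_energy_pl//= orbT.
apply: eq_integral => z _; rewrite /log_gap.
have := lne_abs_le (z.1 - z.2).
by case: (lne _) => [a| |] // _; rewrite -!EFinB; congr (_%:E); lra.
Qed.

Lemma integral_nonneg_abs nu : supported_on_nonneg nu ->
  \int[nu]_x x%:E = \int[nu]_x `|x|%:E.
Proof.
move=> nu0.
have mid : measurable_fun [set: T] (fun x : T => x%:E).
  by apply/measurable_EFinP; exact: measurable_id.
apply: (ae_eq_integral (fun x : T => `|x|%:E)) => //.
exists (~` [set x : R | (0 <= x)%R]); split => //.
- apply: measurableC; rewrite (_ : [set _ | _] = `[0%R, +oo[%classic).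
    exact: measurable_itv.
  by apply/seteqP; split => x /=; rewrite in_itv /= andbT.
- move=> x /= h x0; apply: h => _; by rewrite ger0_norm.
Qed.

Lemma supported_pl : supported_on_nonneg mu.
Proof.
have mC : measurable (~` [set x : R | (0 <= x)%R] : set T).
  apply: measurableC; rewrite (_ : [set _ | _] = `[0%R, +oo[%classic).
    exact: measurable_itv.
  by apply/seteqP; split => x /=; rewrite in_itv /= andbT.
rewrite /supported_on_nonneg.
have := integral_indic mu measurableT mC; rewrite setIT => <-.
rewrite muE; last 2 first.
- by apply/measurable_EFinP; exact: measurable_indic.
- by move=> y; rewrite lee_fin.
rewrite integral0_eq// => y _; rewrite indicE.
case: (boolP (y \in _)); last by rewrite mul0e.
rewrite inE /= => /negP; rewrite -ltNge => y0.
by rewrite (pl_left hks (ltW y0)) mule0.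
Qed.

Variable A : {fset {poly int}}.
Hypothesis A_fam : forall Q, Q \in A ->
  exists2 q, q \in fam & forall x, ((map_poly intr Q).[x] = root_poly q.2 x)%R.
Hypothesis fam_A : forall q, q \in fam ->
  exists2 Q, Q \in A & forall x, ((map_poly intr Q).[x] = root_poly q.2 x)%R.

(** The measure [mu] itself is admissible. *)
Lemma lambda_le : lambda R A <= m%:E.
Proof.
apply: ereal_inf_lbound; exists mu.
  split; [exact: supported_pl|exact: log_energy_pl_ge0|].
  move=> Q /A_fam[q qf Qq]; rewrite /log_integral.
  under eq_integral do rewrite Qq.
  by have [_ ->] := lne_root_poly_pl q.2; rewrite lee_fin fam_ge0.
by rewrite integral_nonneg_abs ?integral_abs_pl//; exact: supported_pl.
Qed.

Hypothesis c_ge0 : (0 <= c)%R.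
Hypothesis below : forall y, (0 <= y)%R ->
  (forall q r, q \in fam -> r \in q.2 -> y != r) ->
  (c + log_fam y + l0 * U y <= y)%R.

Let fam_gap_root y q r : q \in fam -> r \in q.2 -> y = r -> fam_gap y = +oo.
Proof.
move=> qf rq yr; rewrite /fam_gap (big_rem q)//=.
have -> : root_poly q.2 y = 0%R.
  by rewrite /root_poly (big_rem r)//= yr subrr mul0r.
rewrite normr0 lexx /= gt0_muley ?lte_fin ?fam_gt0//.
rewrite addye// gt_eqF// (lt_le_trans ltNy0)//.
rewrite big_seq; apply: sume_ge0 => q' /mem_rem q'f.
by rewrite mule_ge0 ?gap_ge0// lee_fin ltW// fam_gt0.
Qed.

(** Integrate [below] against an admissible [nu]: the terms of the polynomials are nonnegative by
    admissibility, and the integral of [U] is the mutual energy of [nu] and [mu], nonnegative by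
    [log_gap_cross_le]. *)
Lemma lambda_ge : c%:E <= lambda R A.
Proof.
apply: le_ereal_inf_tmp => _ [nu [nu0 nuI nuA] <-].
rewrite integral_nonneg_abs//.
have I0 : 0 <= \int[nu]_x `|x|%:E by apply: integral_ge0 => x _; rewrite lee_fin.
(* A measure of infinite mean satisfies the bound trivially; from here on the mean is a real number
   [e]. *)
case he : (\int[nu]_x `|x|%:E) => [e| |]; last 2 first.
- by rewrite leey.
- by rewrite he in I0.
have l0E : 0 <= l0%:E by rewrite lee_fin ltW.
have gV : \int[nu]_y V y <= (e + m)%:E.
  by rewrite integral_V; apply: log_gap_cross_le => //;
    [exact: integral_abs_pl|exact: log_energy_pl_ge0].
have gF : \int[nu]_y fam_gap y <= (norms_total e)%:E.
  rewrite integral_fam_gap /norms_total -sumEFin big_seq [leRHS]big_seq.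
  apply: lee_sum => q qf; rewrite EFinM lee_wpmul2l ?lee_fin ?(ltW (fam_gt0 qf))//.
  apply: integral_sub_le => //.
  - exact: measurable_log_poly.
  - exact: root_norms_ge0.
  - exact: lne_le_root_norms.
  - exact: integral_root_norms.
  - have [Q QA Qq] := fam_A qf.
    by have := nuA Q QA; rewrite /log_integral; under eq_integral do rewrite Qq.
pose lhs y : R := (c + l0 * (`|y| + m) + fam_norms y)%R.
pose rhs y : \bar R := (l0%:E * V y + fam_gap y) + `|y|%:E.
have mlV : measurable_fun [set: T] (fun y => l0%:E * V y) by exact: measurable_funeM.
have lV0 y : 0 <= l0%:E * V y by rewrite mule_ge0.
have mlVf : measurable_fun [set: T] (fun y => l0%:E * V y + fam_gap y).
  exact: emeasurable_funD.
have lVf0 y : 0 <= l0%:E * V y + fam_gap y by rewrite adde_ge0.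
have I : \int[nu]_y (lhs y)%:E <= \int[nu]_y rhs y.
  apply: ae_ge0_le_integral => //.
  - by move=> y _; rewrite lee_fin !addr_ge0// mulr_ge0 ?addr_ge0 ?pl_mean_ge0// ltW.
  - apply/measurable_EFinP; apply: measurable_funD => //.
    apply: measurable_funD; first exact: measurable_cst.
    apply: measurable_funM; first exact: measurable_cst.
    by apply: measurable_funD; [exact: normr_measurable|exact: measurable_cst].
  - by move=> y _; rewrite adde_ge0// lee_fin.
  - exact: emeasurable_funD.
  exists (~` [set x : R | (0 <= x)%R]); split => //.
    apply: measurableC; rewrite (_ : [set _ | _] = `[0%R, +oo[%classic).
      exact: measurable_itv.
    by apply/seteqP; split => x /=; rewrite in_itv /= andbT.
  move=> y /= h y0; apply: h => _; rewrite /lhs /rhs VE.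
  (* At a root [fam_gap] is [+oo] and the inequality is trivial, so [below] need only hold off the
     roots. This covers atoms of [nu]. *)
  have [[q [r [qf rq yr]]]|nr] := pselect (exists q r, [/\ q \in fam, r \in q.2 & y = r]).
    by rewrite (fam_gap_root qf rq yr) -EFinM addey// addye// leey.
  have nr' q r : q \in fam -> r \in q.2 -> y != r.
    by move=> qf rq; apply/negP => /eqP yr; apply: nr; exists q, r.
  rewrite fam_gapE// -EFinM -!EFinD lee_fin (ger0_norm y0).
  by have := below y0 nr'; lra.
move: I; rewrite (integral_affine c_ge0 he).
rewrite ge0_integralD// ge0_integralD// ge0_integralZl// he => I.
have : (c + l0 * (e + m) + norms_total e)%:E <=
   (l0%:E * (e + m)%:E + (norms_total e)%:E) + e%:E.
  by apply: (le_trans I); rewrite leeD2r// leeD// lee_wpmul2l.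
by rewrite -EFinM -!EFinD !lee_fin; lra.
Qed.

End Certificate.

(** * Taylor bounds for the logarithm *)

Section LogTaylor.
Context (R : realType).
Implicit Types (v w d x y : R).
Local Open Scope ring_scope.

Lemma min_at_one (f df : R -> R) v : 0 < v ->
  (forall x, 0 < x -> is_derive x (1 : R) f (df x)) ->
  (forall x, 0 < x -> 0 <= (x - 1) * df x) -> f 1 <= f v.
Proof.
move=> v0 dfE dfs.
have cf (a b : R) : 0 < a -> {within `[a, b], continuous f}.
  move=> a0; apply: derivable_within_continuous => x; rewrite in_itv /= => /andP[ax _].
  by have [] := dfE x (lt_le_trans a0 ax).
have [v1|v1|->//] := ltgtP v 1.
- have D x : x \in `]v, 1[ -> is_derive x (1 : R) f (df x).
    by rewrite in_itv /= => /andP[vx _]; apply: dfE; exact: lt_trans v0 vx.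
  have [x] := MVT v1 D (cf v 1 v0); rewrite in_itv /= => /andP[vx x1] E.
  have := dfs x (lt_trans v0 vx); rewrite nmulr_rge0 ?subr_lt0// => h.
  by rewrite -subr_le0 E mulr_le0_ge0// subr_ge0 ltW.
- have D x : x \in `]1, v[ -> is_derive x (1 : R) f (df x).
    by rewrite in_itv /= => /andP[vx _]; apply: dfE; exact: lt_trans ltr01 vx.
  have [x] := MVT v1 D (cf 1 v ltr01); rewrite in_itv /= => /andP[vx x1] E.
  have := dfs x (lt_trans ltr01 vx); rewrite pmulr_rge0 ?subr_gt0// => h.
  by rewrite -subr_ge0 E mulr_ge0// subr_ge0 ltW.
Qed.

(* Divided by [v ^+ 2], the remainder has derivative [- w ^+ 3 / (3 * v ^+ 3)];
   adding [w ^+ 4 / (6 * v ^+ 2)] turns it into [w ^+ 3 / (3 * v ^+ 2)]. *)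
Lemma sqr_ln_taylor w : 0 <= 1 + w ->
  - (w ^+ 4 / 6) <= (1 + w) ^+ 2 * ln (1 + w) - (w + 3 / 2 * w ^+ 2 + w ^+ 3 / 3) <= 0.
Proof.
rewrite le_eqVlt => /orP[/eqP v0|]; last set v := 1 + w => v0.
  have -> : w = -1 by move: v0; lra.
  by rewrite subrr expr0n /= mul0r sub0r; apply/andP; split; lra.
have wE : w = v - 1 by rewrite /v; ring.
pose q (c : R) x : R := ln x - (x - 1 + 3 / 2 * (x - 1) ^+ 2 + (x - 1) ^+ 3 / 3
   - c * (x - 1) ^+ 4) * (x ^-1) ^+ 2.
pose dqf c x : R := x^-1 - ((1 + 3 * (x - 1) + (x - 1) ^+ 2 - 4 * c * (x - 1) ^+ 3) * (x^-1) ^+ 2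
    + (x - 1 + 3 / 2 * (x - 1) ^+ 2 + (x - 1) ^+ 3 / 3 - c * (x - 1) ^+ 4) * (- 2 * (x^-1) ^+ 3)).
have dq c x : 0 < x -> is_derive x (1 : R) (q c) (dqf c x).
  move=> x0; have xn0 : x != 0 by rewrite gt_eqF.
  have h1 := is_derive1_ln x0.
  have h2 : is_derive x (1 : R) (fun y : R => y^-1) (- x ^- 2).
    apply: is_derive_eq; first exact: (@is_deriveV R id x 1 1 xn0 (is_derive_id x 1)).
    by rewrite /GRing.scale /= mulr1.
  rewrite /q /dqf; apply: is_derive_eq; rewrite /GRing.scale /=.
  by field.
have [q1 q2] : q 0 v <= 0 /\ 0 <= q (1 / 6) v.
  have q1 c : q c 1 = 0 by rewrite /q ln1 subrr !expr0n /= !(mulr0, mul0r, addr0, subr0).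
  split.
    suff : (- q 0) 1 <= (- q 0) v by rewrite !fctE q1 oppr0 oppr_ge0.
    apply: (@min_at_one _ (fun x => - dqf 0 x) v v0) => [x x0|x x0].
      exact: is_deriveN (dq 0 x x0).
    have -> : (x - 1) * - dqf 0 x = ((x - 1) ^+ 2) ^+ 2 * (3^-1 * (x^-1) ^+ 3).
      by rewrite /dqf; field; rewrite gt_eqF.
    by rewrite mulr_ge0 ?sqr_ge0// mulr_ge0 ?invr_ge0// exprn_ge0// invr_ge0 ltW.
  rewrite -(q1 (1 / 6)); apply: (min_at_one v0 (dq (1 / 6))) => x x0.
  have -> : (x - 1) * dqf (1 / 6) x = ((x - 1) ^+ 2) ^+ 2 * (3^-1 * (x^-1) ^+ 2).
    by rewrite /dqf; field; rewrite gt_eqF.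
  by rewrite mulr_ge0 ?sqr_ge0// mulr_ge0 ?invr_ge0// exprn_ge0// invr_ge0 ltW.
have v2 : 0 < v ^+ 2 by rewrite exprn_gt0.
have E c : v ^+ 2 * q c v = v ^+ 2 * ln v - (w + 3 / 2 * w ^+ 2 + w ^+ 3 / 3 - c * w ^+ 4).
  by rewrite /q wE; field; rewrite gt_eqF.
have E0 := E 0; have E6 := E (1 / 6).
have : v ^+ 2 * q 0 v <= 0 by rewrite pmulr_rle0.
have : 0 <= v ^+ 2 * q (1 / 6) v by rewrite pmulr_rge0.
by rewrite E0 E6 mul0r subr0; lra.
Qed.

(** The homogeneous form of [sqr_ln_taylor], with [w = x / d]. It remains valid at [x = - d], where
    the logarithm is singular, so that a cell may end at a knot of the density. *)
Lemma sqr_ln_shift d x : d != 0 -> `|x| <= `|d| ->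
  `|(d + x) ^+ 2 * ln `|d + x| - ((d + x) ^+ 2 * ln `|d| + d * x + 3 / 2 * x ^+ 2
     + x ^+ 3 / 3 * d^-1)| <= x ^+ 4 / 6 * (d^-1) ^+ 2.
Proof.
move=> d0 xd; set w := x * d^-1.
have xE : x = d * w by rewrite /w mulrC divfK.
have w1 : `|w| <= 1 by rewrite normrM normfV ler_pdivrMr ?mul1r// normr_gt0.
have v0 : 0 <= 1 + w by move: w1; rewrite ler_norml; lra.
have /andP[lo hi] := sqr_ln_taylor v0.
set r := (1 + w) ^+ 2 * ln (1 + w) - (w + 3 / 2 * w ^+ 2 + w ^+ 3 / 3) in lo hi.
have -> : (d + x) ^+ 2 * ln `|d + x| - ((d + x) ^+ 2 * ln `|d| + d * x + 3 / 2 * x ^+ 2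
     + x ^+ 3 / 3 * d^-1) = d ^+ 2 * r.
  have -> : d + x = d * (1 + w) by rewrite xE mulrDr mulr1.
  have [v00|vn0] := eqVneq (1 + w) 0.
    have w_ : w = -1 by move: v00; lra.
    by rewrite /r v00 mulr0 expr0n /= !mul0r xE w_; field.
  have v0' : 0 < 1 + w by rewrite lt_neqAle eq_sym vn0.
  rewrite normrM (gtr0_norm v0') lnM ?posrE ?normr_gt0//.
  by rewrite /r xE; field.
have -> : x ^+ 4 / 6 * (d^-1) ^+ 2 = d ^+ 2 * (w ^+ 4 / 6) by rewrite xE; field.
rewrite normrM ger0_norm ?sqr_ge0// ler_wpM2l ?sqr_ge0//.
by rewrite ler_norml lo (le_trans hi)// mulr_ge0 ?invr_ge0// (exprM _ 2 2) sqr_ge0.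
Qed.

(** [sqr_ln_taylor] divided by [(1 + w) ^ 2], which is at least [9 / 16]. *)
Lemma ln1D_taylor w : `|w| <= 1 / 4 ->
  `|ln (1 + w) - (w - w ^+ 2 / 2 + w ^+ 3 / 3)| <= w ^+ 4.
Proof.
rewrite ler_norml => /andP[w1 w2]; have v0 : 0 < 1 + w by lra.
have /andP[lo hi] := sqr_ln_taylor (ltW v0).
have v2 : 0 < (1 + w) ^+ 2 by rewrite exprn_gt0.
rewrite -(ler_pM2l v2) -{1}(gtr0_norm v2) -normrM ler_norml.
have w4 : 0 <= w ^+ 4 by rewrite (exprM _ 2 2) sqr_ge0.
set L := ln _ in lo hi *.
have -> : (1 + w) ^+ 2 * (L - (w - w ^+ 2 / 2 + w ^+ 3 / 3)) =
  (1 + w) ^+ 2 * L - (w + 3 / 2 * w ^+ 2 + w ^+ 3 / 3) - w ^+ 4 * (1 / 6 + w / 3) by field.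
have h1 : w ^+ 4 * (1 / 6 + w / 3) <= w ^+ 4 * (1 / 4) by rewrite ler_wpM2l//; lra.
have h0 : 0 <= w ^+ 4 * (1 / 6 + w / 3) by rewrite mulr_ge0//; lra.
have h2 : w ^+ 4 * (9 / 16) <= (1 + w) ^+ 2 * w ^+ 4.
  by rewrite mulrC ler_wpM2r//; nra.
by apply/andP; split; lra.
Qed.

End LogTaylor.

(** * Concavity of the potential off the support *)

Section PotentialOnGaps.
Context (R : realType).
Notation T := (measurableTypeR R).
Implicit Types (ks : seq (R * R)) (t x y : R).
Let leb : {sigma_finite_measure set T -> \bar R} := @lebesgue_measure R.
Local Open Scope ring_scope.

Lemma ln_le_id x : 0 <= x -> ln x <= x.
Proof.
rewrite le_eqVlt => /orP[/eqP<-|x0]; first by rewrite ln0.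
by rewrite ltW// ln_sublinear.
Qed.

Lemma ln_concave t x y : 0 <= t <= 1 -> 0 < x -> 0 < y ->
  (1 - t) * ln x + t * ln y <= ln ((1 - t) * x + t * y).
Proof.
move=> /andP[t0 t1] x0 y0.
have s01 : 0 <= 1 - t <= 1 by apply/andP; split; lra.
have := @concave_ln R (Itv01 (proj1 (andP s01)) (proj2 (andP s01))) x y x0 y0.
by rewrite !convRE /= /unstable.onem subKr.
Qed.

(** For [y] outside the interval spanned by [x1] and [x2], the function [ln |y - x|] of [x] is
    concave there; integrate over [y]. *)
Lemma pl_potential_concave ks B x1 x2 t : pl_density ks B ->
  (forall y, 0 <= pl ks y) -> 0 <= t <= 1 ->
  (forall y, pl ks y != 0 -> y < Num.min x1 x2 \/ Num.max x1 x2 < y) ->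
  (1 - t) * pl_potential ks x1 + t * pl_potential ks x2 <=
  pl_potential ks ((1 - t) * x1 + t * x2).
Proof.
move=> h p0 /andP[t0 t1] gap; set u := _ * x1 + _.
have B0 y : pl ks y != 0 -> 0 < y < B.
  move=> py; apply/andP; split; rewrite ltNge; apply: contra py => hy.
    by rewrite (pl_left h).
  by rewrite (pl_right h).
(* Dominates [ln |y - x|] for [y] in the support and [x] among [x1], [x2], [u], so that only
   nonnegative functions are integrated. *)
pose A : R := B + `|x1| + `|x2| + `|u|.
have wA x y : 0 < y < B -> `|x| <= `|x1| + `|x2| + `|u| -> 0 <= A - ln `|y - x|.
  move=> /andP[y0 yB] hx; rewrite subr_ge0 (le_trans (ln_le_id _))//.
  by rewrite (le_trans (ler_normB _ _))// (gtr0_norm y0) /A; lra.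
have n1 := normr_ge0 x1; have n2 := normr_ge0 x2; have nu := normr_ge0 u.
have I (s x : R) : 0 <= s -> `|x| <= `|x1| + `|x2| + `|u| ->
    (\int[leb]_y ((s * (A - ln `|y - x|)) * pl ks y)%:E =
     (s * (A - pl_potential ks x))%:E)%E.
  move=> s0 hx.
  have := @integral_log_weight R ks B (s * A) 0 s x h.
  rewrite mul0r addr0 -mulrBr => <-; last first.
    by move=> y hy; rewrite mul0r addr0 -mulrBr mulr_ge0// wA.
  by apply: eq_integral => y _; rewrite mul0r addr0 -mulrBr.
have F0 (s x y : R) : 0 <= s -> `|x| <= `|x1| + `|x2| + `|u| ->
    0 <= (s * (A - ln `|y - x|)) * pl ks y.
  move=> s0 hx; have [->|/B0 hy] := eqVneq (pl ks y) 0; first by rewrite mulr0.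
  by rewrite mulr_ge0// mulr_ge0// wA.
have mF (s x : R) : measurable_fun [set: T]
    (fun y : T => ((s * (A - ln `|y - x|)) * pl ks y)%:E).
  apply/measurable_EFinP; apply: measurable_funM; last exact: measurable_pl.
  have := measurable_log_weight (s * A) 0 s x.
  by under eq_fun do rewrite mul0r addr0 -mulrBr.
have s0 : 0 <= 1 - t by rewrite subr_ge0.
have h1 : `|x1| <= `|x1| + `|x2| + `|u| by lra.
have h2 : `|x2| <= `|x1| + `|x2| + `|u| by lra.
have hu : `|u| <= `|x1| + `|x2| + `|u| by lra.
have : (\int[leb]_y ((1 * (A - ln `|y - u|)) * pl ks y)%:E <=
  \int[leb]_y (((1 - t) * (A - ln `|y - x1|) * pl ks y)%:E +
     (t * (A - ln `|y - x2|) * pl ks y)%:E))%E.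
  apply: ge0_le_integral => //.
  - by move=> y _; rewrite lee_fin F0.
  - exact: emeasurable_funD.
  move=> y _; rewrite -EFinD lee_fin -mulrDl.
  have [->|py] := eqVneq (pl ks y) 0; first by rewrite !mulr0.
  rewrite ler_wpM2r// mul1r.
  suff : (1 - t) * ln `|y - x1| + t * ln `|y - x2| <= ln `|y - u| by lra.
  have cv a b : 0 < a -> 0 < b -> 0 < (1 - t) * a + t * b.
    move=> a0 b0; have [->|tn0] := eqVneq t 0; first by rewrite subr0 mul1r mul0r addr0.
    by rewrite ltr_wpDl ?mulr_ge0 ?(ltW a0)// mulr_gt0// lt_neqAle eq_sym tn0.
  case: (gap y py); rewrite ?lt_min ?gt_max => /andP[y1 y2].
    have p1 : 0 < x1 - y by lra.
    have p2 : 0 < x2 - y by lra.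
    rewrite !(distrC y) (_ : u - y = (1 - t) * (x1 - y) + t * (x2 - y)); last by rewrite /u; ring.
    by rewrite !gtr0_norm ?cv// ln_concave// t0.
  have p1 : 0 < y - x1 by lra.
  have p2 : 0 < y - x2 by lra.
  rewrite (_ : y - u = (1 - t) * (y - x1) + t * (y - x2)); last by rewrite /u; ring.
  by rewrite !gtr0_norm ?cv// ln_concave// t0.
rewrite ge0_integralD//; [|by move=> y _; rewrite lee_fin F0|by move=> y _; rewrite lee_fin F0].
by rewrite !I// -EFinD lee_fin mul1r; lra.
Qed.

(* [Phi] is convex on a gap of the density which contains no root, so that it
   keeps growing beyond two points [x1], [x2] where it has grown. *)
Lemma pl_gap_le ks B (l0 : R) (rs : seq (R * R)) x1 x2 x : pl_density ks B ->
  (forall y, 0 <= pl ks y) -> 0 <= l0 ->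
  x1 < x2 <= x \/ x <= x2 < x1 ->
  (forall y, pl ks y != 0 -> y < Num.min x1 x \/ Num.max x1 x < y) ->
  (forall q, q \in rs -> 0 <= q.1 /\ (q.2 < Num.min x1 x \/ Num.max x1 x < q.2)) ->
  let Phi y := y - \sum_(q <- rs) q.1 * ln `|y - q.2| - l0 * pl_potential ks y in
  Phi x1 <= Phi x2 -> Phi x2 <= Phi x.
Proof.
move=> h p0 l00 xs gap rsP Phi P12.
pose t := (x2 - x1) / (x - x1).
have xx1 : x - x1 != 0 by case: xs => /andP[]; rewrite subr_eq0 => ? ?; apply/negP => /eqP; lra.
have [t0 t1] : 0 < t /\ t <= 1.
  rewrite /t; case: xs => /andP[h1 h2].
    by rewrite divr_gt0 ?ler_pdivrMr; lra.
  rewrite -mulrNN -invrN !opprB divr_gt0 ?ler_pdivrMr; lra.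
have t01 : 0 <= t <= 1 by rewrite (ltW t0).
have x2E : x2 = (1 - t) * x1 + t * x by rewrite /t; field.
have cU := pl_potential_concave h p0 t01 gap.
have cR : \sum_(q <- rs) q.1 * ((1 - t) * ln `|x1 - q.2| + t * ln `|x - q.2|) <=
    \sum_(q <- rs) q.1 * ln `|x2 - q.2|.
  rewrite big_seq [leRHS]big_seq; apply: ler_sum => q qr.
  have [q0 qx] := rsP q qr; rewrite ler_wpM2l//.
  have cv a1 a2 : 0 < a1 -> 0 < a2 -> 0 < (1 - t) * a1 + t * a2.
    by move=> a10 a20; rewrite ltr_wpDl ?mulr_ge0 ?subr_ge0 ?(ltW a10)// mulr_gt0.
  case: qx; rewrite ?lt_min ?gt_max => /andP[y1 y2].
    have p1 : 0 < x1 - q.2 by lra.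
    have p2 : 0 < x - q.2 by lra.
    rewrite (_ : x2 - q.2 = (1 - t) * (x1 - q.2) + t * (x - q.2)); last by rewrite x2E; ring.
    by rewrite !gtr0_norm ?cv// ln_concave.
  have p1 : 0 < q.2 - x1 by lra.
  have p2 : 0 < q.2 - x by lra.
  rewrite !(distrC _ q.2) (_ : q.2 - x2 = (1 - t) * (q.2 - x1) + t * (q.2 - x)); last by rewrite x2E; ring.
  by rewrite !gtr0_norm ?cv// ln_concave.
have cP : Phi x2 <= (1 - t) * Phi x1 + t * Phi x.
  rewrite /Phi.
  have : \sum_(q <- rs) q.1 * ((1 - t) * ln `|x1 - q.2| + t * ln `|x - q.2|) =
    (1 - t) * (\sum_(q <- rs) q.1 * ln `|x1 - q.2|) + t * (\sum_(q <- rs) q.1 * ln `|x - q.2|).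
    by rewrite !mulr_sumr -big_split /=; apply: eq_bigr => q _; ring.
  move: cR => /[swap] ->.
  have : l0 * ((1 - t) * pl_potential ks x1 + t * pl_potential ks x) <= l0 * pl_potential ks x2.
    by rewrite ler_wpM2l// x2E.
  by rewrite {3}x2E; lra.
have : t * Phi x2 <= t * Phi x by nra.
by rewrite ler_pM2l.
Qed.

End PotentialOnGaps.

Arguments Z.shiftr : simpl never.
Arguments Z.shiftl : simpl never.
Arguments Z.add : simpl never.
Arguments Z.sub : simpl never.
Arguments Z.opp : simpl never.
Arguments Z.abs : simpl never.
Arguments Z.mul : simpl never.
Arguments Z.div : simpl never.
Arguments Z.pow : simpl never.

(** * Binary integers as real numbers *)

Section ZReal.
Context (R : realType).
Local Open Scope ring_scope.

(* Locked, lest an automatic tactic evaluate a large constant in unary. *)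
Fact zr_key : unit. Proof. exact: tt. Qed.

Definition zr : Z -> R := locked_with zr_key (fun z => (int_of_Z z)%:~R).

Lemma zrE z : zr z = (int_of_Z z)%:~R. Proof. by rewrite /zr unlock. Qed.

Lemma zr0 : zr Z0 = 0. Proof. by rewrite zrE. Qed.

Lemma zr1 : zr (Zpos xH) = 1. Proof. by rewrite zrE. Qed.

Lemma zrD x y : zr (Z.add x y) = zr x + zr y.
Proof. by rewrite !zrE -intrD -rmorphD. Qed.

Lemma zr2 : zr (Zpos 2) = 2. Proof. by rewrite zrE. Qed.

Lemma zrN x : zr (Z.opp x) = - zr x.
Proof. by rewrite !zrE -rmorphN -raddfN. Qed.

Lemma zrB x y : zr (Z.sub x y) = zr x - zr y.
Proof. by rewrite -Z.add_opp_r zrD zrN. Qed.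

Lemma zrM x y : zr (Z.mul x y) = zr x * zr y.
Proof. by rewrite !zrE -intrM -rmorphM. Qed.

Lemma zr_le x y : Z.le x y -> zr x <= zr y.
Proof. 
move=> /Z.sub_nonneg h; rewrite -subr_ge0 -zrB.
by case: (Z.sub y x) h => [|p|p] //= _; rewrite zrE ler0z.
Qed.

Lemma zr_lt x y : Z.lt x y -> zr x < zr y.
Proof.
move=> h; have /zr_le : Z.le (Z.succ x) y by apply/Z.le_succ_l.
by rewrite -Z.add_1_r zrD zr1; apply: lt_le_trans; rewrite ltrDl ltr01.
Qed.

Lemma zr_ge0 x : Z.le 0 x -> 0 <= zr x. Proof. by move=> /zr_le; rewrite zr0. Qed.

Lemma zr_gt0 x : Z.lt 0 x -> 0 < zr x. Proof. by move=> /zr_lt; rewrite zr0. Qed.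

Lemma zr_lt0 x : Z.lt x 0 -> zr x < 0. Proof. by move=> /zr_lt; rewrite zr0. Qed.

Lemma zr_abs x : zr (Z.abs x) = `|zr x|.
Proof.
case: (Z.abs_spec x) => [[h ->]|[h ->]].
  by rewrite ger0_norm ?zr_ge0.
by rewrite zrN ltr0_norm // zr_lt0.
Qed.

Lemma zr_nat n : zr (Z.of_nat n) = n%:R.
Proof.
by elim: n => [|n IH]; rewrite ?zr0// Nat2Z.inj_succ -Z.add_1_r zrD zr1 IH -natr1.
Qed.

Lemma zr_pow x n : zr (Z.pow x (Z.of_nat n)) = zr x ^+ n.
Proof.
elim: n => [|n IH]; first by rewrite zr1 expr0.
rewrite Nat2Z.inj_succ Z.pow_succ_r ?zrM ?IH ?exprS//.
exact: Nat2Z.is_nonneg.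
Qed.

Lemma zr_div x y : y <> Z0 -> zr (Z.div x y) <= zr x / zr y < zr (Z.div x y) + 1.
Proof.
move=> y0; have E := Z.div_mod x y y0.
have := congr1 zr E; rewrite zrD zrM => ->.
have yn0 : zr y != 0.
  case: y y0 {E} => // p _; first by rewrite gt_eqF ?zr_gt0.
  by rewrite lt_eqF// zr_lt0.
rewrite mulrDl (mulrC (zr y)) mulfK// lerDl ltrD2l.
case: (Z_lt_le_dec 0 y) => ys.
  have [m0 m1] := Z.mod_pos_bound x y ys; have y1 := zr_gt0 ys.
  have h0 := zr_ge0 m0; have h1 := zr_lt m1.
  by rewrite divr_ge0 ?(ltW y1)//= ltr_pdivrMr// mul1r.
have yneg : Z.lt y 0 by apply/Z.le_neq.
have [m0 m1] := Z.mod_neg_bound x y yneg; have y1 := zr_lt0 yneg.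
have h0 := zr_lt m0; have := zr_le m1; rewrite zr0 => h1.
rewrite -mulrNN -invrN divr_ge0 ?oppr_ge0 ?(ltW y1)//=.
by rewrite ltr_pdivrMr ?oppr_gt0// mul1r ltrN2.
Qed.

Lemma zr_shiftr x n :
  zr (Z.shiftr x (Z.of_nat n)) <= zr x / 2 ^+ n < zr (Z.shiftr x (Z.of_nat n)) + 1.
Proof.
rewrite Z.shiftr_div_pow2; last exact: Nat2Z.is_nonneg.
rewrite (_ : 2 ^+ n = zr (Z.pow 2 (Z.of_nat n))); last by rewrite zr_pow zr2.
apply: zr_div; apply: Z.pow_nonzero => //; exact: Nat2Z.is_nonneg.
Qed.

Lemma zr_shiftl x n : zr (Z.shiftl x (Z.of_nat n)) = zr x * 2 ^+ n.
Proof.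
by rewrite Z.shiftl_mul_pow2 ?zrM ?zr_pow ?zr2//; exact: Nat2Z.is_nonneg.
Qed.

End ZReal.

(** * Fixed-point interval arithmetic and interval polynomials *)

Section IntervalDefs.
Local Open Scope Z_scope.

(** The unit [2 ^ 44]. An interval is a pair of a centre and a radius, both in multiples of
    [2 ^ -44]. *)
Definition fscale : Z := 17592186044416.

Definition iadd (a b : Z * Z) : Z * Z := (a.1 + b.1, a.2 + b.2).

Definition iopp (a : Z * Z) : Z * Z := (- a.1, a.2).

(** The final [2] pays for the two roundings by [Z.shiftr], each of which loses less than 1. *)
Definition imul (a b : Z * Z) : Z * Z :=
  (Z.shiftr (a.1 * b.1) 44,
   Z.shiftr (Z.abs a.1 * b.2 + a.2 * (Z.abs b.1 + b.2)) 44 + 2).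

Definition idiv (a : Z * Z) (n : Z) : Z * Z := (a.1 / n, a.2 / n + 2).

Definition irat (m n : Z) : Z * Z := (m * fscale / n, 1).

Definition iwiden (e : Z) (a : Z * Z) : Z * Z := (a.1, a.2 + e).

(** The magnitude: a bound on the absolute value over the whole interval. *)
Definition imag (a : Z * Z) : Z := Z.abs a.1 + a.2.

(** Polynomials are lists of interval coefficients, constant term first. *)
Fixpoint padd (p q : seq (Z * Z)) : seq (Z * Z) :=
  match p, q with
  | [::], _ => q
  | _, [::] => p
  | a :: p, b :: q => iadd a b :: padd p q
  end.

Definition pscale (a : Z * Z) (p : seq (Z * Z)) : seq (Z * Z) := map (imul a) p.

Fixpoint pmul (p q : seq (Z * Z)) : seq (Z * Z) :=
  match p with
  | [::] => [::]
  | a :: p => padd (pscale a q) ((0, 0) :: pmul p q)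
  end.

(** Absorbs a remainder of size [e] into the constant coefficient. *)
Definition pwiden (e : Z) (p : seq (Z * Z)) : seq (Z * Z) :=
  match p with
  | [::] => [:: (0, e)]
  | a :: p => iwiden e a :: p
  end.

Fixpoint horner_ival (p : seq (Z * Z)) (x : Z * Z) : Z * Z :=
  match p with
  | [::] => (0, 0)
  | a :: p => iadd a (imul x (horner_ival p x))
  end.

End IntervalDefs.

Section IntervalTheory.
Context (R : realType).
Local Open Scope ring_scope.
Notation zr := (@zr R).
Notation S := (zr fscale).
Implicit Types (x y : R) (e : Z) (a b : Z * Z) (p q : seq (Z * Z)).

Definition contains a x : Prop := `|S * x - zr a.1| <= zr a.2.

Lemma fscaleE : S = 2 ^+ 44.
Proof. by rewrite -zr2 -zr_pow. Qed.

Lemma fscale_gt0 : 0 < S.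
Proof. exact: zr_gt0. Qed.

Lemma contains_ge0 a x : contains a x -> 0 <= zr a.2.
Proof. exact: le_trans. Qed.

Lemma containsP a x : contains a x ->
  zr a.1 - zr a.2 <= S * x <= zr a.1 + zr a.2.
Proof. by rewrite /contains ler_norml => /andP[h1 h2]; apply/andP; split; lra. Qed.

Lemma contains_imag a x : contains a x -> S * `|x| <= zr (imag a).
Proof.
move=> h; rewrite /imag zrD zr_abs.
have -> : S * `|x| = `|S * x| by rewrite normrM gtr0_norm// fscale_gt0.
have -> : S * x = zr a.1 + (S * x - zr a.1) by ring.
by rewrite (le_trans (ler_normD _ _))// lerD2l.
Qed.

Lemma contains_add a b x y : contains a x -> contains b y -> contains (iadd a b) (x + y).
Proof.
rewrite /contains /= !zrD => ha hb.
rewrite (_ : _ - _ = (S * x - zr a.1) + (S * y - zr b.1)); last by ring.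
by rewrite (le_trans (ler_normD _ _))// lerD.
Qed.

Lemma contains_opp a x : contains a x -> contains (iopp a) (- x).
Proof. by rewrite /contains /= zrN mulrN -opprD normrN. Qed.

Lemma contains_mul a b x y : contains a x -> contains b y -> contains (imul a b) (x * y).
Proof.
move=> ha hb; have a0 := contains_ge0 ha; have b0 := contains_ge0 hb.
rewrite /contains /= zrD zr2.
set m := Z.mul a.1 b.1; set r := Z.add _ _.
have sh z : zr (Z.shiftr z 44) <= zr z / S < zr (Z.shiftr z 44) + 1.
  by rewrite fscaleE; exact: (zr_shiftr R z 44).
have := sh m; have := sh r.
set fr := zr (Z.shiftr r 44); set fm := zr (Z.shiftr m 44).
move=> /andP[r1 r2] /andP[m1 m2]; have S0 := fscale_gt0.
have -> : S * (x * y) = zr m / S + (zr a.1 * (S * y - zr b.1) +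
     (S * x - zr a.1) * (zr b.1 + (S * y - zr b.1))) / S.
  by rewrite /m zrM; field; rewrite gt_eqF.
set t := zr a.1 * _ + _.
have ht : `|t| <= zr r.
  rewrite /t /r zrD !zrM !zrD !zr_abs (le_trans (ler_normD _ _))// !normrM.
  by rewrite lerD// ?ler_wpM2l// ler_pM// (le_trans (ler_normD _ _))// lerD2l.
have htS : `|t / S| <= fr + 1.
  by rewrite normrM normfV (gtr0_norm S0) (le_trans _ (ltW r2))// ler_wpM2r// invr_ge0 ltW.
have -> : zr m / S + t / S - fm = (zr m / S - fm) + t / S by ring.
rewrite (le_trans (ler_normD _ _))//.
have : `|zr m / S - fm| <= 1 by rewrite ger0_norm; lra.
by move: htS; lra.
Qed.

Lemma contains_div a x n : Z.lt 0 n -> contains a x -> contains (idiv a n) (x / zr n).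
Proof.
move=> n0 ha; have n0' : n <> Z0 by move=> n00; rewrite n00 in n0.
have nR := zr_gt0 R n0.
rewrite /contains /= zrD; rewrite zr2.
have /andP[r1 r2] := zr_div R a.2 n0'; have /andP[m1 m2] := zr_div R a.1 n0'.
have -> : S * (x / zr n) - zr (Z.div a.1 n) =
  (S * x - zr a.1) / zr n + (zr a.1 / zr n - zr (Z.div a.1 n)) by ring.
rewrite (le_trans (ler_normD _ _))//.
have : `|(S * x - zr a.1) / zr n| <= zr a.2 / zr n.
  by rewrite normrM normfV (gtr0_norm nR) ler_wpM2r// invr_ge0 ltW.
have : `|zr a.1 / zr n - zr (Z.div a.1 n)| <= 1 by rewrite ger0_norm; lra.
by lra.
Qed.

Lemma contains_rat m n : n <> Z0 -> contains (irat m n) (zr m / zr n).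
Proof.
move=> n0; have /andP[h1 h2] := zr_div R (Z.mul m fscale) n0.
rewrite /contains /= zr1; move: h1 h2; rewrite zrM.
have -> : S * (zr m / zr n) = zr m * S / zr n by ring.
by move=> h1 h2; rewrite ger0_norm; lra.
Qed.

Lemma contains_widen a x y e : contains a x -> S * `|y - x| <= zr e -> contains (iwiden e a) y.
Proof.
rewrite /contains /= zrD => ha hy.
have -> : S * y - zr a.1 = (S * x - zr a.1) + S * (y - x) by ring.
by rewrite (le_trans (ler_normD _ _))// lerD// normrM gtr0_norm ?fscale_gt0.
Qed.

Lemma contains0 : contains (Z0, Z0) 0.
Proof. by rewrite /contains /= zr0 mulr0 subr0 normr0. Qed.

(** An enclosure at the single point [x]: the coefficients picked in the intervals may depend on
    [x], which is how a Taylor remainder is allowed to sit in the constant term. *)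
Fixpoint encl p x y : Prop :=
  match p with
  | [::] => y = 0
  | a :: p => exists2 c, contains a c & exists2 z, encl p x z & y = c + x * z
  end.

Lemma encl_add p q x y z : encl p x y -> encl q x z -> encl (padd p q) x (y + z).
Proof.
elim: p q y z => [|a p IH] [|b q] y z /=.
- by move=> -> ->; rewrite addr0.
- by move=> ->; rewrite add0r.
- by move=> h ->; rewrite addr0.
- move=> [c ca [y1 py1 ->]] [d db [z1 pz1 ->]].
  exists (c + d); first exact: contains_add.
  by exists (y1 + z1); [exact: IH|ring].
Qed.

Lemma encl_scale a p x c y : contains a c -> encl p x y -> encl (pscale a p) x (c * y).
Proof.
move=> ac; elim: p y => [|b p IH] y /= => [->|]; first by rewrite mulr0.
move=> [d db [y1 py1 ->]]; exists (c * d); first exact: contains_mul.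
by exists (c * y1); [exact: IH|ring].
Qed.

Lemma encl_mul p q x y z : encl p x y -> encl q x z -> encl (pmul p q) x (y * z).
Proof.
elim: p y => [|a p IH] y /= => [-> _|]; first by rewrite mul0r.
move=> [c ca [y1 py1 ->]] hz.
rewrite mulrDl; apply: encl_add; first exact: encl_scale.
exists 0; first exact: contains0.
by exists (y1 * z); [exact: IH|ring].
Qed.

Lemma encl_widen e p x y z : encl p x y -> S * `|z - y| <= zr e -> encl (pwiden e p) x z.
Proof.
case: p => [|a p] /= => [->|[c ca [y1 py1 ->]]] h.
  exists z; last by exists 0; [|rewrite mulr0 addr0].
  by move: h; rewrite /contains /= zr0 !subr0 normrM gtr0_norm// fscale_gt0.
exists (c + (z - (c + x * y1))); last by exists y1 => //; ring.
by apply: contains_widen ca _; rewrite (_ : _ - c = z - (c + x * y1)) //; ring.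
Qed.

Lemma contains_horner p a x y : encl p x y -> contains a x -> contains (horner_ival p a) y.
Proof.
move=> h ax; elim: p y h => [|b p IH] y /= => [->|[c ca [z hz ->]]].
  exact: contains0.
by apply: contains_add => //; apply: contains_mul => //; exact: IH.
Qed.

End IntervalTheory.

(** * A table of logarithms and reciprocals with a proved error bound *)

Section LogTable.
Local Open Scope Z_scope.

Inductive log_tree := LogLeaf of Z * Z | LogNode of log_tree & log_tree.

(** [2 ^ 60] times [1 / n - 1 / (2 n ^ 2) + 1 / (3 n ^ 3)], the start of the series of
    [ln (1 + 1 / n)], rounded down. *)
Definition log_step (n : Z) : Z :=
  1152921504606846976 * (6 * (n * n) - 3 * n + 2) / (6 * (n * n * n)).

(** Logarithms are accumulated at scale [2 ^ 60] and shifted by 16 bits to scale [2 ^ 44], so that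
    the errors of the many additions stay small. The second component bounds [2 ^ 40 / n] from
    above. *)
Fixpoint log_list (k : nat) (n acc : Z) : seq (Z * Z) :=
  match k with
  | 0%nat => [::]
  | S k => (Z.shiftr acc 16, 1099511627776 / n + 1) :: log_list k (n + 1) (acc + log_step n)
  end.

(** Even and odd positions, that is, a split on the lowest bit of the index. *)
Fixpoint halves (T : Type) (l : seq T) : seq T * seq T :=
  match l with
  | x :: y :: l => let (a, b) := halves l in (x :: a, y :: b)
  | _ => (l, [::])
  end.

Fixpoint log_tree_of (d : nat) (l : seq (Z * Z)) : log_tree :=
  match d with
  | 0%nat => LogLeaf (head (0, 0) l)
  | S d => let (a, b) := halves l in LogNode (log_tree_of d a) (log_tree_of d b)
  end.

(* Bits are read from the least significant one. *)
Fixpoint log_look (t : log_tree) (p : positive) : Z * Z :=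
  match t, p with
  | LogLeaf e, _ => e
  | LogNode a b, xO p => log_look a p
  | LogNode a b, xI p => log_look b p
  | LogNode _ _, xH => (0, 0)
  end.

(** Doubles [p] until it reaches [2 ^ 14], within [k] doublings, and counts them in [s]. *)
Fixpoint log_norm (k : nat) (p : positive) (s : Z) : positive * Z :=
  match k with
  | 0%nat => (p, s)
  | S k => if Pos.ltb p 16384 then log_norm k (xO p) (s + 1) else (p, s)
  end.

(* The pair is made of [2 ^ 44 * ln (p / 2 ^ 14)] and [2 ^ 40 / p]. *)
Definition log_at (t : log_tree) (ln2 : Z) (p : positive) : Z * Z :=
  let (q, s) := log_norm 14 p 0 in
  let (l, r) := log_look t q in
  (l - s * ln2, Z.shiftl r s).

End LogTable.

Section LogTableTheory.
Context (R : realType).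
Local Open Scope ring_scope.
Notation zr := (@zr R).
Notation S := (zr fscale).

Lemma nth_halves (T : Type) (x0 : T) l i :
  nth x0 (halves l).1 i = nth x0 l i.*2 /\ nth x0 (halves l).2 i = nth x0 l i.*2.+1.
Proof.
have [n] := ubnP (size l); elim: n l i => // n IH [|x [|y l]] i /=.
- by case: i.
- by case: i => [|[|i]].
rewrite ltnS => sl; have := IH l; case: (halves l) => a b /= {}IH.
by case: i => [|i] //=; apply: IH; apply: leq_trans sl.
Qed.

Lemma log_look_nth d l p i : Pos.to_nat p = (2 ^ d + i)%N -> (i < 2 ^ d)%N ->
  log_look (log_tree_of d l) p = nth (Z0, Z0) l i.
Proof.
elim: d l p i => [|d IH] l p i /=.
  by rewrite expn0 ltnS leqn0 => _ /eqP->; rewrite nth0.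
have := nth_halves (Z0, Z0) l; case: (halves l) => a b /= ab.
rewrite expnS; case: p => [p|p|] E iD.
- have [j jE] : exists j, Pos.to_nat p = (2 ^ d + j)%N by exists (Pos.to_nat p - 2 ^ d)%N; lia.
  have -> : i = j.*2.+1 by lia.
  by rewrite -(ab j).2; apply: IH => //; lia.
- have [j jE] : exists j, Pos.to_nat p = (2 ^ d + j)%N by exists (Pos.to_nat p - 2 ^ d)%N; lia.
  have -> : i = j.*2 by lia.
  by rewrite -(ab j).1; apply: IH => //; lia.
- have : (0 < 2 ^ d)%N by rewrite expn_gt0. 
  by lia.
Qed.

(** The bound 17 is 1 for the rounding plus 16 for the Taylor remainder, which is at most
    [2 ^ 60 / n ^ 4] with [n >= 2 ^ 14]. *)
Lemma log_step_le n : Z.le 16384 n ->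
  `|zr (log_step n) - 2 ^+ 60 * (ln (zr (n + 1)) - ln (zr n))| <= 17.
Proof.
move=> n14; have nR := zr_le R n14.
have K14 : zr 16384 = 2 ^+ 14 by rewrite -zr2 -zr_pow.
have n0 : 0 < zr n by rewrite (lt_le_trans _ nR)// K14 exprn_gt0.
set w := (zr n)^-1; have w0 : 0 < w by rewrite invr_gt0.
have w14 : w <= (2 ^+ 14)^-1 by rewrite lef_pV2 ?posrE ?exprn_gt0// -K14.
have w4 : `|w| <= 1 / 4.
  rewrite gtr0_norm// (le_trans w14)// mul1r lef_pV2 ?posrE ?exprn_gt0//.
  by rewrite -natrX ler_nat.
have hT := ln1D_taylor w4.
have -> : ln (zr (n + 1)) - ln (zr n) = ln (1 + w).
  rewrite zrD zr1 -ln_div ?posrE//; last by rewrite addr_gt0.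
  by congr ln; rewrite /w; field; rewrite gt_eqF.
have d0 : Z.mul 6 (Z.mul (Z.mul n n) n) <> Z0 by lia.
have := zr_div R (Z.mul 1152921504606846976 (Z.add (Z.sub (Z.mul 6 (Z.mul n n)) (Z.mul 3 n)) 2)) d0.
rewrite -/(log_step n); set fl := zr (log_step n).
have z6 : zr 6 = 6 by rewrite zrE.
have z3 : zr 3 = 3 by rewrite zrE.
have K60 : zr 1152921504606846976 = 2 ^+ 60 by rewrite -zr2 -zr_pow.
rewrite !zrM !zrD !zrN K60 !zrM z6 z3 zr2.
have -> : 2 ^+ 60 * (6 * (zr n * zr n) - 3 * zr n + 2) / (6 * (zr n * zr n * zr n)) =
   2 ^+ 60 * (w - w ^+ 2 / 2 + w ^+ 3 / 3).
  by rewrite /w; field; rewrite gt_eqF.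
set P := w - _ + _ in hT *; set K : R := 2 ^+ 60.
have K0 : 0 < K by rewrite exprn_gt0.
move=> /andP[f1 f2].
have h4 : K * w ^+ 4 <= 16.
  have -> : 16 = K * ((2 ^+ 14)^-1) ^+ 4.
    rewrite /K -exprVn -exprM; have -> : (60 = 4 + 56)%N by [].
    by rewrite exprD -mulrA -exprMn divff// expr1n mulr1 -natrX.
  by rewrite ler_pM2l// lerXn2r// nnegrE ?invr_ge0 ltW// exprn_gt0.
have hK : K * `|ln (1 + w) - P| <= 16 by rewrite (le_trans _ h4)// ler_pM2l.
have hK' : `|K * (ln (1 + w) - P)| <= 16 by rewrite normrM gtr0_norm.
move: hK'; rewrite !ler_norml => /andP[k1 k2]; apply/andP; split; lra.
Qed.

Definition log_entry (n : Z) (e : Z * Z) : Prop :=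
  `|zr e.1 - S * ln (zr n / 2 ^+ 14)| <= 6 /\
  0 <= zr e.2 / 2 ^+ 40 - (zr n)^-1 <= (2 ^+ 40)^-1.

(** After at most [2 ^ 14] steps the accumulated error is at most [17 * 2 ^ 14], which becomes
    [17 / 4] after the shift; rounding adds 1, and 6 covers the total. *)
Lemma log_list_entry k n acc i : Z.le 16384 n -> (i < k)%N ->
  Z.le (Z.add n (Z.of_nat i)) 32768 ->
  `|zr acc - 2 ^+ 60 * ln (zr n / 2 ^+ 14)| <= 17 * (zr n - zr 16384) ->
  log_entry (Z.add n (Z.of_nat i)) (nth (Z0, Z0) (log_list k n acc) i).
Proof.
have K14 : zr 16384 = 2 ^+ 14 by rewrite -zr2 -zr_pow.
have p14 : 0 < 2 ^+ 14 :> R by rewrite exprn_gt0.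
elim: k n acc i => // k IH n acc [|i] n14 ik n15 hacc; have nR := zr_le R n14.
- have n0 : 0 < zr n by rewrite (lt_le_trans _ nR)// K14 exprn_gt0.
  rewrite (_ : Z.add n (Z.of_nat 0) = n); last by rewrite Z.add_0_r.
  have nle : zr n - zr 16384 <= 2 ^+ 14.
    have := zr_le R n15; rewrite Z.add_0_r (_ : Zpos 32768 = Z.add 16384 16384)// zrD -K14; lra.
  split => /=.
  + have /andP[s1 s2] := zr_shiftr R acc 16.
    have p16 : 0 < 2 ^+ 16 :> R by rewrite exprn_gt0.
    have : `|zr acc / 2 ^+ 16 - 2 ^+ 44 * ln (zr n / 2 ^+ 14)| <= 17 / 4.
      have -> : zr acc / 2 ^+ 16 - 2 ^+ 44 * ln (zr n / 2 ^+ 14) =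
          (zr acc - 2 ^+ 60 * ln (zr n / 2 ^+ 14)) / 2 ^+ 16.
        rewrite mulrBl (_ : (60 = 16 + 44)%N)// exprD.
        by congr (_ - _); field.
      rewrite normrM normfV (gtr0_norm p16) ler_pdivrMr// (le_trans hacc)//.
      rewrite (_ : 17 / 4 * 2 ^+ 16 = 17 * 2 ^+ 14) ?ler_wpM2l//.
      by rewrite (_ : (16 = 2 + 14)%N)// exprD; field.
    rewrite fscaleE; set X := 2 ^+ 44 * _; move: s1 s2.
    rewrite (_ : Z.of_nat 16 = Zpos 16)//.
    set fl := zr (Z.shiftr acc 16); set y := zr acc / _ => s1 s2.
    by rewrite !ler_norml => /andP[h1 h2]; apply/andP; split; lra.
  + have n00 : n <> Z0 by lia.
    have /andP[s1 s2] := zr_div R 1099511627776 n00.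
    have K40 : zr 1099511627776 = 2 ^+ 40 by rewrite -zr2 -zr_pow.
    have p40 : 0 < 2 ^+ 40 :> R by rewrite exprn_gt0.
    rewrite zrD zr1 -(ler_pM2r p40) -[X in _ && X](ler_pM2r p40) mul0r.
    rewrite mulrBl divfK ?gt_eqF// mulVf ?gt_eqF//.
    by move: s1 s2; rewrite K40 (mulrC _^-1) => s1 s2; apply/andP; split; lra.
- rewrite (_ : Z.add n (Z.of_nat i.+1) = Z.add (Z.add n 1) (Z.of_nat i)); last by lia.
  rewrite /=; apply: IH => //; [lia|lia|].
  have := log_step_le n14; have n0 : 0 < zr n by rewrite (lt_le_trans _ nR)// K14 exprn_gt0.
  have n1 : 0 < zr (Z.add n 1) by rewrite zrD zr1 addr_gt0.
  move: hacc; rewrite !ln_div ?posrE// !zrD zr1.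
  set L1 := ln (zr n + 1); set L := ln (zr n); set L0 := ln _; set K := 2 ^+ 60.
  by rewrite !ler_norml => /andP[a1 a2] /andP[b1 b2]; apply/andP; split; lra.
Qed.

(** The extra last entry, at [2 ^ 15], is [ln 2]. *)
Definition log_table : seq (Z * Z) := log_list (2 ^ 14).+1 16384 Z0.

Lemma log_table_entry i : (i <= 2 ^ 14)%N ->
  log_entry (Z.add 16384 (Z.of_nat i)) (nth (Z0, Z0) log_table i).
Proof.
move=> i14; apply: log_list_entry => //; [lia|].
have K14 : zr 16384 = 2 ^+ 14 by rewrite -zr2 -zr_pow.
by rewrite zr0 subrr mulr0 K14 divff ?gt_eqF ?exprn_gt0// ln1 mulr0 subrr normr0.
Qed.

Lemma size_log_list k n acc : size (log_list k n acc) = k.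
Proof. by elim: k n acc => //= k IH n acc; rewrite IH. Qed.

Lemma last_log_table : last (Z0, Z0) log_table = nth (Z0, Z0) log_table (2 ^ 14).
Proof. by rewrite -nth_last /log_table size_log_list -pred_Sn. Qed.

Lemma log_norm_spec k p s : Z.le 16384 (Z.mul (Zpos p) (Z.pow 2 (Z.of_nat k))) ->
  Z.lt (Zpos p) 32768 ->
  exists j q, [/\ (j <= k)%N, log_norm k p s = (q, Z.add s (Z.of_nat j)),
    Zpos q = Z.mul (Zpos p) (Z.pow 2 (Z.of_nat j)), Z.le 16384 (Zpos q) & Z.lt (Zpos q) 32768].
Proof.
elim: k p s => [|k IH] p s h1 h2.
  by exists 0%N, p; split => //=; rewrite ?Z.add_0_r ?Z.mul_1_r//; lia.
rewrite /=; case: Pos.ltb_spec => hp; last first.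
  by exists 0%N, p; split => //=; rewrite ?Z.add_0_r ?Z.mul_1_r//; lia.
have E : Zpos (xO p) = Z.mul 2 (Zpos p) by lia.
move: h1; rewrite Nat2Z.inj_succ Z.pow_succ_r; last exact: Nat2Z.is_nonneg.
move=> h1; have [||j [q [j1 j2 j3 j4 j5]]] := IH (xO p) (Z.add s 1).
- by rewrite E; lia.
- by rewrite E; lia.
exists j.+1, q; split => //.
- by rewrite j2; congr (_, _); lia.
- by rewrite j3 E Nat2Z.inj_succ Z.pow_succ_r; [ring|exact: Nat2Z.is_nonneg].
Qed.

(** The error 90 is 6 for a table entry plus 6 for each of at most 14 subtractions of [ln 2]. For
    the reciprocal, the entry error [2 ^ -40] is multiplied by [2 ^ j], where
    [p * 2 ^ j <= 2 ^ 15]. *)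
Definition log_oracle (t : log_tree) (ln2 : Z) : Prop :=
  forall p, Z.lt (Zpos p) 32768 ->
  `|zr (log_at t ln2 p).1 - S * ln (zr (Zpos p) / 2 ^+ 14)| <= 90 /\
  0 <= zr (log_at t ln2 p).2 / 2 ^+ 40 - (zr (Zpos p))^-1 <= (2 ^+ 25)^-1 / zr (Zpos p).

Lemma log_tableP l : l = log_table -> log_oracle (log_tree_of 14 l) (last (Z0, Z0) l).1.
Proof.
move=> lE p p15.
have [||j [q [j14 nE qE q1 q2]]] := @log_norm_spec 14 p Z0 => //; first by lia.
rewrite /log_at nE.
have [i iE] : exists i, Pos.to_nat q = (2 ^ 14 + i)%N by exists (Pos.to_nat q - 2 ^ 14)%N; lia.
have i14 : (i < 2 ^ 14)%N by lia.
rewrite (log_look_nth l iE i14) lE.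
have [h1 h2] := log_table_entry (ltnW i14).
have := log_table_entry (leqnn (2 ^ 14)).
rewrite -last_log_table.
move: (last _ _) => e2 [g1 _].
move: (nth _ _ _) h1 h2 => [l1 r1] /= h1 h2.
have qZ : Z.add 16384 (Z.of_nat i) = Zpos q by lia.
rewrite qZ in h1 h2.
have p0 : 0 < zr (Zpos p) by exact: zr_gt0.
have E : zr (Zpos q) = zr (Zpos p) * 2 ^+ j by rewrite qE zrM zr_pow zr2.
have K14 : zr 16384 = 2 ^+ 14 by rewrite -zr2 -zr_pow.
split.
  rewrite zrB zrM zr_nat.
  have L : ln (zr (Zpos q) / 2 ^+ 14) = ln (zr (Zpos p) / 2 ^+ 14) + j%:R * ln 2.
    by rewrite E mulrAC [LHS]lnM ?posrE ?divr_gt0 ?exprn_gt0// lnXn// mulr_natl.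
  have L2 : ln (zr (Z.add 16384 (Z.of_nat (2 ^ 14))) / 2 ^+ 14) = ln 2.
    rewrite (_ : Z.add _ _ = Z.mul 2 16384) ?zrM ?zr2 ?K14; last by lia.
    by rewrite mulfK // gt_eqF ?exprn_gt0.
  rewrite L2 in g1; rewrite L in h1.
  have j0 : 0 <= j%:R :> R by rewrite ler0n.
  have j14R : j%:R <= 14 :> R by rewrite ler_nat.
  have gj : `|j%:R * (zr e2.1 - S * ln 2)| <= 14 * 6.
    by rewrite normrM ger0_norm// ler_pM.
  rewrite (_ : _ - _ = (zr l1 - S * (ln (zr (Zpos p) / 2 ^+ 14) + j%:R * ln 2)) -
     j%:R * (zr e2.1 - S * ln 2)); last by ring.
  by rewrite (le_trans (ler_normB _ _))//; lra.
have sE : Z.add Z0 (Z.of_nat j) = Z.of_nat j by [].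
rewrite sE zr_shiftl.
have p2j : 0 < 2 ^+ j :> R by rewrite exprn_gt0.
have -> : zr r1 * 2 ^+ j / 2 ^+ 40 - (zr (Zpos p))^-1 =
    2 ^+ j * (zr r1 / 2 ^+ 40 - (zr (Zpos q))^-1).
  by rewrite E; field; rewrite !gt_eqF ?exprn_gt0.
have /andP[r0 r2] := h2.
rewrite mulr_ge0 ?(ltW p2j)//= (le_trans (ler_wpM2l (ltW p2j) r2))//.
have : zr (Zpos q) <= 2 ^+ 15 by rewrite -zr2 -zr_pow; apply: zr_le; lia.
rewrite E => hq.
rewrite ler_pdivlMr// mulrAC (mulrC (2 ^+ j)) ler_pdivrMr ?exprn_gt0//.
by rewrite (_ : (40 = 25 + 15)%N)// exprD mulKf ?gt_eqF ?exprn_gt0.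
Qed.

End LogTableTheory.

(** * Taylor enclosures of the potential on a cell *)

Section PotentialDefs.
Local Open Scope Z_scope.

Definition zsum (f : Z * Z -> Z) (ks : seq (Z * Z)) : Z :=
  foldr (fun k a => f k + a) 0 ks.

(** For a knot of weight [c] at signed distance [d] from [M], [l] approximates
    [2 ^ 44 * ln (|d| / 2 ^ 14)] and [i] approximates [2 ^ 40 / |d|]. The sums are those of
    [c d ^ 2 l], [c d l], [c l] and [2 ^ 40 * c / d], and an upper bound for [2 ^ 50 * |c| / d ^ 2]:
    indeed [j] is at least [2 ^ 25 / |d|]. *)
Fixpoint log_sums (t : log_tree) (ln2 M : Z) (ks : seq (Z * Z)) : Z * Z * Z * Z * Z :=
  match ks with
  | [::] => (0, 0, 0, 0, 0)
  | k :: ks =>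
    let '(a0, a1, a2, a3, r) := log_sums t ln2 M ks in
    let d := M - k.1 in
    let (l, i) := log_at t ln2 (Z.to_pos (Z.abs d)) in
    let x2 := k.2 * l in
    let x1 := d * x2 in
    let j := Z.shiftr i 15 + 1 in
    (a0 + d * x1, a1 + x1, a2 + x2, a3 + Z.sgn d * (k.2 * i),
     r + Z.abs k.2 * (j * j))
  end.

(** The cubic of [sqr_ln_shift] summed over the knots and divided by [s]; its terms [d x] and
    [3 / 2 x ^ 2] sum to 0 because the weights have vanishing moments of order 0 and 1. In the
    widening, [96636764160 = 90 * 2 ^ 30] is the table error times a bound on [(d + x) ^ 2]. The
    divisor [384 = 6 * 2 ^ 6] belongs to the quartic remainder, rescaled from [2 ^ 50] to [2 ^ 44].
    The factor [524288 = 2 ^ 19] accounts for the reciprocals, of relative error [2 ^ -25], with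
    [H <= |d|]. The last 3 pays for three roundings. *)
Definition potential_poly (t : log_tree) (ln2 s ca : Z) (ks : seq (Z * Z)) (M H : Z) :
    seq (Z * Z) :=
  let '(a0, a1, a2, a3, r) := log_sums t ln2 M ks in
  pwiden (ca * 96636764160 / s + r * H ^ 4 / (384 * s) + ca * H ^ 2 * 524288 / (3 * s) + 3)
    [:: (a0 / s, 1); (2 * a1 / s, 1); (a2 / s, 1); (16 * a3 / (3 * s), 1)].

(** No knot lies strictly inside the cell of centre [M] and half-width [H], nor at its centre. The
    bounds on [M] and [H] keep all distances to the knots at most [2 ^ 15], and [H <= M + 1] still
    admits the cell of half-width 1 around 0. *)
Definition potential_ok (ks : seq (Z * Z)) (M H : Z) : bool :=
  [&& 0 <=? H, 0 <=? M, H <=? M + 1, M + H <=? 32767 &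
   all (fun k => Z.max H 1 <=? Z.abs (M - k.1)) ks].

End PotentialDefs.

Section PotentialTheory.
Context (R : realType).
Local Open Scope ring_scope.
Notation zr := (@zr R).
Notation S := (zr fscale).

Lemma Z_sgn_abs z : Z.mul (Z.sgn z) (Z.abs z) = z.
Proof. by case: z. Qed.

Lemma zr_zsum f ks : zr (zsum f ks) = \sum_(k <- ks) zr (f k).
Proof.
elim: ks => [|k ks IH]; first by rewrite big_nil zr0.
by rewrite big_cons /= zrD IH.
Qed.

(** The normalisation of the table. *)
Definition scaled_log (x : R) : R := ln (`|x| / 2 ^+ 14).

Lemma scaled_logE x : x != 0 -> scaled_log x = ln `|x| - ln (2 ^+ 14).
Proof. by move=> x0; rewrite /scaled_log ln_div ?posrE ?normr_gt0// exprn_gt0. Qed.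

Lemma log_sums_spec t ln2 M ks (x : R) : log_oracle R t ln2 ->
  (forall k, k \in ks -> Z.le 1 (Z.abs (Z.sub M k.1)) /\ Z.lt (Z.abs (Z.sub M k.1)) 32768) ->
  let '(a0, a1, a2, a3, r) :=
    log_sums t ln2 M ks in
  let d k := zr M - zr k.1 in
  [/\ `|zr a0 + 2 * zr a1 * x + zr a2 * x ^+ 2 -
        S * \sum_(k <- ks) zr k.2 * ((d k + x) ^+ 2 * scaled_log (d k))| <=
      90 * \sum_(k <- ks) `|zr k.2| * (d k + x) ^+ 2,
      `|zr a3 / 2 ^+ 40 - \sum_(k <- ks) zr k.2 / d k| <=
      (2 ^+ 25)^-1 * \sum_(k <- ks) `|zr k.2| / `|d k| &
      \sum_(k <- ks) `|zr k.2| * (d k)^-1 ^+ 2 <= zr r / 2 ^+ 50].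
Proof.
move=> ok; elim: ks => [|k ks IH] hd /=.
  by rewrite !big_nil !zr0 !(mulr0, mul0r, addr0, subr0) normr0.
have := IH (fun j jk => hd j (mem_behead (s := k :: ks) jk)).
case: (log_sums _ _ _ _) => [[[[a0 a1] a2] a3] r] /= [h1 h2 h3] {IH}.
have [d1 d15] := hd k (mem_head _ _).
set d := Z.sub M k.1 in d1 d15 *.
have pE : Zpos (Z.to_pos (Z.abs d)) = Z.abs d by apply: Z2Pos.id; lia.
have := ok (Z.to_pos (Z.abs d)).
rewrite pE => /(_ d15); rewrite zr_abs.
case: (log_at _ _ _) => [lg i] /= [g1 g2].
have dE : zr M - zr k.1 = zr d by rewrite zrB.
have ad1 : 1 <= `|zr d| by rewrite -zr_abs -zr1; apply: zr_le.
have d0 : zr d != 0 by rewrite -normr_gt0 (lt_le_trans ltr01).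
rewrite !big_cons !zrD !zrM !zr_abs dE /=; split.
- have -> : zr a0 + zr d * (zr d * (zr k.2 * zr lg)) +
      2 * (zr a1 + zr d * (zr k.2 * zr lg)) * x + (zr a2 + zr k.2 * zr lg) * x ^+ 2 -
      S * (zr k.2 * ((zr d + x) ^+ 2 * scaled_log (zr d)) +
      \sum_(j <- ks) zr j.2 * ((zr M - zr j.1 + x) ^+ 2 * scaled_log (zr M - zr j.1))) =
      (zr k.2 * (zr d + x) ^+ 2) * (zr lg - S * scaled_log (zr d)) +
     (zr a0 + 2 * zr a1 * x + zr a2 * x ^+ 2 -
      S * \sum_(j <- ks) zr j.2 * ((zr M - zr j.1 + x) ^+ 2 * scaled_log (zr M - zr j.1))).
    by ring.
  rewrite (le_trans (ler_normD _ _))// [leRHS]mulrDr; apply: lerD => //.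
  by rewrite normrM mulrC ler_pM// normrM (ger0_norm (sqr_ge0 _)).
- have -> : (zr a3 + zr (Z.sgn d) * (zr k.2 * zr i)) / 2 ^+ 40 -
      (zr k.2 / zr d + \sum_(j <- ks) zr j.2 / (zr M - zr j.1)) =
    zr k.2 * (zr (Z.sgn d) * (zr i / 2 ^+ 40) - (zr d)^-1) +
    (zr a3 / 2 ^+ 40 - \sum_(j <- ks) zr j.2 / (zr M - zr j.1)) by ring.
  have sg : zr (Z.sgn d) * `|zr d| = zr d by rewrite -zr_abs -zrM; congr zr; exact: Z_sgn_abs.
  have sn : `|zr (Z.sgn d)| = 1.
    have : `|zr d| = `|zr (Z.sgn d)| * `|zr d| by rewrite -{1}sg normrM normr_id.
    by move=> /(congr1 (fun z => z / `|zr d|)); rewrite mulfK ?divff ?normr_eq0.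
  have -> : zr (Z.sgn d) * (zr i / 2 ^+ 40) - (zr d)^-1 =
     zr (Z.sgn d) * (zr i / 2 ^+ 40 - `|zr d|^-1).
    rewrite mulrBr; congr (_ - _); apply: (mulfI d0); rewrite divff// -{1}sg.
    by rewrite mulrACA divff ?normr_eq0// mulr1 -expr2 -(real_normK (num_real _)) sn expr1n.
  move: g2 => /andP[g0 g2].
  rewrite (le_trans (ler_normD _ _))// [leRHS]mulrDr; apply: lerD => //.
  rewrite normrM mulrCA ler_wpM2l// normrM sn mul1r ger0_norm//.
- have /andP[g0 _] := g2.
  have ji := zr_shiftr R i 15.
  rewrite [leRHS]mulrDl addrC lerD// zrD zr1.
  set sh := zr (Z.shiftr i (Z.of_nat 15)) in ji *.
  rewrite -mulrA ler_wpM2l// -expr2.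
  have p15 : 0 < 2 ^+ 15 :> R by rewrite exprn_gt0.
  have -> : (sh + 1) ^+ 2 / 2 ^+ 50 = ((sh + 1) / 2 ^+ 25) ^+ 2.
    by rewrite exprMn exprVn -exprM.
    have h : `|zr d|^-1 <= (sh + 1) / 2 ^+ 25.
    move: g0; rewrite subr_ge0 => /le_trans; apply.
    have -> : zr i / 2 ^+ 40 = zr i / 2 ^+ 15 / 2 ^+ 25.
      by rewrite -mulrA -invfM -exprD.
    by move: ji => /andP[_ /ltW ji]; rewrite ler_wpM2r// invr_ge0 exprn_ge0.
  rewrite -(real_normK (num_real _)) normfV lerXn2r ?nnegrE ?invr_ge0//.
  by rewrite (le_trans _ h)// invr_ge0.
Qed.

Lemma contains_quot m n : n <> Z0 -> contains (Z.div m n, Zpos 1) (zr m / zr n / S).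
Proof.
move=> n0; have /andP[h1 h2] := zr_div R m n0.
rewrite /contains /= zr1 mulrC divfK ?gt_eqF ?fscale_gt0//.
by rewrite ger0_norm; lra.
Qed.

Lemma sqr_scaled_log_shift (d x : R) : d != 0 -> `|x| <= `|d| ->
  `|(d + x) ^+ 2 * scaled_log (d + x) - ((d + x) ^+ 2 * scaled_log d + d * x +
     3 / 2 * x ^+ 2 + x ^+ 3 / 3 * d^-1)| <= x ^+ 4 / 6 * (d^-1) ^+ 2.
Proof.
move=> d0 xd; have := sqr_ln_shift d0 xd; rewrite (scaled_logE d0).
have -> : (d + x) ^+ 2 * scaled_log (d + x) = (d + x) ^+ 2 * (ln `|d + x| - ln (2 ^+ 14)).
  by have [->|dx0] := eqVneq (d + x) 0; [rewrite expr0n !mul0r|rewrite scaled_logE].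
by congr (`|_| <= _); ring.
Qed.

Definition scaled_potential ks (x : R) : R :=
  \sum_(k <- ks) zr k.2 * ((x - zr k.1) ^+ 2 * scaled_log (x - zr k.1)).

Lemma potential_poly_encl t ln2 s ca ks M H (x : R) : log_oracle R t ln2 ->
  potential_ok ks M H ->
  (forall k, k \in ks -> Z.le 0 k.1 /\ Z.le k.1 32767) ->
  \sum_(k <- ks) zr k.2 = 0 -> \sum_(k <- ks) zr k.2 * zr k.1 = 0 ->
  Z.lt 0 s -> zr ca = \sum_(k <- ks) `|zr k.2| -> `|x| <= zr H ->
  encl (potential_poly t ln2 s ca ks M H) x (scaled_potential ks (zr M + x) / zr s).
Proof.
move=> ok /and5P[/Z.leb_le H0 /Z.leb_le M0 /Z.leb_le HM /Z.leb_le MH /allP dks] kB c0 c1 s0 caE xH.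
have dk k : k \in ks -> Z.le (Z.max H 1) (Z.abs (Z.sub M k.1)).
  by move=> /dks /Z.leb_le.
have hk k : k \in ks -> Z.le 1 (Z.abs (Z.sub M k.1)) /\ Z.lt (Z.abs (Z.sub M k.1)) 32768.
  by move=> kk; have := dk k kk; have [] := kB k kk; lia.
have := @log_sums_spec t ln2 M ks x ok.
rewrite /potential_poly; case: (log_sums _ _ _ _) => [[[[a0 a1] a2] a3] r].
cbv beta iota; move=> /(_ hk) [h1 h2 h3].
have s0' : s <> Z0 by lia.
have s3 : Z.mul 3 s <> Z0 by lia.
have s384 : Z.mul 384 s <> Z0 by lia.
have sR := zr_gt0 R s0; have S0 := fscale_gt0 R.
pose d k := zr M - zr (k : Z * Z).1.
have dn0 k : k \in ks -> d k != 0.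
  move=> kk; rewrite -normr_gt0 /d -zrB -zr_abs; apply: zr_gt0.
  by apply: Z.lt_le_trans (proj1 (hk k kk)).
have dH k : k \in ks -> zr H <= `|d k|.
  by move=> kk; rewrite /d -zrB -zr_abs; apply: zr_le; exact: Z.le_trans (Z.le_max_l H 1) (dk k kk).
have HR : 0 <= zr H by exact: zr_ge0.
pose e k := (d k + x) ^+ 2 * scaled_log (d k + x) - ((d k + x) ^+ 2 * scaled_log (d k) + d k * x +
     3 / 2 * x ^+ 2 + x ^+ 3 / 3 * (d k)^-1).
have he k : k \in ks -> `|e k| <= x ^+ 4 / 6 * (d k)^-1 ^+ 2.
  by move=> kk; apply: sqr_scaled_log_shift (dn0 k kk) _; exact: le_trans (dH k kk).
have GE : scaled_potential ks (zr M + x) =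
    \sum_(k <- ks) zr k.2 * ((d k + x) ^+ 2 * scaled_log (d k)) +
    x ^+ 3 / 3 * (\sum_(k <- ks) zr k.2 / d k) + \sum_(k <- ks) zr k.2 * e k.
  (* These are the linear and quadratic terms that [potential_poly] omits. *)
  have E0 : \sum_(k <- ks) (x * (zr M * zr k.2 - zr k.2 * zr k.1) + 3 / 2 * x ^+ 2 * zr k.2) = 0.
    by rewrite big_split /= -!mulr_sumr sumrB -mulr_sumr c0 c1; ring.
  rewrite mulr_sumr -!big_split -[LHS]subr0 -{1}E0 -sumrB; apply: eq_bigr => k _ /=.
  by rewrite (_ : zr M + x - zr k.1 = d k + x) /e /d; ring.
have rho : `|\sum_(k <- ks) zr k.2 * e k| <= zr H ^+ 4 / 6 * (zr r / 2 ^+ 50).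
  apply: (@le_trans _ _ (zr H ^+ 4 / 6 * \sum_(k <- ks) `|zr k.2| * (d k)^-1 ^+ 2)); last first.
    by rewrite ler_wpM2l// divr_ge0// exprn_ge0.
  rewrite mulr_sumr (le_trans (ler_norm_sum _ _ _))// big_seq [leRHS]big_seq.
  apply: ler_sum => k kk; rewrite normrM mulrCA ler_wpM2l// (le_trans (he k kk))//.
  by rewrite ler_wpM2r ?sqr_ge0// ler_wpM2r// (le_trans (ler_norm _))// normrX lerXn2r ?nnegrE.
have q1 : \sum_(k <- ks) `|zr k.2| * (d k + x) ^+ 2 <= zr ca * 2 ^+ 30.
  rewrite caE mulr_suml big_seq [leRHS]big_seq; apply: ler_sum => k kk.
  rewrite ler_wpM2l// (_ : 2 ^+ 30 = (2 ^+ 15) ^+ 2); last by rewrite -exprM.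
  rewrite -(real_normK (num_real _)) lerXn2r ?nnegrE ?exprn_ge0//.
  have [k1 k2] := kB k kk; have := zr_le R k1; have := zr_le R k2.
  have := zr_le R HM; have := zr_le R MH; rewrite zr0 !zrD zr1.
  have -> : zr 32767 = 2 ^+ 15 - 1 by rewrite -zr2 -zr_pow -zr1 -zrB.
  move: xH; rewrite /d !ler_norml => /andP[x1 x2]; move: (2 ^+ 15) => K *.
  by apply/andP; split; lra.
have q2 : zr H ^+ 3 * \sum_(k <- ks) `|zr k.2| / `|d k| <= zr ca * zr H ^+ 2.
  rewrite caE mulr_sumr mulr_suml big_seq [leRHS]big_seq; apply: ler_sum => k kk.
  rewrite mulrCA ler_wpM2l// exprSr -mulrA ler_piMr ?exprn_ge0//.
  by rewrite ler_pdivrMr ?mul1r ?dH// normr_gt0 dn0.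
have SE := fscaleE R.
have K44 : 2 ^+ 44 = 16 * 2 ^+ 40 :> R by rewrite (_ : 16 = 2 ^+ 4) -?exprD// -natrX.
have K19 : 2 ^+ 44 = 2 ^+ 19 * 2 ^+ 25 :> R by rewrite -exprD.
have K50 : 2 ^+ 50 = 2 ^+ 44 * 64 :> R by rewrite (_ : 64 = 2 ^+ 6) -?exprD// -natrX.
have E30 : zr 96636764160 = 90 * 2 ^+ 30.
  by rewrite -zr2 -zr_pow (_ : 90 = zr 90) -?zrM// zrE.
have E19 : zr 524288 = 2 ^+ 19 by rewrite -zr2 -zr_pow.
have p19 : 0 < 2 ^+ 19 :> R by rewrite exprn_gt0.
have p25 : 0 < 2 ^+ 25 :> R by rewrite exprn_gt0.
have p40 : 0 < 2 ^+ 40 :> R by rewrite exprn_gt0.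
have p44 : 0 < 2 ^+ 44 :> R by rewrite exprn_gt0.
move: (2 ^+ 19) (2 ^+ 25) (2 ^+ 30) (2 ^+ 40) (2 ^+ 44) (2 ^+ 50) SE K44 K19 K50 E30 E19
  p19 p25 p40 p44 h2 h3 rho q1 => P19 P25 P30 P40 P44 P50 SE K44 K19 K50 E30 E19
  p19 p25 p40 p44 h2 h3 rho q1.
apply: (@encl_widen _ _ _ _ (zr a0 / zr s / S + x * (zr (Z.mul 2 a1) / zr s / S + x *
   (zr a2 / zr s / S + x * (zr (Z.mul 16 a3) / zr (Z.mul 3 s) / S + x * 0))))).
  do 4 (eexists; first exact: contains_quot; eexists; last by reflexivity).
  by [].
have -> : scaled_potential ks (zr M + x) / zr s - (zr a0 / zr s / S + x * (zr (Z.mul 2 a1) / zr s / S + x *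
   (zr a2 / zr s / S + x * (zr (Z.mul 16 a3) / zr (Z.mul 3 s) / S + x * 0)))) =
  (- (zr a0 + 2 * zr a1 * x + zr a2 * x ^+ 2 -
        S * \sum_(k <- ks) zr k.2 * ((d k + x) ^+ 2 * scaled_log (d k)))
   - S * (x ^+ 3 / 3 * (zr a3 / P40 - \sum_(k <- ks) zr k.2 / d k))
   + S * \sum_(k <- ks) zr k.2 * e k) / zr s / S.
  have z16 : zr 16 = 16 by rewrite zrE.
  have z3 : zr 3 = 3 by rewrite zrE.
  rewrite GE !zrM zr2 z16 z3.
  rewrite SE K44; field; rewrite !gt_eqF//.
rewrite normrM mulrCA normfV (gtr0_norm S0) divff ?gt_eqF// mulr1.
rewrite normrM normfV (gtr0_norm sR) ler_pdivrMr//.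
set A := - _; set B := _ * (_ * (_ - _)); set E := S * _.
have hA : `|A| <= 90 * (zr ca * P30) by rewrite /A normrN (le_trans h1)// ler_wpM2l.
have hB : `|B| <= P19 / 3 * (zr ca * zr H ^+ 2).
  apply: (@le_trans _ _ (P44 * (zr H ^+ 3 / 3 * (P25^-1 * \sum_(k <- ks) `|zr k.2| / `|d k|)))).
    rewrite /B SE normrM (gtr0_norm p44) ler_pM2l// normrM; apply: ler_pM => //.
    rewrite normrM normfV normrX (ger0_norm (ler0n _ 3)).
    by rewrite ler_wpM2r// lerXn2r ?nnegrE.
  rewrite K19; set Q := \sum_(k <- ks) _ in q2 *.
  have -> : P19 * P25 * (zr H ^+ 3 / 3 * (P25^-1 * Q)) = P19 / 3 * (zr H ^+ 3 * Q).
    by field; rewrite gt_eqF.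
  by rewrite ler_wpM2l// divr_ge0// ltW.
have p384 : 0 < zr 384 by exact: zr_gt0.
have r384 : zr 384 = 6 * 64 by rewrite (_ : Zpos 384 = Z.mul 6 64)// zrM !zrE.
have hE : `|E| <= zr H ^+ 4 * zr r / zr 384.
  rewrite /E SE normrM (gtr0_norm p44).
  apply: (@le_trans _ _ (P44 * (zr H ^+ 4 / 6 * (zr r / P50)))); first by rewrite ler_pM2l.
  by rewrite r384 K50 le_eqVlt; apply/orP; left; apply/eqP; field; rewrite gt_eqF.
rewrite (le_trans (ler_normD _ _))// (le_trans (lerD (ler_normB _ _) (lexx _)))//.
rewrite !zrD.
set z1 := zr (Z.div _ _); set z2 := zr (Z.div _ _); set z3 := zr (Z.div _ _).
have /andP[_ b1] := zr_div R (Z.mul ca 96636764160) s0'.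
have /andP[_ b2] := zr_div R (Z.mul r (Z.pow H 4)) s384.
have /andP[_ b3] := zr_div R (Z.mul (Z.mul ca (Z.pow H 2)) 524288) s3.
have r3 : zr 3 = 3 by rewrite zrE.
have H4 : zr (Z.pow H 4) = zr H ^+ 4 := zr_pow R H 4.
have H2 : zr (Z.pow H 2) = zr H ^+ 2 := zr_pow R H 2.
move: b1; rewrite -/z1 (zrM R ca) E30 ltr_pdivrMr// => b1.
move: b2; rewrite -/z2 (zrM R r) (zrM R 384) H4 ltr_pdivrMr ?mulr_gt0// => b2.
move: b3; rewrite -/z3 (zrM R _ 524288) (zrM R ca) (zrM R 3) H2 E19 r3 ltr_pdivrMr ?mulr_gt0// => b3.
have -> : (z1 + z2 + z3 + 3) * zr s = (z1 + 1) * zr s + (z2 + 1) * (zr 384 * zr s) / zr 384 +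
   (z3 + 1) * (3 * zr s) / 3 by field; rewrite gt_eqF.
have b2' : zr r * zr H ^+ 4 / zr 384 <= (z2 + 1) * (zr 384 * zr s) / zr 384 by rewrite ler_pM2r ?invr_gt0// ltW.
have b3' : zr ca * zr H ^+ 2 * P19 / 3 <= (z3 + 1) * (3 * zr s) / 3 by rewrite ler_wpM2r// ltW.
by lra.
Qed.

End PotentialTheory.

(** * Taylor enclosures of [Phi] on a cell *)

Section PhiDefs.
Local Open Scope Z_scope.

(* The root [(rho, eta)] is [rho + eta / 2 ^ 20], up to [2 ^ -20]. *)
Definition log_root_poly (t : log_tree) (ln2 : Z) (rt : Z * Z) (M H : Z) :
    bool * seq (Z * Z) :=
  let d := M - rt.1 in
  let r := irat 1 d in
  let w := [:: iopp (imul (rt.2 * 16777216, 16777216) r); r] in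
  let w2 := pmul w w in
  let m := imag (horner_ival w (0, H * fscale)) in
  let m2 := m * m in
  ([&& 1 <=? Z.abs d, Z.abs d <=? 32767 & m <=? 4398046511104],
   padd [:: ((log_at t ln2 (Z.to_pos (Z.abs d))).1, 90)]
     (pwiden (Z.shiftr (m2 * m2) 132 + 1)
       (padd w (padd (pscale (irat (-1) 2) w2) (pscale (irat 1 3) (pmul w w2)))))).

(** Positions are in units of [1 / D]; [kap] collects the constants produced by passing to
    [scaled_log] in these units. *)
Definition phi_poly (t : log_tree) (ln2 D s ca : Z) (kap : Z * Z) (l0 : Z)
    (ks : seq (Z * Z)) (rts : seq (Z * (Z * Z))) (M H : Z) : bool * seq (Z * Z) :=
  foldr (fun q a => let p := log_root_poly t ln2 q.2 M H in
           (p.1 && a.1, padd (pscale (- q.1, 0) p.2) a.2))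
    (potential_ok ks M H,
     padd [:: irat M D; irat 1 D]
       (padd [:: kap] (pscale (- l0, 0) (potential_poly t ln2 s ca ks M H)))) rts.

End PhiDefs.

Arguments padd : simpl never.
Arguments pscale : simpl never.
Arguments pwiden : simpl never.
Arguments log_root_poly : simpl never.
Arguments potential_poly : simpl never.

Section PhiTheory.
Context (R : realType).
Local Open Scope ring_scope.
Notation zr := (@zr R).
Notation S := (zr fscale).

Definition near_root (rt : Z * Z) (x : R) : Prop :=
  `|2 ^+ 20 * (x - zr rt.1) - zr rt.2| <= 1.

Lemma near_root_contains rt x : near_root rt x ->
  contains (Z.mul rt.2 16777216, Zpos 16777216) (x - zr rt.1).
Proof.
move=> h; rewrite /contains /= zrM.
have -> : S = 2 ^+ 20 * zr 16777216.
  by rewrite (_ : fscale = Z.mul (Z.pow 2 20) 16777216)// zrM (zr_pow R 2 20) zr2.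
set K := zr 16777216; have K0 : 0 < K by exact: zr_gt0.
rewrite mulrAC -mulrBl normrM (gtr0_norm K0) -[leRHS]mul1r ler_pM2r//.
Qed.

Lemma near_root_le1 rt x : near_root rt x -> Z.lt (Z.abs rt.2) 1048576 ->
  `|x - zr rt.1| <= 1.
Proof.
rewrite /near_root; set y := x - zr rt.1 => hx eta1.
have : `|zr rt.2| <= 2 ^+ 20 - 1.
  have -> : 2 ^+ 20 - 1 = zr 1048575 by rewrite -zr2 -zr_pow -zr1 -zrB.
  by rewrite -zr_abs; apply: zr_le; apply/Z.lt_succ_r.
have K0 : 0 < 2 ^+ 20 :> R by rewrite exprn_gt0.
move: (2 ^+ 20) K0 hx => K K0 hx hr.
rewrite -(ler_pM2l K0) -{1}(gtr0_norm K0) -normrM.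
by rewrite -(subrK (zr rt.2) (K * y)) (le_trans (ler_normD _ _))//; lra.
Qed.

Lemma contains_interval H (x : R) : `|x| <= zr H -> contains (Z0, Z.mul H fscale) x.
Proof.
move=> xH; rewrite /contains /= zr0 subr0 zrM normrM (gtr0_norm (fscale_gt0 R)).
by rewrite mulrC ler_pM2r// fscale_gt0.
Qed.

Lemma contains_const m : contains (m, Z0) (zr m / S).
Proof. by rewrite /contains /= mulrC divfK ?gt_eqF ?fscale_gt0// subrr normr0 zr0. Qed.

(** Write [zr M + x - r = d * (1 + w)] with [d] an integer. The tested bound
    [4398046511104 = 2 ^ 42] on the magnitude of [w] gives [|w| <= 1 / 4], as [ln1D_taylor] demands,
    and the remainder is [2 ^ 44 * w ^ 4 <= m ^ 4 / 2 ^ 132]. *)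
Lemma log_root_poly_encl t ln2 rt M H (x r : R) : log_oracle R t ln2 ->
  near_root rt r -> `|x| <= zr H -> (log_root_poly t ln2 rt M H).1 ->
  zr M + x != r /\
  encl (log_root_poly t ln2 rt M H).2 x (scaled_log (zr M + x - r)).
Proof.
move=> ok hr xH; rewrite /log_root_poly.
set d := Z.sub M rt.1; set iv := irat _ d; set wp := [:: _; _]; set m := imag _.
cbv beta iota zeta; cbn [fst snd].
move=> /and3P[/Z.leb_le d1 /Z.leb_le d2 /Z.leb_le m42].
have d0 : d <> Z0 by lia.
have ad0 : 0 < `|zr d| by rewrite -zr_abs; apply: zr_gt0; lia.
have dn0 : zr d != 0 by rewrite -normr_gt0.
set e := r - zr rt.1; pose w := (x - e) / zr d.
have he : contains _ e := near_root_contains hr.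
have hiv : contains iv (1 / zr d) by have := contains_rat R 1 d0; rewrite zr1.
have hw : encl wp x w.
  exists (- (e * (1 / zr d))); first by apply: contains_opp; apply: contains_mul.
  exists (1 / zr d); last by rewrite /w; field.
  by exists (1 / zr d) => //; exists 0 => //; rewrite mulr0 addr0.
have hm : S * `|w| <= zr m.
  by apply: contains_imag; apply: (contains_horner hw); exact: contains_interval.
have S0 := fscale_gt0 R.
have w4 : `|w| <= 1 / 4.
  rewrite -(ler_pM2l S0) (le_trans hm)// (le_trans (zr_le R m42))//.
  rewrite (_ : fscale = Z.mul 4 4398046511104)// zrM (_ : zr 4 = 4); last by rewrite zrE.
  by move: (zr _) => K; rewrite le_eqVlt; apply/orP; left; apply/eqP; field.
have w1 : 0 < 1 + w by move: w4; rewrite ler_norml; lra.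
have E : zr M + x - r = zr d * (1 + w).
  by rewrite /w /e /d zrB; field; rewrite -zrB.
split; first by rewrite -subr_eq0 E mulf_neq0// gt_eqF.
have -> : scaled_log (zr M + x - r) = scaled_log (zr d) + ln (1 + w).
  have wn0 : 1 + w != 0 by rewrite gt_eqF.
  rewrite E (scaled_logE dn0) (scaled_logE (mulf_neq0 dn0 wn0)) normrM (gtr0_norm w1) lnM ?posrE//.
  by ring.
apply: encl_add.
  exists (scaled_log (zr d)); last by exists 0 => //; rewrite mulr0 addr0.
  have pE : Zpos (Z.to_pos (Z.abs d)) = Z.abs d by apply: Z2Pos.id; lia.
  have [|g1 _] := ok (Z.to_pos (Z.abs d)); first by rewrite pE; lia.
  rewrite /contains; cbn [fst snd]; rewrite distrC.
  by move: g1; rewrite pE zr_abs (_ : zr 90 = 90)// zrE.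
have hw2 := encl_mul hw hw.
apply: (encl_widen (y := w + ((zr (-1) / zr 2) * (w * w) + (zr 1 / zr 3) * (w * (w * w))))).
  apply: encl_add => //; apply: encl_add.
    by apply: encl_scale => //; exact: contains_rat.
  by apply: encl_scale; [exact: contains_rat|exact: encl_mul].
have := ln1D_taylor w4.
have -> : w + ((zr (-1) / zr 2) * (w * w) + (zr 1 / zr 3) * (w * (w * w))) = w - w ^+ 2 / 2 + w ^+ 3 / 3.
  have z3 : zr 3 = 3 by rewrite zrE.
  have zm1 : zr (-1) = -1 by rewrite zrE.
  by rewrite zm1 zr2 zr1 z3; field.
move=> h; apply: (@le_trans _ _ (S * w ^+ 4)); first by rewrite ler_pM2l.
have m0 : 0 <= zr m by rewrite (le_trans _ hm)// mulr_ge0// ltW.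
have /andP[_ sh] := zr_shiftr R (Z.mul (Z.mul m m) (Z.mul m m)) 132.
rewrite zrD zr1 (le_trans _ (ltW sh))// !zrM.
have p132 : 0 < 2 ^+ 132 :> R by rewrite exprn_gt0.
rewrite ler_pdivlMr// (_ : 2 ^+ 132 = S ^+ 3); last by rewrite fscaleE -exprM.
have -> : S * w ^+ 4 * S ^+ 3 = (S * w) ^+ 4 by ring.
have -> : zr m * zr m * (zr m * zr m) = zr m ^+ 4 by ring.
rewrite (le_trans (ler_norm _))// normrX lerXn2r ?nnegrE//.
by rewrite normrM (gtr0_norm S0).
Qed.

Definition knots_real (D s : Z) (ks : seq (Z * Z)) : seq (R * R) :=
  [seq (zr k.1 / zr D, zr k.2 * (2 * zr D ^+ 2 / zr s)) | k <- ks].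

(** Since the moments of order 0 and 1 vanish, the weighted sum of [(x - t) ^ 2] over the knots is
    [s] whatever [x] is. Hence both the factor [ln D] and the term [- 3 / 4 u ^ 2] of [log_prim2]
    contribute constants. *)
Lemma pl_potential_scaled D s ks (x : R) : Z.lt 0 D -> Z.lt 0 s ->
  \sum_(k <- ks) zr k.2 = 0 -> \sum_(k <- ks) zr k.2 * zr k.1 = 0 ->
  \sum_(k <- ks) zr k.2 * zr k.1 ^+ 2 = zr s ->
  pl_potential (knots_real D s ks) (x / zr D) =
  scaled_potential ks x / zr s - scaled_log (zr D) - 3 / 2.
Proof.
move=> /(zr_gt0 R) D0 /(zr_gt0 R) s0 c0 c1 c2.
rewrite /pl_potential /knots_real big_map.
have Dn0 : zr D != 0 by rewrite gt_eqF.
have sn0 : zr s != 0 by rewrite gt_eqF.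
have E k : zr k.2 * (2 * zr D ^+ 2 / zr s) * log_prim2 (zr k.1 / zr D - x / zr D) =
  (zr k.2 * ((x - zr k.1) ^+ 2 * scaled_log (x - zr k.1))) / zr s +
  (- scaled_log (zr D) - 3 / 2) / zr s *
    (x ^+ 2 * zr k.2 - 2 * x * (zr k.2 * zr k.1) + zr k.2 * zr k.1 ^+ 2).
  rewrite (_ : zr k.1 / zr D - x / zr D = - ((x - zr k.1) / zr D)); last by field.
  rewrite log_prim2N /log_prim2 (scaled_logE Dn0).
  have [->|xk] := eqVneq x (zr k.1).
    by rewrite subrr mul0r expr0n /= !mul0r !(mulr0, mul0r) subr0; field; rewrite sn0.
  have xk0 : x - zr k.1 != 0 by rewrite subr_eq0.
  rewrite (scaled_logE xk0) normrM normfV ln_div ?posrE ?normr_gt0//.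
  by field; rewrite sn0.
under eq_bigr do rewrite E.
rewrite big_split /= -mulr_suml -mulr_sumr !big_split /= -mulr_sumr sumrN -mulr_sumr c0 c1 c2.
by rewrite /scaled_potential; field.
Qed.

Lemma phi_poly_encl t ln2 D s ca kap l0 ks rts (rs : seq R) M H (x : R) :
  log_oracle R t ln2 ->
  (forall k, k \in ks -> Z.le 0 k.1 /\ Z.le k.1 32767) ->
  \sum_(k <- ks) zr k.2 = 0 -> \sum_(k <- ks) zr k.2 * zr k.1 = 0 ->
  Z.lt 0 s -> zr ca = \sum_(k <- ks) `|zr k.2| -> Z.lt 0 D -> `|x| <= zr H ->
  size rs = size rts ->
  (forall i, (i < size rts)%N -> near_root (nth (Z0, (Z0, Z0)) rts i).2 (zr D * nth 0 rs i)) ->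
  forall c, contains kap c ->
  (phi_poly t ln2 D s ca kap l0 ks rts M H).1 ->
  (forall r, r \in rs -> (zr M + x) / zr D != r) /\
  encl (phi_poly t ln2 D s ca kap l0 ks rts M H).2 x
    ((zr M + x) / zr D + c - zr l0 / S * (scaled_potential ks (zr M + x) / zr s) -
     \sum_(q <- zip rts rs) zr q.1.1 / S * scaled_log (zr M + x - zr D * q.2)).
Proof.
move=> ok kB c0 c1 s0 caE D0 xH + + c kc.
have DR := zr_gt0 R D0; have D0' : D <> Z0 by lia.
elim: rts rs => [|[a rt] rts IH] [|r rs] // => [_ _ pok|[sz] near].
  split => //; rewrite [zip _ _]/= big_nil subr0 /phi_poly [foldr _ _ _]/=; cbn [snd].
  rewrite -addrA; apply: encl_add.
    exists (zr M / zr D); first exact: contains_rat.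
    exists (zr 1 / zr D); last by rewrite zr1; field; rewrite gt_eqF.
    by exists (zr 1 / zr D); [exact: contains_rat|exists 0 => //; rewrite mulr0 addr0].
  apply: encl_add; first by exists c => //; exists 0 => //; rewrite mulr0 addr0.
  rewrite -mulNr -mulNr -zrN; apply: encl_scale; first exact: contains_const.
  exact: potential_poly_encl.
have near0 := near 0%N isT; have nearS i := near i.+1.
have {}IH := IH rs sz nearS.
have phiE : phi_poly t ln2 D s ca kap l0 ks ((a, rt) :: rts) M H =
    let p := log_root_poly t ln2 rt M H in
    let q := phi_poly t ln2 D s ca kap l0 ks rts M H in
    (p.1 && q.1, padd (pscale (Z.opp a, Z0) p.2) q.2) by [].
rewrite phiE; cbv beta iota zeta; cbn [fst snd] => /andP[bT aT].
have [n1 e1] := @log_root_poly_encl t ln2 rt M H x (zr D * r) ok near0 xH bT.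
have [n2 e2] := IH aT; split.
  move=> r'; rewrite inE => /orP[/eqP->|/n2//].
  by apply: contra n1 => /eqP <-; rewrite mulrC divfK// gt_eqF.
rewrite [zip _ _]/= big_cons opprD addrCA -mulNr -mulNr -zrN; apply: encl_add => //.
by apply: encl_scale => //; exact: contains_const.
Qed.

End PhiTheory.

(** * Nonnegativity and support of a bump *)

Section HingeDefs.
Local Open Scope Z_scope.

(* [v] and [w] are the value and the slope, from [x] on, of a piecewise linear
   function whose next knots are [ks]. *)
Fixpoint hinge_check (v w x : Z) (ks : seq (Z * Z)) : bool :=
  match ks with
  | [::] => w =? 0
  | k :: ks =>
    [&& x <=? k.1, all (fun j => k.1 <=? j.1) ks, 0 <=? v + w * (k.1 - x) &
        hinge_check (v + w * (k.1 - x)) (w + k.2) k.1 ks]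
  end.

(** Each bump has vanishing moments of order 0 and 1 by itself, which confines it to the interval
    from [a] to [b]. *)
Definition group_check (a b : Z) (ks : seq (Z * Z)) : bool :=
  [&& zsum (fun k => k.2) ks =? 0, zsum (fun k => k.2 * k.1) ks =? 0,
      all (fun k => (a <=? k.1) && (k.1 <=? b)) ks & hinge_check 0 0 a ks].

End HingeDefs.

Section HingeTheory.
Context (R : realType).
Local Open Scope ring_scope.
Notation zr := (@zr R).
Implicit Types (x : R) (ks : seq (Z * Z)).

Definition hinge_sum ks x : R := \sum_(k <- ks) zr k.2 * Num.max 0 (x - zr k.1).

Lemma hinge_sum_left ks x : (forall k, k \in ks -> x <= zr k.1) -> hinge_sum ks x = 0.
Proof.
move=> h; rewrite /hinge_sum big_seq big1// => k kk.
by rewrite max_l ?mulr0// subr_le0 h.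
Qed.

(** The function is linear between consecutive knots and constant after the last, so its values at
    the knots decide. *)
Lemma hinge_check_ge0 v w a ks x : hinge_check v w a ks -> 0 <= zr v -> zr a <= x ->
  0 <= zr v + zr w * (x - zr a) + hinge_sum ks x.
Proof.
elim: ks v w a => [|k ks IH] v w a /=.
  by move=> /Z.eqb_eq -> v0 _; rewrite zr0 mul0r addr0 /hinge_sum big_nil addr0.
move=> /and4P[/Z.leb_le ak /allP kks /Z.leb_le v'0 h] v0 ax.
have := IH _ _ _ h; set v' := Z.add v _ in v'0 *.
have v'R : zr v' = zr v + zr w * (zr k.1 - zr a) by rewrite /v' zrD zrM zrB.
move=> /(_ (zr_ge0 R v'0)) {}IH; rewrite /hinge_sum big_cons -/(hinge_sum ks x).
have akR := zr_le R ak.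
have [xk|kx] := leP x (zr k.1); last first.
  have := IH (ltW kx); rewrite v'R zrD (max_r (x := 0)) ?subr_ge0 ?(ltW kx)//; lra.
rewrite max_l ?subr_le0// mulr0 add0r hinge_sum_left ?addr0; last first.
  by move=> j /kks /Z.leb_le /(zr_le R); exact: le_trans.
have [kaE|ka0] := eqVneq (zr k.1 - zr a) 0.
  have -> : x = zr a by apply/eqP; rewrite eq_le ax andbT; lra.
  by rewrite subrr mulr0 addr0.
have ka : 0 < zr k.1 - zr a by rewrite lt_neqAle eq_sym ka0 subr_ge0.
rewrite -(pmulr_rge0 _ ka).
have -> : (zr k.1 - zr a) * (zr v + zr w * (x - zr a)) =
   (zr k.1 - x) * zr v + (x - zr a) * (zr v + zr w * (zr k.1 - zr a)) by ring.
by rewrite -v'R addr_ge0// mulr_ge0 ?subr_ge0// zr_ge0.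
Qed.

Lemma group_check_ge0 a b ks x : group_check a b ks -> 0 <= hinge_sum ks x.
Proof.
move=> /and4P[_ _ /allP h hc].
have [ax|xa] := leP (zr a) x.
  have := hinge_check_ge0 hc; rewrite zr0 => /(_ x (lexx _) ax).
  by rewrite mul0r !add0r.
rewrite hinge_sum_left// => k /h /andP[/Z.leb_le /(zr_le R) ak _].
by rewrite (le_trans (ltW xa)).
Qed.

Lemma group_check_neq0 a b ks x : group_check a b ks -> hinge_sum ks x != 0 ->
  zr a < x < zr b.
Proof.
move=> /and4P[/Z.eqb_eq c0 /Z.eqb_eq c1 /allP h _] hx; apply/andP; split.
  rewrite ltNge; apply: contra hx => xa; apply/eqP; apply: hinge_sum_left => k /h.
  by move=> /andP[/Z.leb_le /(zr_le R) ak _]; rewrite (le_trans xa).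
rewrite ltNge; apply: contra hx => bx; apply/eqP; rewrite /hinge_sum big_seq.
rewrite (eq_bigr (fun k => x * zr k.2 - zr (Z.mul k.2 k.1))) => [|k kk]; last first.
  have /andP[_ /Z.leb_le /(zr_le R) kb] := h k kk.
  by rewrite max_r ?subr_ge0 ?(le_trans kb)// zrM; ring.
by rewrite -big_seq sumrB -mulr_sumr -!zr_zsum c0 c1 zr0 mulr0 subrr.
Qed.

Lemma pl_knots_real D s ks x : Z.lt 0 D -> Z.lt 0 s ->
  pl (knots_real R D s ks) (x / zr D) = 2 * zr D / zr s * hinge_sum ks x.
Proof.
move=> /(zr_gt0 R) D0 /(zr_gt0 R) s0; rewrite /pl /knots_real big_map mulr_sumr.
apply: eq_bigr => k _ /=.
have -> : Num.max 0 (x / zr D - zr k.1 / zr D) = Num.max 0 (x - zr k.1) / zr D.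
  by rewrite -mulrBl -[in LHS](mul0r (zr D)^-1) maxr_pMl// invr_ge0 ltW.
by field; rewrite !gt_eqF.
Qed.

End HingeTheory.

(** * Verification of the bounds on [Phi], bump by bump *)

(** A bump with support from [bl_lo] to [bl_hi], between the roots of index [bl_left] and [bl_right]
    in the list of roots. [bl_cells] holds the half-widths of consecutive cells covering the
    support; [bl_first] and [bl_last] are the half-widths of the cells adjoining it on the left and
    on the right. *)
Record block := Block {
  bl_lo : Z ; bl_hi : Z ; bl_knots : seq (Z * Z) ;
  bl_left : nat ; bl_right : nat ;
  bl_first : Z ; bl_cells : seq Z ; bl_last : Z }.

Section CheckDefs.
Local Open Scope Z_scope.
Variables (t : log_tree) (ln2 D s ca : Z) (kap : Z * Z) (l0 : Z) (ks : seq (Z * Z))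
  (rts : seq (Z * (Z * Z))) (cz Kz : Z).

(** In multiples of [H / 8]; each piece has half-width [H / 8]. *)
Definition piece_centers : seq Z := [:: -7; -5; -3; -1; 1; 3; 5; 7].

(* The values on [-H, H], bounded on each of eight equal pieces. *)
Definition poly_pieces (p : seq (Z * Z)) (H : Z) : seq (Z * Z) :=
  let q := H * 2199023255552 in
  [seq horner_ival p (c * q, q) | c <- piece_centers].

Definition cell_in (M H : Z) : bool :=
  let p := phi_poly t ln2 D s ca kap l0 ks rts M H in
  p.1 && all (fun v => (cz <=? v.1 - v.2) && (v.1 + v.2 <=? Kz)) (poly_pieces p.2 H).

(** For a cell just outside the support, lying in direction [e] (1 or -1) from it. Besides the lower
    bound, [Phi] must be no smaller at the outer end than at the centre: by convexity it then keeps
    growing across the rest of the gap. *)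
Definition cell_out (M H e : Z) : bool :=
  let p := phi_poly t ln2 D s ca kap l0 ks rts M H in
  let u := horner_ival p.2 (0, 0) in
  let v := horner_ival p.2 (e * H * fscale, 0) in
  [&& p.1, all (fun v => cz <=? v.1 - v.2) (poly_pieces p.2 H) & u.1 + u.2 <=? v.1 - v.2].

Fixpoint cells_check (x : Z) (hs : seq Z) (b : Z) : bool :=
  match hs with
  | [::] => x =? b
  | h :: hs => [&& 0 <=? h, cell_in (x + h) h & cells_check (x + 2 * h) hs b]
  end.

Definition root_at (i : nat) : Z := (nth (0, (0, 0)) rts i).2.1.

(* No mass and no root lies strictly between the left root and [bl_lo b],
   nor between [bl_hi b] and the right root (which is absent when its index is
   [size rts]). *)
Definition block_sep (bs : seq block) (b : block) : bool :=
  [&& all (fun c => (bl_hi c <=? root_at (bl_left b) - 1) || (bl_lo b <=? bl_lo c)) bs,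
      all (fun c => (bl_hi c <=? bl_hi b) ||
         (leq (bl_right b).+1 (size rts) && (root_at (bl_right b) + 1 <=? bl_lo c))) bs,
      all (fun i => [|| i == bl_left b, root_at i + 2 <=? root_at (bl_left b) |
         bl_lo b + 1 <=? root_at i]) (iota 0 (size rts)) &
      all (fun i => [|| i == bl_right b, root_at i + 1 <=? bl_hi b |
         leq (bl_right b).+1 (size rts) && (root_at (bl_right b) + 2 <=? root_at i)])
        (iota 0 (size rts))].

Definition block_check (bs : seq block) (b : block) : bool :=
  [&& group_check (bl_lo b) (bl_hi b) (bl_knots b), block_sep bs b,
      leq (bl_left b).+1 (size rts), 0 <? bl_first b, 0 <? bl_last b,
      cell_out (bl_lo b - bl_first b) (bl_first b) (-1),
      cell_out (bl_hi b + bl_last b) (bl_last b) 1 &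
      cells_check (bl_lo b) (bl_cells b) (bl_hi b)].

(** Consecutive blocks share a root and the last one has no root on its right, so that the blocks
    account for everything to the right of root [l]. *)
Fixpoint chain_check (l : nat) (bs : seq block) : bool :=
  match bs with
  | [::] => l == size rts
  | b :: bs => (bl_left b == l) && chain_check (bl_right b) bs
  end.

End CheckDefs.

Lemma Z_add_double a h : Z.add (Z.add a h) h = Z.add a (Z.mul 2 h).
Proof. by lia. Qed.

Lemma all_In (T : Type) (P : T -> bool) l x : all P l -> List.In x l -> P x.
Proof. by elim: l => //= y l IH /andP[Py /IH {}IH] [<-|/IH]. Qed.

Lemma hinge_sum_flatten (R : realType) l (x : R) :
  hinge_sum (flatten (map bl_knots l)) x = (\sum_(b <- l) hinge_sum (bl_knots b) x)%R.
Proof.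
elim: l => [|b l IH]; first by rewrite /hinge_sum !big_nil.
by rewrite big_cons -IH /hinge_sum /= big_cat.
Qed.

Section CheckTheory.
Context (R : realType).
Local Open Scope ring_scope.
Notation zr := (@zr R).
Notation S := (zr fscale).

Variables (t : log_tree) (ln2 D s ca : Z) (kap : Z * Z) (l0 : Z) (bs : seq block)
  (rts : seq (Z * (Z * Z))) (cz Kz : Z) (rs : seq R).
Let ks := flatten (map bl_knots bs).
Let KS := knots_real R D s ks.
Let U := pl_potential KS.
Let n := size rts.

Hypotheses (ok : log_oracle R t ln2) (D0 : Z.lt 0 D) (s0 : Z.lt 0 s)
  (kB : forall k, k \in ks -> Z.le 0 k.1 /\ Z.le k.1 32767)
  (c0 : \sum_(k <- ks) zr k.2 = 0) (c1 : \sum_(k <- ks) zr k.2 * zr k.1 = 0)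
  (c2 : \sum_(k <- ks) zr k.2 * zr k.1 ^+ 2 = zr s)
  (caE : zr ca = \sum_(k <- ks) `|zr k.2|)
  (l00 : Z.lt 0 l0) (lam0 : forall q, q \in rts -> Z.lt 0 q.1)
  (sz : size rs = n)
  (near : forall i, (i < n)%N -> near_root (nth (Z0, (Z0, Z0)) rts i).2 (zr D * nth 0 rs i))
  (eta1 : forall i, (i < n)%N -> Z.lt (Z.abs (nth (Z0, (Z0, Z0)) rts i).2.2) 1048576)
  (kapE : contains kap ((zr l0 / S + \sum_(q <- rts) zr q.1 / S) * scaled_log (zr D) +
     3 / 2 * (zr l0 / S))).

Let roots : seq (R * R) := [seq (zr q.1.1 / S, q.2) | q <- zip rts rs].
Let l0R : R := zr l0 / S.
Let Phi y : R := y - \sum_(q <- roots) q.1 * ln `|y - q.2| - l0R * U y.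
Let DR : 0 < zr D. Proof. exact: zr_gt0. Qed.
Let S0 : 0 < S := fscale_gt0 R.
Let phi := phi_poly t ln2 D s ca kap l0 ks rts.
Let blk_ok := block_check t ln2 D s ca kap l0 ks rts cz Kz bs.

Let phi_encl M H (x : R) : `|x| <= zr H -> (phi M H).1 ->
  (forall r, r \in rs -> (zr M + x) / zr D != r) /\
  encl (phi M H).2 x (Phi ((zr M + x) / zr D)).
Proof.
move=> xH pok.
have [nr he] := phi_poly_encl ok kB c0 c1 s0 caE D0 xH sz near kapE pok.
split => //; move: he; congr encl.
rewrite /Phi /U (pl_potential_scaled _ D0 s0 c0 c1 c2).
have Dn0 : zr D != 0 by rewrite gt_eqF.
have E : \sum_(q <- roots) q.1 * ln `|(zr M + x) / zr D - q.2| =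
  \sum_(q <- zip rts rs) zr q.1.1 / S * scaled_log (zr M + x - zr D * q.2) -
  (\sum_(q <- rts) zr q.1 / S) * scaled_log (zr D).
  have -> : \sum_(q <- rts) zr q.1 / S = \sum_(q <- zip rts rs) zr q.1.1 / S.
    rewrite -[X in \sum_(q <- X) _ = _](unzip1_zip (s := rts) (t := rs)) ?sz//.
    by rewrite big_map.
  rewrite mulr_suml -sumrB /roots big_map big_seq [RHS]big_seq.
  apply: eq_bigr => q qz /=.
  have /nr nq : q.2 \in rs.
    by rewrite -(unzip2_zip (s := rts) (t := rs)) ?sz//; exact: map_f.
  have n0 : zr M + x - zr D * q.2 != 0.
    by rewrite subr_eq0; apply: contra nq => /eqP->; rewrite mulrC mulKf.
  rewrite !scaled_logE// -mulrBr; congr (_ * _).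
  have -> : (zr M + x) / zr D - q.2 = (zr M + x - zr D * q.2) / zr D by field.
  by rewrite normrM normfV ln_div ?posrE ?normr_gt0//; ring.
by rewrite E /l0R; ring.
Qed.

(** Interval evaluation overestimates less on eight small pieces than on the whole cell. *)
Let phi_piece M H (x : R) : `|x| <= zr H -> (phi M H).1 ->
  exists2 v, v \in poly_pieces (phi M H).2 H & contains v (Phi ((zr M + x) / zr D)).
Proof.
move=> xH pok; have [_ he] := phi_encl xH pok.
set q := Z.mul H 2199023255552.
have qE : S * zr H = 8 * zr q.
  rewrite /q zrM (_ : fscale = Z.mul 8 2199023255552)// zrM (_ : zr 8 = 8); last by rewrite zrE.
  by ring.
have xq : `|S * x| <= 8 * zr q by rewrite normrM (gtr0_norm S0) -qE ler_pM2l.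
suff [c cin cx] : exists2 c, c \in piece_centers & contains (Z.mul c q, q) x.
  exists (horner_ival (phi M H).2 (Z.mul c q, q)); last exact: contains_horner he cx.
  by apply/mapP; exists c.
have cE c : contains (Z.mul c q, q) x <-> zr c * zr q - zr q <= S * x <= zr c * zr q + zr q.
  rewrite /contains /= zrM ler_norml; split => /andP[h1 h2]; apply/andP; split; lra.
have zc : [/\ zr (-7) = -7, zr (-5) = -5, zr (-3) = -3 & zr (-1) = -1] /\
    [/\ zr 1 = 1, zr 3 = 3, zr 5 = 5 & zr 7 = 7] by rewrite !zrE.
have [[e1 e2 e3 e4] [e5 e6 e7 e8]] := zc.
move: xq; rewrite ler_norml => /andP[x1 x2].
have [h|h] := leP (S * x) (- 6 * zr q).
  by exists (Zneg 7) => //; apply/cE; rewrite e1; apply/andP; split; lra.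
have [h2|h2] := leP (S * x) (- 4 * zr q).
  by exists (Zneg 5) => //; apply/cE; rewrite e2; apply/andP; split; lra.
have [h3|h3] := leP (S * x) (- 2 * zr q).
  by exists (Zneg 3) => //; apply/cE; rewrite e3; apply/andP; split; lra.
have [h4|h4] := leP (S * x) 0.
  by exists (Zneg 1) => //; apply/cE; rewrite e4; apply/andP; split; lra.
have [h5|h5] := leP (S * x) (2 * zr q).
  by exists (Zpos 1) => //; apply/cE; rewrite e5; apply/andP; split; lra.
have [h6|h6] := leP (S * x) (4 * zr q).
  by exists (Zpos 3) => //; apply/cE; rewrite e6; apply/andP; split; lra.
have [h7|h7] := leP (S * x) (6 * zr q).
  by exists (Zpos 5) => //; apply/cE; rewrite e7; apply/andP; split; lra.
by exists (Zpos 7) => //; apply/cE; rewrite e8; apply/andP; split; lra.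
Qed.

Let cz_le v x : contains v x -> Z.le cz (Z.sub v.1 v.2) -> zr cz / S <= x.
Proof.
move=> /containsP /andP[h _] /(zr_le R); rewrite zrB => h2.
by rewrite ler_pdivrMr// mulrC (le_trans h2).
Qed.

Let cell_shift M H (y : R) : zr (Z.sub M H) / zr D <= y <= zr (Z.add M H) / zr D ->
  exists2 x, `|x| <= zr H & y = (zr M + x) / zr D.
Proof.
rewrite ler_pdivrMr// ler_pdivlMr// zrB zrD => /andP[h1 h2].
exists (y * zr D - zr M); first by rewrite ler_norml; apply/andP; split; lra.
by rewrite addrC subrK mulfK// gt_eqF.
Qed.

Let cell_outP M H e y : cell_out t ln2 D s ca kap l0 ks rts cz M H e ->
  zr (Z.sub M H) / zr D <= y <= zr (Z.add M H) / zr D -> zr cz / S <= Phi y.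
Proof.
move=> /and3P[pok /allP hc _] /cell_shift[x xH ->].
by have [v /hc/Z.leb_le vc vx] := phi_piece xH pok; exact: cz_le vx vc.
Qed.

Let cells_checkP a hs b y : cells_check t ln2 D s ca kap l0 ks rts cz Kz a hs b ->
  zr a / zr D <= y < zr b / zr D -> zr cz / S <= Phi y <= zr Kz / S.
Proof.
elim: hs a => [|h hs IH] a /=.
  by move=> /Z.eqb_eq -> /andP[h1 h2]; have := le_lt_trans h1 h2; rewrite ltxx.
move=> /and3P[/Z.leb_le h0 /andP[p1 /allP p2] /IH {}IH] /andP[ay yb].
have [y2|y2] := ltP y (zr (Z.add a (Z.mul 2 h)) / zr D); last by apply: IH; rewrite y2.
have [|x xH yE] := @cell_shift (Z.add a h) h y.
  by rewrite Z.add_simpl_r Z_add_double ay ltW.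
have [v /p2/andP[/Z.leb_le v1 /Z.leb_le v2] vx] := phi_piece xH p1.
rewrite yE (cz_le vx v1)/=.
have /containsP/andP[_ h4] := vx; have := zr_le R v2; rewrite zrD => h5.
by rewrite ler_pdivlMr// mulrC (le_trans h4).
Qed.

Let cell_out_grows M H e : Z.le 0 H -> zr e = 1 \/ zr e = -1 ->
  cell_out t ln2 D s ca kap l0 ks rts cz M H e ->
  Phi (zr M / zr D) <= Phi ((zr M + zr e * zr H) / zr D).
Proof.
move=> H0 e1 /and3P[pok _ /Z.leb_le /(zr_le R)]; rewrite zrD zrB => h.
have HR : 0 <= zr H by exact: zr_ge0.
have [|_ h1] := @phi_encl M H 0 _ pok; first by rewrite normr0.
have [|_ h2] := @phi_encl M H (zr e * zr H) _ pok.
  by case: e1 => ->; rewrite ?mul1r ?mulN1r ?normrN ger0_norm.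
have /containsP/andP[_ k1] := contains_horner h1 (contains0 R).
have he : contains (Z.mul (Z.mul e H) fscale, Z0) (zr e * zr H).
  by rewrite /contains /= !zrM zr0 (mulrC S) subrr normr0.
have /containsP/andP[k2 _] := contains_horner h2 he.
by move: k1; rewrite addr0 => k1; rewrite -(ler_pM2l S0) (le_trans k1)// (le_trans h).
Qed.

Hypothesis bsP : all blk_ok bs.

Let plE y : pl KS y = 2 * zr D / zr s * hinge_sum ks (zr D * y).
Proof.
by rewrite -(pl_knots_real ks _ D0 s0); congr pl; rewrite mulrC mulKf// gt_eqF.
Qed.

Let groups_ok : all (fun b => group_check (bl_lo b) (bl_hi b) (bl_knots b)) bs.
Proof. by apply: sub_all bsP => b /and5P[]. Qed.

Let sR : 0 < zr s. Proof. exact: zr_gt0. Qed.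

Lemma blocks_pl_ge0 y : 0 <= pl KS y.
Proof.
rewrite plE mulr_ge0 ?divr_ge0 ?mulr_ge0 ?(ltW DR) ?(ltW sR)// hinge_sum_flatten.
elim: bs groups_ok => [|b l IH]; first by rewrite big_nil.
rewrite big_cons /= => /andP[hb /IH hl].
by rewrite addr_ge0// (group_check_ge0 _ hb).
Qed.

Lemma blocks_pl_neq0 y : pl KS y != 0 ->
  exists b, List.In b bs /\ zr (bl_lo b) < zr D * y < zr (bl_hi b).
Proof.
rewrite plE hinge_sum_flatten mulf_eq0 negb_or => /andP[_].
elim: bs groups_ok => [|b l IH]; first by rewrite big_nil eqxx.
rewrite big_cons /= => /andP[hb /IH {}IH] h.
have [hb0|hbn] := eqVneq (hinge_sum (bl_knots b) (zr D * y)) 0.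
  by move: h; rewrite hb0 add0r => /IH[c [cl hc]]; exists c; split => //; right.
by exists b; split; [left|exact: group_check_neq0 hb hbn].
Qed.

Lemma blocks_pl_density : pl_density KS (zr 32768 / zr D).
Proof.
have Dn0 : zr D != 0 by rewrite gt_eqF.
have sn0 : zr s != 0 by rewrite gt_eqF.
split.
- move=> k /mapP[j /kB[j0 j1] -> /=]; apply/andP; split.
    by rewrite divr_ge0 ?(ltW DR)//; exact: zr_ge0.
  by rewrite ltr_pM2r ?invr_gt0//; apply: zr_lt; apply: Z.le_lt_trans j1 _.
- by rewrite /KS /knots_real big_map /= -mulr_suml c0 mul0r.
- rewrite /KS /knots_real big_map.
  rewrite (eq_bigr (fun k => zr k.2 * zr k.1 * (2 * zr D / zr s))) => [|k _ /=].
    by rewrite -mulr_suml c1 mul0r.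
  by field; rewrite sn0.
- rewrite /KS /knots_real big_map.
  rewrite (eq_bigr (fun k => zr k.2 * zr k.1 ^+ 2 * (2 / zr s))) => [|k _ /=].
    by rewrite -mulr_suml c2; field.
  by field; rewrite sn0.
- exact: blocks_pl_ge0.
Qed.

Let nearP i : (i < n)%N ->
  zr (root_at rts i) - 1 <= zr D * nth 0 rs i <= zr (root_at rts i) + 1.
Proof.
move=> ni; have := near_root_le1 (near ni) (eta1 ni); rewrite ler_norml -/(root_at rts i).
by move=> /andP[h1 h2]; apply/andP; split; lra.
Qed.

Let rootsP q : q \in roots -> exists2 i, (i < n)%N & 0 <= q.1 /\ q.2 = nth 0 rs i.
Proof.
case/mapP => p /(nthP ((Z0, (Z0, Z0)), 0)) [i].
rewrite size_zip sz minnn => ni; rewrite nth_zip ?sz// => <- ->; exists i => //=; split => //.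
rewrite divr_ge0 ?(ltW S0)//; apply: zr_ge0; apply/Z.lt_le_incl.
by apply: lam0; exact: mem_nth.
Qed.

(** Between the left root and the support [Phi] is convex. The points [x1] and [x2] of [pl_gap_le]
    are the centre and the outer end of the adjoining cell. *)
Lemma block_left_gap b y : List.In b bs -> nth 0 rs (bl_left b) < y ->
  y <= zr (Z.sub (bl_lo b) (Z.mul 2 (bl_first b))) / zr D -> zr cz / S <= Phi y.
Proof.
move=> bb ry yl; have := all_In bsP bb.
move=> /and5P[gc /and4P[sep1 _ /allP sep3 _] nl /Z.ltb_lt f0 /and4P[_ cl _ _]].
have fR := zr_gt0 R f0.
set lo := bl_lo b; set h := bl_first b.
have [ryR yl'] : zr (root_at rts (bl_left b)) - 1 < zr D * y /\ zr D * y <= zr lo - 2 * zr h.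
  split; last by move: yl; rewrite ler_pdivlMr// mulrC zrB zrM zr2.
  have /andP[r1 _] := nearP nl; apply: (le_lt_trans r1).
  by rewrite ltr_pM2l.
have x1E : zr D * (zr (Z.sub lo h) / zr D) = zr lo - zr h.
  by rewrite zrB; field; rewrite gt_eqF.
have x2E : zr D * (zr (Z.sub lo (Z.mul 2 h)) / zr D) = zr lo - 2 * zr h.
  by rewrite zrB zrM zr2; field; rewrite gt_eqF.
have hR : 0 < zr h by [].
apply: (@le_trans _ _ (Phi (zr (Z.sub lo (Z.mul 2 h)) / zr D))).
  apply: (cell_outP cl); rewrite !ler_pM2r ?invr_gt0//.
  by rewrite !zrB zrD zrB zrM zr2 -/lo -/h; apply/andP; split; lra.
have mn : Num.min (zr (Z.sub lo h) / zr D) y = y.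
  by rewrite min_r// -(ler_pM2l DR) x1E; lra.
have mx : Num.max (zr (Z.sub lo h) / zr D) y = zr (Z.sub lo h) / zr D.
  by rewrite max_l// -(ler_pM2l DR) x1E; lra.
rewrite /Phi; apply: (pl_gap_le (x1 := zr (Z.sub lo h) / zr D) blocks_pl_density blocks_pl_ge0).
- by rewrite ltW// divr_gt0//; exact: zr_gt0.
- right; rewrite yl /= ltr_pM2r ?invr_gt0// !zrB zrM zr2; lra.
- move=> z /blocks_pl_neq0[c [cc /andP[z1 z2]]]; rewrite mn mx.
  have /orP[/Z.leb_le/(zr_le R)|/Z.leb_le/(zr_le R)] := all_In sep1 cc.
    by rewrite zrB zr1 => hh; left; rewrite -(ltr_pM2l DR); lra.
  by rewrite -/lo => hh; right; rewrite -(ltr_pM2l DR) x1E; lra.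
- move=> q /rootsP[i ni [q0 qE]]; split => //; rewrite mn mx qE.
  have /andP[n1 n2] := nearP ni.
  have : i \in iota 0 (size rts) by rewrite mem_iota.
  move=> /sep3 /or3P[/eqP->|/Z.leb_le/(zr_le R)|/Z.leb_le/(zr_le R)].
  + by left.
  + by rewrite zrD zr2 => hh; left; rewrite -(ltr_pM2l DR); lra.
  + by rewrite zrD zr1 -/lo => hh; right; rewrite -(ltr_pM2l DR) x1E; lra.
have zm1 : zr (-1) = -1 by rewrite zrE.
have := cell_out_grows (Z.lt_le_incl _ _ f0) (or_intror zm1) cl.
by rewrite zm1 zrB -/lo -/h (_ : _ + -1 * _ = zr (Z.sub lo (Z.mul 2 h)))// zrB zrM zr2; ring.
Qed.

(** Mirror image of [block_left_gap]; if there is no right root the gap extends to infinity. *)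
Lemma block_right_gap b y : List.In b bs ->
  ((bl_right b < n)%N -> y < nth 0 rs (bl_right b)) ->
  zr (Z.add (bl_hi b) (Z.mul 2 (bl_last b))) / zr D <= y -> zr cz / S <= Phi y.
Proof.
move=> bb ry yl; have := all_In bsP bb.
move=> /and5P[gc /and4P[_ sep2 _ /allP sep4] nl _ /and4P[/Z.ltb_lt f0 _ cl _]].
have hR := zr_gt0 R f0.
set hi := bl_hi b; set h := bl_last b.
have yl' : zr hi + 2 * zr h <= zr D * y.
  by move: yl; rewrite ler_pdivrMr// mulrC zrD zrM zr2.
have ryR : (bl_right b < n)%N -> zr D * y < zr (root_at rts (bl_right b)) + 1.
  by move=> nr; have /andP[_] := nearP nr; apply: lt_le_trans; rewrite ltr_pM2l ?ry.
have x1E : zr D * (zr (Z.add hi h) / zr D) = zr hi + zr h.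
  by rewrite zrD; field; rewrite gt_eqF.
have hR' : 0 < zr h by [].
apply: (@le_trans _ _ (Phi (zr (Z.add hi (Z.mul 2 h)) / zr D))).
  apply: (cell_outP cl); rewrite !ler_pM2r ?invr_gt0//.
  by rewrite zrB !zrD zrM zr2 -/hi -/h; apply/andP; split; lra.
have mn : Num.min (zr (Z.add hi h) / zr D) y = zr (Z.add hi h) / zr D.
  by rewrite min_l// -(ler_pM2l DR) x1E; lra.
have mx : Num.max (zr (Z.add hi h) / zr D) y = y.
  by rewrite max_r// -(ler_pM2l DR) x1E; lra.
rewrite /Phi; apply: (pl_gap_le (x1 := zr (Z.add hi h) / zr D) blocks_pl_density blocks_pl_ge0).
- by rewrite ltW// divr_gt0//; exact: zr_gt0.
- left; rewrite yl andbT ltr_pM2r ?invr_gt0// !zrD zrM zr2; lra.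
- move=> z /blocks_pl_neq0[c [cc /andP[z1 z2]]]; rewrite mn mx.
  have /orP[/Z.leb_le/(zr_le R)|/andP[nr /Z.leb_le/(zr_le R)]] := all_In sep2 cc.
    by rewrite -/hi => hh; left; rewrite -(ltr_pM2l DR) x1E; lra.
  by rewrite zrD zr1 => hh; right; rewrite -(ltr_pM2l DR); have := ryR nr; lra.
- move=> q /rootsP[i ni [q0 qE]]; split => //; rewrite mn mx qE.
  have /andP[n1 n2] := nearP ni.
  have : i \in iota 0 (size rts) by rewrite mem_iota.
  move=> /sep4 /or3P[/eqP iE|/Z.leb_le/(zr_le R)|/andP[nr /Z.leb_le/(zr_le R)]].
  + by right; rewrite iE ry// -iE.
  + by rewrite zrD zr1 -/hi => hh; left; rewrite -(ltr_pM2l DR) x1E; lra.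
  + by rewrite zrD zr2 => hh; right; rewrite -(ltr_pM2l DR); have := ryR nr; lra.
have := cell_out_grows (Z.lt_le_incl _ _ f0) (or_introl (zr1 R)) cl.
by rewrite zr1 -/hi -/h (_ : _ + 1 * _ = zr (Z.add hi (Z.mul 2 h)))// !zrD zrM zr2; ring.
Qed.

Lemma block_territory b y : List.In b bs -> nth 0 rs (bl_left b) < y ->
  ((bl_right b < n)%N -> y < nth 0 rs (bl_right b)) -> zr cz / S <= Phi y.
Proof.
move=> bb yl yr.
have [y1|y1] := leP y (zr (Z.sub (bl_lo b) (Z.mul 2 (bl_first b))) / zr D).
  exact: block_left_gap yl y1.
have [y2|y2] := leP (zr (Z.add (bl_hi b) (Z.mul 2 (bl_last b))) / zr D) y.
  exact: block_right_gap yr y2.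
have := all_In bsP bb.
move=> /and5P[gc _ nl _ /and4P[_ clo chi cin]].
have [y3|y3] := leP y (zr (bl_lo b) / zr D).
  apply: (cell_outP clo); rewrite (le_trans _ (ltW y1))/=; last first.
    by rewrite ler_pM2r ?invr_gt0// !zrB zrM zr2; lra.
  by rewrite (le_trans y3)// ler_pM2r ?invr_gt0// zrD zrB; lra.
have [y4|y4] := ltP y (zr (bl_hi b) / zr D).
  have /andP[] // : zr cz / S <= Phi y <= zr Kz / S.
  by apply: (cells_checkP cin); rewrite (ltW y3).
apply: (cell_outP chi); rewrite (le_trans (ltW y2)) ?andbT; last first.
  by rewrite ler_pM2r ?invr_gt0// !zrD zrM zr2; lra.
by rewrite (le_trans _ y4)// ler_pM2r ?invr_gt0// zrB zrD; lra.
Qed.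

(** Walk along the chain until [y] lies to the left of the right root of the current block. *)
Lemma blocks_phi_ge l bs' y : (forall b, List.In b bs' -> List.In b bs) ->
  chain_check rts l bs' -> (l < n)%N -> nth 0 rs l < y ->
  (forall r, r \in rs -> y != r) -> zr cz / S <= Phi y.
Proof.
elim: bs' l => [|b bs' IH] l sub /=; first by move=> /eqP ->; rewrite ltnn.
move=> /andP[/eqP <-] ch ln yl nr.
have [rn|rn] := ltnP (bl_right b) n; last first.
  by apply: (block_territory (b := b)) => //; [exact: sub (or_introl erefl)|rewrite ltnNge rn].
have [yr|yr|yr] := ltgtP y (nth 0 rs (bl_right b)).
- by apply: (block_territory (b := b)) => //; exact: sub (or_introl erefl).
- by apply: (IH _ _ ch) => // c cc; apply: sub; right.
- by have := nr (nth 0 rs (bl_right b)); rewrite yr eqxx mem_nth ?sz// => /(_ isT).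
Qed.

Lemma blocks_phi_le y : 0 < pl KS y -> Phi y <= zr Kz / S.
Proof.
move=> py; have [b [bb /andP[y1 y2]]] := blocks_pl_neq0 (lt0r_neq0 py).
have := all_In bsP bb; move=> /and5P[_ _ _ _ /and4P[_ _ _ cin]].
have /andP[] // : zr cz / S <= Phi y <= zr Kz / S.
by apply: (cells_checkP cin); rewrite ler_pdivrMr// ltr_pdivlMr// mulrC (ltW y1).
Qed.

End CheckTheory.

(** * The boolean certificate and its soundness *)

Section CertificateDefs.
Local Open Scope Z_scope.

(** The Taylor polynomial at the integer [rt.1], evaluated at the offset of the root, which is at
    most 1; [16777216 = 2 ^ 24] converts multiples of [2 ^ -20] to the fixed-point unit. *)
Definition root_potential_ival (t : log_tree) (ln2 D s ca : Z) (ks : seq (Z * Z)) (rt : Z * Z) :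
    Z * Z :=
  iadd (horner_ival (potential_poly t ln2 s ca ks rt.1 1) (rt.2 * 16777216, 16777216))
    (iopp (iadd ((log_at t ln2 (Z.to_pos D)).1, 90) (irat 3 2))).

Definition isum (s : seq (Z * Z)) : Z * Z := foldr iadd (0, 0) s.

Definition family_roots (fams : seq (Z * seq (Z * Z))) : seq (Z * (Z * Z)) :=
  flatten [seq [seq (q.1, rt) | rt <- q.2] | q <- fams].

(** Here [pots] encloses the integrals of [log |Q|] over [mu], whose nonnegativity is part of
    admissibility, and [loss] their sum weighted by the multipliers. The comparison of [Kz] with
    [mean] and [loss] is the hypothesis [K_le], on which the nonnegative energy of [mu] rests; [mz]
    is the resulting upper bound on [lambda], and [cz] the lower one. *)
Definition certificate_check (t : log_tree) (ln2 D l0 cz Kz mz : Z) (bs : seq block)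
    (fams : seq (Z * seq (Z * Z))) : bool :=
  let ks := flatten (map bl_knots bs) in
  let rts := family_roots fams in
  let s := zsum (fun k => k.2 * (k.1 * k.1)) ks in
  let ca := zsum (fun k => Z.abs k.2) ks in
  let lD := ((log_at t ln2 (Z.to_pos D)).1, 90) in
  let kap := iadd (imul (iadd (l0, 0) (isum [seq (q.1, 0) | q <- rts])) lD)
    (imul (irat 3 2) (l0, 0)) in
  let pots := [seq (q.1, isum [seq root_potential_ival t ln2 D s ca ks rt | rt <- q.2])
     | q <- fams] in
  let mean := irat (zsum (fun k => k.2 * (k.1 * k.1 * k.1)) ks) (3 * s * D) in
  let loss := isum [seq imul (q.1, 0) q.2 | q <- pots] in
  [&& [&& 0 <? D, D <=? 32767, 0 <? s, zsum (fun k => k.2) ks =? 0 &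
          zsum (fun k => k.2 * k.1) ks =? 0],
      [&& 0 <? l0, 0 <=? cz, 0 <=? Kz, all (fun k => (0 <=? k.1) && (k.1 <=? 32767)) ks &
          all (fun q => Z.abs q.2.2 <? 1048576) rts],
      [&& all (fun f => 0 <? f.1) fams, all (fun q => potential_ok ks q.2.1 1) rts,
          all (fun q => 0 <=? q.2.1 - q.2.2) pots,
          Kz + (loss.1 + loss.2) <=? mean.1 - mean.2 & mean.1 + mean.2 <=? mz],
      all (fun q => all (fun b => (q.2.1 + 1 <=? bl_lo b) || (bl_hi b <=? q.2.1 - 1)) bs) rts,
      leq 1 (size rts), chain_check rts 0 bs &
      all (block_check t ln2 D s ca kap l0 ks rts cz Kz bs) bs].

End CertificateDefs.

Section CertificateTheory.
Context (R : realType).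
Local Open Scope ring_scope.
Notation zr := (@zr R).
Notation S := (zr fscale).

Lemma contains_isum (T : Type) (f : T -> Z * Z) (g : T -> R) (s : seq T) :
  (forall x, List.In x s -> contains (f x) (g x)) ->
  contains (isum (map f s)) (\sum_(x <- s) g x).
Proof.
elim: s => [|x s IH] h; first by rewrite big_nil; exact: contains0.
rewrite big_cons /=; apply: contains_add; first by apply: h; left.
by apply: IH => y ys; apply: h; right.
Qed.

Lemma In_mem (T : eqType) (x : T) s : List.In x s -> x \in s.
Proof. by elim: s => //= y s IH [->|/IH]; rewrite inE ?eqxx// => ->; rewrite orbT. Qed.

Lemma zip_map_self (T1 T2 : Type) (f : T1 -> T2) (s : seq T1) :
  zip s (map f s) = [seq (x, f x) | x <- s].
Proof. by elim: s => //= x s ->. Qed.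

Lemma sum_family_roots (fams : seq (Z * seq (Z * Z))) (g : Z * (Z * Z) -> R) :
  \sum_(q <- family_roots fams) g q = \sum_(f <- fams) \sum_(rt <- f.2) g (f.1, rt).
Proof.
elim: fams => [|f fams IH]; first by rewrite /family_roots !big_nil.
by rewrite big_cons -IH /family_roots /= big_cat /= big_map.
Qed.

Variables (t : log_tree) (ln2 D l0 cz Kz mz : Z) (bs : seq block)
  (fams : seq (Z * seq (Z * Z))) (root_of : Z * Z -> R).
Let ks := flatten (map bl_knots bs).
Let rts := family_roots fams.
Let s := zsum (fun k => Z.mul k.2 (Z.mul k.1 k.1)) ks.
Let ca := zsum (fun k => Z.abs k.2) ks.
Let KS := knots_real R D s ks.
Let fam : seq (R * seq R) := [seq (zr q.1 / S, map root_of q.2) | q <- fams].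

Lemma family_rootsP q : q \in rts -> exists2 f, f \in fams & q.1 = f.1 /\ q.2 \in f.2.
Proof.
move=> /flatten_mapP[f ff /mapP[rt rtf ->]]; by exists f.
Qed.

Lemma mem_family_roots f rt : f \in fams -> rt \in f.2 -> (f.1, rt) \in rts.
Proof. by move=> ff rtf; apply/flatten_mapP; exists f => //; exact: map_f. Qed.

Lemma certificate_bounds (A : {fset {poly int}}) : log_oracle R t ln2 ->
  certificate_check t ln2 D l0 cz Kz mz bs fams ->
  (forall f rt, f \in fams -> rt \in f.2 -> near_root rt (zr D * root_of rt)) ->
  root_of (nth (Z0, (Z0, Z0)) rts 0).2 <= 0 ->
  (forall Q, Q \in A -> exists2 f, f \in fams &
     forall x, (map_poly intr Q).[x] = root_poly (map root_of f.2) x) ->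
  (forall f, f \in fams -> exists2 Q, Q \in A &
     forall x, (map_poly intr Q).[x] = root_poly (map root_of f.2) x) ->
  ((zr cz / S)%:E <= lambda R A <= (zr mz / S)%:E)%E.
Proof.
move=> ok; rewrite /certificate_check -/ks -/rts -/s -/ca; cbv zeta.
set kap := iadd _ _; set pots := map _ fams.
move=> /and5P[/and5P[/Z.ltb_lt D0 /Z.leb_le D15 /Z.ltb_lt s0 /Z.eqb_eq sC /Z.eqb_eq sCT]
  /and5P[/Z.ltb_lt l00 /Z.leb_le cz0 /Z.leb_le Kz0 /allP kB /allP rtsP]
  /and5P[/allP lamP /allP potok /allP potge /Z.leb_le Kle /Z.leb_le mle] /allP rout /and3P[n0 chain blocks]].
move=> near root0 A_fam fam_A.
have DR := zr_gt0 R D0; have sR := zr_gt0 R s0; have S0 := fscale_gt0 R.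
pose rs := [seq root_of q.2 | q <- rts].
have kB' k : k \in ks -> Z.le 0 k.1 /\ Z.le k.1 32767.
  by move=> /kB /andP[/Z.leb_le h1 /Z.leb_le h2].
have c0 : \sum_(k <- ks) zr k.2 = 0 by rewrite -zr_zsum sC zr0.
have c1 : \sum_(k <- ks) zr k.2 * zr k.1 = 0.
  by under eq_bigr do rewrite -zrM; rewrite -zr_zsum sCT zr0.
have c2 : \sum_(k <- ks) zr k.2 * zr k.1 ^+ 2 = zr s.
  by rewrite /s zr_zsum; apply: eq_bigr => k _; rewrite !zrM expr2.
have caE : zr ca = \sum_(k <- ks) `|zr k.2|.
  by rewrite /ca zr_zsum; apply: eq_bigr => k _; rewrite zr_abs.
have lam0 q : q \in rts -> Z.lt 0 q.1 by move=> /family_rootsP[f /lamP /Z.ltb_lt h [-> _]].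
have sz : size rs = size rts by rewrite size_map.
have nearq q : q \in rts -> near_root q.2 (zr D * root_of q.2).
  by move=> /family_rootsP[f ff [_]]; exact: near.
have nearn i : (i < size rts)%N -> near_root (nth (Z0, (Z0, Z0)) rts i).2 (zr D * nth 0 rs i).
  by move=> ni; rewrite (nth_map (Z0, (Z0, Z0)))//; apply: nearq; exact: mem_nth.
have eta1 i : (i < size rts)%N -> Z.lt (Z.abs (nth (Z0, (Z0, Z0)) rts i).2.2) 1048576.
  by move=> ni; have /rtsP /Z.ltb_lt := mem_nth (Z0, (Z0, Z0)) ni.
have lDE : contains ((log_at t ln2 (Z.to_pos D)).1, 90) (scaled_log (zr D)).
  have pE : Zpos (Z.to_pos D) = D by apply: Z2Pos.id.
  have [|g1 _] := ok (Z.to_pos D); first by rewrite pE; apply: Z.le_lt_trans D15 _.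
  rewrite /contains; cbn [fst snd]; rewrite distrC /scaled_log (gtr0_norm DR).
  by move: g1; rewrite pE (_ : zr 90 = 90)// zrE.
have kapE : contains kap ((zr l0 / S + \sum_(q <- rts) zr q.1 / S) * scaled_log (zr D) +
     3 / 2 * (zr l0 / S)).
  apply: contains_add; apply: contains_mul => //.
  - apply: contains_add; first exact: contains_const.
    by apply: contains_isum => q _; exact: contains_const.
  - have := contains_rat R 3 (n := 2); rewrite zr2 (_ : zr 3 = 3); last by rewrite zrE.
    by apply.
  - exact: contains_const.
pose hks := blocks_pl_density D0 s0 kB' c0 c1 c2 blocks.
have near1 q : q \in rts -> `|zr D * root_of q.2 - zr q.2.1| <= 1.
  by move=> qr; apply: near_root_le1 (nearq q qr) _; have /rtsP /Z.ltb_lt := qr.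
have plroot q : q \in rts -> pl KS (root_of q.2) = 0.
  move=> qr; apply/eqP/negPn/negP.
  move=> /(blocks_pl_neq0 D0 s0 blocks)[b [bb /andP[b1 b2]]].
  have := near1 q qr; rewrite ler_norml => /andP[h1 h2].
  by have := all_In (rout q qr) bb; move=> /orP[/Z.leb_le/(zr_le R)|/Z.leb_le/(zr_le R)];
    rewrite ?zrB ?zrD zr1; lra.
have potE q : q \in rts -> contains (root_potential_ival t ln2 D s ca ks q.2)
    (pl_potential KS (root_of q.2)).
  move=> qr; set x := zr D * root_of q.2 - zr q.2.1.
  have xE : zr q.2.1 + x = zr D * root_of q.2 by rewrite /x; ring.
  have -> : pl_potential KS (root_of q.2) =
      scaled_potential ks (zr q.2.1 + x) / zr s - (scaled_log (zr D) + 3 / 2).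
    rewrite xE opprD addrA -(pl_potential_scaled _ D0 s0 c0 c1 c2).
    by congr pl_potential; rewrite mulrC mulKf// gt_eqF.
  apply: contains_add.
    apply: contains_horner (near_root_contains (nearq q qr)).
    apply: potential_poly_encl => //; first exact: potok.
    by rewrite zr1; exact: near1.
  apply: contains_opp; apply: contains_add => //.
  have := contains_rat R 3 (n := 2); rewrite zr2 (_ : zr 3 = 3); last by rewrite zrE.
  by apply.
have famE f : f \in fams -> contains (isum [seq root_potential_ival t ln2 D s ca ks rt | rt <- f.2])
    (root_potential KS (map root_of f.2)).
  move=> ff; rewrite /root_potential big_map; apply: contains_isum => rt rtf.
  by apply: (potE (f.1, rt)); apply: mem_family_roots => //; exact: In_mem.
have log_famE y : log_fam fam y = \sum_(q <- [seq (zr q.1.1 / S, q.2) | q <- zip rts rs])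
    q.1 * ln `|y - q.2|.
  rewrite /rs zip_map_self !big_map sum_family_roots /log_fam /fam big_map.
  apply: eq_bigr => f _ /=; rewrite /log_root_sum big_map mulr_sumr.
  by apply: eq_bigr.
have phi_le y : 0 < pl KS y -> y <= zr Kz / S + zr l0 / S * pl_potential KS y + log_fam fam y.
  move=> py; rewrite log_famE.
  by have := blocks_phi_le ok D0 s0 kB' c0 c1 c2 caE sz nearn kapE blocks py; rewrite -/KS; lra.
have phi_ge y : 0 <= y -> (forall q r, q \in fam -> r \in q.2 -> y != r) ->
    zr cz / S + log_fam fam y + zr l0 / S * pl_potential KS y <= y.
  move=> y0 ynr; have ynr' r : r \in rs -> y != r.
    move=> /mapP[q /family_rootsP[f ff [_ qf]] ->].
    by apply: (ynr (zr f.1 / S, map root_of f.2)); [exact: map_f|exact: map_f].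
  (* The chain starts at a root that is at most 0, so it covers every nonnegative [y] off the
     roots. *)
  have y0' : nth 0 rs 0 < y.
    rewrite lt_neqAle eq_sym ynr' ?mem_nth ?sz//=.
    by rewrite /rs (nth_map (Z0, (Z0, Z0)))// (le_trans root0).
  have := blocks_phi_ge ok D0 s0 kB' c0 c1 c2 caE l00 lam0 sz nearn eta1 kapE blocks
    (fun b h => h) chain n0 y0' ynr'.
  by rewrite -log_famE -/KS; lra.
have meanE : contains (irat (zsum (fun k => Z.mul k.2 (Z.mul (Z.mul k.1 k.1) k.1)) ks) (Z.mul (Z.mul 3 s) D))
    (pl_mean KS).
  have -> : pl_mean KS = zr (zsum (fun k => Z.mul k.2 (Z.mul (Z.mul k.1 k.1) k.1)) ks) /
      zr (Z.mul (Z.mul 3 s) D).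
    rewrite zr_zsum /pl_mean /KS /knots_real big_map !zrM (_ : zr 3 = 3); last by rewrite zrE.
    rewrite !mulr_suml; apply: eq_bigr => k _ /=; rewrite !zrM.
    by field; rewrite !gt_eqF.
  apply: contains_rat => h.
  have := zr_gt0 R D0; have := congr1 zr h; rewrite !zrM zr0 => /eqP.
  by rewrite !mulf_eq0 !gt_eqF// zr_gt0.
have lossE : contains (isum [seq imul (q.1, Z0) q.2 | q <- pots])
    (\sum_(q <- fam) q.1 * root_potential KS q.2).
  rewrite /pots -map_comp /fam big_map; apply: contains_isum => f /In_mem ff /=.
  by apply: contains_mul; [exact: contains_const|exact: famE].
have Sz z x : S * x <= zr z -> x <= zr z / S by rewrite ler_pdivlMr// mulrC.
have K_le : zr Kz / S <= pl_mean KS - \sum_(q <- fam) q.1 * root_potential KS q.2.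
  rewrite ler_pdivrMr// mulrC mulrBr.
  have /containsP/andP[h1 _] := meanE; have /containsP/andP[_ h2] := lossE.
  by have := zr_le R Kle; rewrite zrB !zrD; lra.
have m_le : pl_mean KS <= zr mz / S.
  apply: Sz; have /containsP/andP[_ h1] := meanE.
  by have := zr_le R mle; rewrite zrD; lra.
have fam_gt0 q : q \in fam -> 0 < q.1.
  by move=> /mapP[f /lamP /Z.ltb_lt ff ->] /=; rewrite divr_gt0//; exact: zr_gt0.
have fam_root q r : q \in fam -> r \in q.2 -> pl KS r = 0.
  move=> /mapP[f ff ->] /= /mapP[rt rtf ->].
  exact: plroot (mem_family_roots ff rtf).
have fam_ge0 q : q \in fam -> 0 <= root_potential KS q.2.
  move=> /mapP[f ff ->] /=.
  have /potge/Z.leb_le/(zr_le R) :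
      (f.1, isum [seq root_potential_ival t ln2 D s ca ks rt | rt <- f.2]) \in pots.
    by apply/mapP; exists f.
  have /containsP/andP[h1 _] := famE f ff; rewrite zr0 zrB => h2.
  by rewrite -(pmulr_rge0 _ S0) (le_trans h2).
have A_fam' Q : Q \in A -> exists2 q, q \in fam & forall x, (map_poly intr Q).[x] = root_poly q.2 x.
  by move=> /A_fam[f ff h]; exists (zr f.1 / S, map root_of f.2) => //; exact: map_f.
have fam_A' q : q \in fam -> exists2 Q, Q \in A & forall x, (map_poly intr Q).[x] = root_poly q.2 x.
  by move=> /mapP[f /fam_A[Q QA h] ->]; exists Q.
have mass1 : (\int[lebesgue_measure]_y (pl KS y)%:E = 1)%E.
  have := @integral_log_weight R KS _ 1 0 0 0 hks.
  rewrite !mul0r addr0 subr0 => <-; last by move=> y _; rewrite !mul0r addr0 subr0.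
  by apply: eq_integral => y _; rewrite !mul0r addr0 subr0 mul1r.
have [mu muE] := exists_probability_density (measurable_pl KS) (pl_ge0 hks) mass1.
have l0R : 0 < zr l0 / S by rewrite divr_gt0//; exact: zr_gt0.
have K0R : 0 <= zr Kz / S by rewrite divr_ge0 ?(ltW S0)//; exact: zr_ge0.
apply/andP; split.
  apply: (lambda_ge hks muE l0R fam_gt0 fam_root phi_le K_le K0R fam_A' _ phi_ge).
  by rewrite divr_ge0 ?(ltW S0)//; exact: zr_ge0.
apply: (le_trans (lambda_le hks muE l0R fam_gt0 fam_root fam_ge0 phi_le K_le K0R A_fam')).
by rewrite lee_fin.
Qed.

End CertificateTheory.

(** * Localisation of the roots of the integer polynomials *)

Section RootDefs.
Local Open Scope Z_scope.

(* [v ^ (n - 1) * P (u / v)], for the polynomial [P] with the [n] coefficients [cs]. *)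
Fixpoint homogeneous (cs : seq Z) (u v : Z) : Z :=
  match cs with
  | [::] => 0
  | c :: cs => c * v ^ Z.of_nat (size cs) + u * homogeneous cs u v
  end.

Definition code_num (rt : Z * Z) : Z := 1048576 * rt.1 + rt.2.

(** Denominators are cleared, so that the signs at the two ends of the interval coded by [rt] are
    found in integer arithmetic. *)
Definition sign_change (cs : seq Z) (D : Z) (rt : Z * Z) : bool :=
  homogeneous cs (code_num rt - 1) (1048576 * D) *
  homogeneous cs (code_num rt + 1) (1048576 * D) <=? 0.

(** Codes more than 2 apart belong to distinct roots. A monic polynomial with as many distinct real
    roots as its degree is the product of the corresponding linear factors. *)
Definition roots_check (D : Z) (cs : seq Z) (rts : seq (Z * Z)) : bool :=
  [&& all (sign_change cs D) rts, size cs == (size rts).+1, last 0 cs =? 1 &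
      pairwise (fun a b => 2 <? Z.abs (code_num a - code_num b)) rts].

End RootDefs.

Section RootTheory.
Context (R : realType).
Local Open Scope ring_scope.
Notation zr := (@zr R).
Implicit Types (cs : seq Z) (rt : Z * Z).

Definition zpoly cs : {poly R} := Poly (map zr cs).

Lemma homogeneousE cs u v : zr v != 0 ->
  zr (homogeneous cs u v) * zr v = zr v ^+ size cs * (zpoly cs).[zr u / zr v].
Proof.
move=> v0; rewrite /zpoly horner_Poly; elim: cs => [|c cs IH] /=.
  by rewrite zr0 mul0r mulr0.
rewrite zrD !zrM zr_pow mulrDl -(mulrA (zr u)) IH exprS.
by field.
Qed.

Lemma code_numE rt : zr (code_num rt) = 2 ^+ 20 * zr rt.1 + zr rt.2.
Proof. by rewrite /code_num zrD zrM (_ : zr 1048576 = 2 ^+ 20)// -zr2 -zr_pow. Qed.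

Lemma poly_root_between (p : {poly R}) a b : a <= b -> p.[a] * p.[b] <= 0 ->
  exists2 x, a <= x <= b & root p x.
Proof.
move=> ab; rewrite -oppr_ge0 => h.
have [pa|pa] := leP p.[a] 0.
  have [pa0|pan] := eqVneq p.[a] 0; first by exists a; rewrite ?lexx//; apply/eqP.
  have pb : 0 <= p.[b].
    have an : p.[a] < 0 by rewrite lt_neqAle pan.
    by move: h; rewrite -mulNr pmulr_rge0// oppr_gt0.
  have pab : p.[a] <= 0 <= p.[b] by rewrite pa.
  by have [x xab rx] := poly_ivt ab pab; exists x.
have pb : p.[b] <= 0 by move: h; rewrite -mulrN pmulr_rge0// oppr_ge0.
have pab : (- p).[a] <= 0 <= (- p).[b] by rewrite !hornerN oppr_le0 oppr_ge0 (ltW pa).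
by have [x xab] := poly_ivt ab pab; rewrite rootN; exists x.
Qed.

Lemma sign_change_root cs D rt : Z.lt 0 D -> sign_change cs D rt ->
  exists r : R, near_root rt (zr D * r) /\ root (zpoly cs) r.
Proof.
move=> D0 /Z.leb_le /(zr_le R); rewrite zr0 zrM.
set v := Z.mul 1048576 D; set u := code_num rt => h.
have vE : zr v = 2 ^+ 20 * zr D.
  by rewrite /v zrM (_ : zr 1048576 = 2 ^+ 20)// -zr2 -zr_pow.
have DR := zr_gt0 R D0.
have v0 : 0 < zr v by rewrite vE mulr_gt0// exprn_gt0.
have vn0 : zr v != 0 by rewrite gt_eqF.
have vV : 0 <= (zr v)^-1 by rewrite invr_ge0 ltW.
have [||x /andP[x1 x2] rx] := @poly_root_between (zpoly cs)
    (zr (Z.sub u 1) / zr v) (zr (Z.add u 1) / zr v).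
- by rewrite ler_wpM2r// zrB zrD zr1; lra.
- have k0 : 0 < (zr v ^+ size cs) ^+ 2 by rewrite !exprn_gt0.
  rewrite -(pmulr_rle0 _ k0).
  have E (c a b : R) : c ^+ 2 * (a * b) = (c * a) * (c * b) by ring.
  by rewrite E -!homogeneousE// mulrACA mulr_le0_ge0// mulr_ge0// ltW.
exists x; split => //; rewrite /near_root.
move: x1 x2; rewrite ler_pdivrMr// ler_pdivlMr// zrB zrD zr1 code_numE vE.
move: (2 ^+ 20) => K h1 h2.
by rewrite ler_norml; apply/andP; split; lra.
Qed.

Lemma root_poly_of_roots cs D rts (root_of : Z * Z -> R) : Z.lt 0 D ->
  roots_check D cs rts ->
  (forall rt, rt \in rts -> near_root rt (zr D * root_of rt) /\ root (zpoly cs) (root_of rt)) ->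
  forall x, (zpoly cs).[x] = root_poly (map root_of rts) x.
Proof.
move=> D0 /and4P[_ /eqP sz /Z.eqb_eq lst sep] h x.
have DR := zr_gt0 R D0.
have lE a : last a (map zr cs) = 1.
  by move: sz lst; case: cs {h} => //= c cs _; rewrite last_map => ->; rewrite zr1.
have pE : zpoly cs = map zr cs :> seq R.
  by rewrite /zpoly (@PolyK _ 1)// lE oner_eq0.
have un : uniq (map root_of rts).
  rewrite uniq_pairwise pairwise_map; apply: (sub_in_pairwise (P := mem rts) _ _ sep) => [a b ar br|]; last exact: allss.
  move=> /Z.ltb_lt /(zr_lt R) hab; rewrite /relpre /=; apply/eqP => ab.
  have [na _] := h a ar; have [nb _] := h b br.
  move: na nb; rewrite /near_root -ab.
  move: hab; rewrite zr_abs zrB !code_numE zr2.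
  move: (2 ^+ 20) => K; rewrite !ler_norml => hab /andP[h1 h2] /andP[h3 h4].
  by move: hab; rewrite ltNge ler_norml => /negP; apply; apply/andP; split; lra.
have lc : lead_coef (zpoly cs) = 1 by rewrite lead_coefE pE nth_last lE.
have -> : zpoly cs = lead_coef (zpoly cs) *: \prod_(z <- map root_of rts) ('X - z%:P).
  apply: all_roots_prod_XsubC; first by rewrite pE !size_map sz.
    by apply/allP => _ /mapP[rt rtr ->]; exact: (h rt rtr).2.
  by rewrite uniq_rootsE.
rewrite lc scale1r horner_prod /root_poly; apply: eq_bigr => r _.
by rewrite hornerXsubC.
Qed.

End RootTheory.

(** * The numerical certificate *)

Section Data.
Local Open Scope Z_scope.

(** Positions are in units of [1 / 5912], and the slope jumps are not yet normalised to total mass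
    1. The roots, in increasing order, are close to 0, 0.198, 0.382, 1, 1.555, 2, 2.618 and 3.247;
    the blocks follow them in this order. *)
Definition block0 : block := Block 278 1096
  [:: (278, 41083719); (280, -23337076); (282, -6398143); (288, -4266634); (296, -2067985);
   (306, -1256184); (316, -896692); (330, -793754); (346, -503753); (362, -410930); (382, -333777);
   (404, -263488); (430, -201967); (458, -159853); (492, -121057); (528, -89039); (572, -69526);
   (622, -47614); (680, -36885); (748, -29972); (814, -35169); (874, -52926); (920, -81493);
   (958, -133375); (988, -200371); (1012, -306426); (1032, -482948); (1048, -632172);
   (1060, -1023375); (1072, -1807335); (1080, -1759906); (1086, -5020244); (1092, -5151002);
   (1094, -33204010); (1096, 50091362)]
  0 5 1
  [:: 1; 1; 3; 4; 5; 5; 7; 8; 8; 10; 11; 13; 14; 17; 18; 22; 25; 27; 2; 27; 7; 26; 7; 24; 6; 21; 2;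
    19; 15; 12; 10; 8; 6; 6; 4; 3; 3; 1; 1] 1.

Definition block1 : block := Block 1248 1990
  [:: (1248, 43415603); (1250, -25689967); (1252, -7127464); (1258, -4484265); (1264, -1725870);
   (1272, -1684204); (1284, -972948); (1296, -602297); (1312, -461604); (1332, -298605);
   (1356, -189732); (1384, -127199); (1420, -86109); (1464, -57412); (1518, -42271); (1578, -36106);
   (1638, -39813); (1694, -47817); (1742, -61262); (1786, -84694); (1824, -104507); (1856, -146760);
   (1886, -194461); (1910, -261437); (1932, -370584); (1950, -555378); (1964, -615346);
   (1976, -2317570); (1984, 4006807); (1988, -33140317); (1990, 34103589)]
  5 3 1
  [:: 1; 1; 3; 3; 4; 6; 6; 8; 10; 12; 14; 18; 21; 1; 23; 4; 25; 5; 26; 4; 26; 2; 24; 22; 19; 16; 15;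
    12; 11; 9; 7; 6; 4; 2; 1] 1.

Definition block2 : block := Block 2544 4732
  [:: (2544, 16885111); (2548, -14560003); (2566, -665573); (2592, -792730); (2628, -346942);
   (2676, -235828); (2738, -139341); (2818, -85396); (2918, -50785); (3048, -30758); (3216, -18426);
   (3426, -12799); (3658, -12435); (3878, -15901); (4068, -21641); (4228, -31149); (4364, -43852);
   (4474, -65398); (4566, -99882); (4638, -194898); (4688, -245611); (4720, -2257475);
   (4732, 3041712)]
  3 1 1
  [:: 1; 1; 5; 4; 10; 3; 16; 2; 19; 5; 23; 8; 27; 13; 32; 18; 36; 29; 40; 42; 2; 45; 47; 13; 49; 51;
    16; 52; 53; 5; 54; 41; 54; 26; 51; 17; 48; 7; 41; 5; 34; 2; 23; 2; 16; 6] 1.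

Definition block3 : block := Block 7250 8956
  [:: (7250, 1764400); (7268, -1371763); (7320, -126448); (7402, -115440); (7516, -55156);
   (7660, -37808); (7836, -25064); (8048, -18844); (8282, -17528); (8498, -25701); (8664, -52425);
   (8778, -96545); (8858, -266612); (8912, -295038); (8944, -3289520); (8956, 4029492)]
  1 6 1
  [:: 8; 1; 16; 10; 29; 12; 46; 11; 53; 19; 61; 27; 64; 42; 65; 52; 60; 48; 51; 32; 40; 17; 33; 7; 17;
    10; 13; 3; 4; 2] 1.

Definition block4 : block := Block 9430 11636
  [:: (9430, 3742472); (9442, -2911618); (9474, -390772); (9524, -250067); (9602, -105625);
   (9712, -51095); (9872, -23861); (10112, -10931); (10456, -5679); (10852, -6850); (11150, -15756);
   (11340, -41382); (11462, -86053); (11542, -260777); (11594, -279068); (11626, -3972987);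
   (11636, 4670049)]
  6 2 1
  [:: 5; 1; 15; 1; 20; 5; 28; 11; 37; 18; 47; 33; 56; 61; 3; 67; 69; 36; 72; 70; 56; 63; 59; 27; 51;
    44; 37; 24; 31; 9; 14; 12; 13; 3; 3; 2] 1.

Definition block5 : block := Block 12014 14602
  [:: (12014, 3945946); (12026, -3338280); (12058, -219274); (12110, -253905); (12192, -82676);
   (12318, -39628); (12514, -14947); (12818, -6783); (13218, -5479); (13592, -8078);
   (13888, -13124); (14118, -22968); (14294, -36136); (14428, -82917); (14522, -83372);
   (14580, -936771); (14602, 1198392)]
  2 4 1
  [:: 4; 2; 8; 8; 13; 13; 29; 12; 34; 29; 48; 50; 60; 65; 27; 74; 78; 48; 81; 83; 23; 82; 66; 78; 37;
    66; 22; 57; 10; 33; 14; 25; 4; 9; 2] 1.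

Definition block6 : block := Block 16404 18776
  [:: (16404, 987251); (16428, -788296); (16498, -71761); (16610, -65529); (16768, -28480);
   (16976, -17984); (17248, -10529); (17588, -7566); (17948, -8522); (18244, -16316);
   (18454, -31270); (18600, -82689); (18696, -101694); (18756, -1115159); (18776, 1358544)]
  4 7 1
  [:: 10; 2; 20; 15; 35; 21; 61; 18; 71; 33; 85; 51; 92; 78; 95; 85; 88; 60; 71; 34; 58; 15; 33; 15;
    24; 6; 8; 2] 1.

Definition block7 : block := Block 19624 31926
  [:: (19624, 1207995); (19646, -991725); (19708, -91022); (19808, -76982); (19960, -28462);
   (20182, -14300); (20516, -6034); (21026, -2507); (21838, -955); (23174, -356); (25082, -260);
   (26870, -397); (28308, -602); (29458, -1000); (30364, -1449); (31054, -3559); (31540, -3176);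
   (31830, -51374); (31926, 66165)]
  7 8 1
  [:: 10; 1; 16; 15; 33; 17; 57; 19; 69; 42; 88; 79; 106; 114; 35; 127; 131; 136; 12; 147; 140; 143;
    149; 89; 164; 156; 154; 156; 162; 162; 174; 164; 164; 165; 178; 49; 180; 169; 171; 181; 18; 182;
    180; 182; 31; 177; 177; 99; 188; 157; 134; 109; 103; 40; 2; 38; 10] 1.

Definition blocks : seq block := [:: block0; block1; block2; block3; block4; block5; block6; block7].

(** Dual multipliers at scale [2 ^ 44], with the codes of the roots; the order is that of
    [coefs]. *)
Definition families : seq (Z * seq (Z * Z)) :=
  [:: (8742566169636, [:: (0, 0)]);
      (7580092047188, [:: (5912, 0)]);
      (676480971219, [:: (11824, 0)]);
      (2669546875213, [:: (2258, 191951); (15478, -191951)]);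
      (971718970505, [:: (1171, -58609); (9193, -91775); (19196, 150384)])].

(** The five numbers are [D], then [l0], [cz], [Kz], [mz] at scale [2 ^ 44]; [cz] is 1.7997 rounded
    up and [mz] is 1.7999 rounded down. *)
Definition certificate (l : seq (Z * Z)) : bool :=
  certificate_check (log_tree_of 14 l) (last (0, 0) l).1 5912 23018160199567
    31660657224136 31663461405833 31664175661344 blocks families.

Lemma certificate_holds : certificate log_table.
Proof. by vm_compute. Qed.

End Data.

Section RootsOfFamilies.
Local Open Scope Z_scope.

Definition coefs : seq (seq Z) :=
  [:: [:: 0; 1]; [:: -1; 1]; [:: -2; 1]; [:: 1; -3; 1]; [:: -1; 6; -5; 1]].

Definition family_of (rt : Z * Z) : nat := find (fun f => rt \in f.2) families.

Lemma families_roots_check i : leq i.+1 5 ->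
  roots_check 5912 (nth [::] coefs i) (nth (0, [::]) families i).2.
Proof. by case: i => [|[|[|[|[|]]]]] // _; vm_compute. Qed.

Lemma family_ofE i rt : leq i.+1 5 -> rt \in (nth (0, [::]) families i).2 -> family_of rt = i.
Proof.
case: i => [|[|[|[|[|]]]]] // _; rewrite !inE.
- by move=> /eqP ->; vm_compute.
- by move=> /eqP ->; vm_compute.
- by move=> /eqP ->; vm_compute.
- by move=> /orP[/eqP->|/eqP->]; vm_compute.
- by move=> /or3P[/eqP->|/eqP->|/eqP->]; vm_compute.
Qed.

End RootsOfFamilies.

(** * The five polynomials and their roots *)

Section FamilyRoots.
Context (R : realType).
Local Open Scope ring_scope.
Notation zr := (@zr R).

(** A real root at the coded place; the sign change guarantees that there is one, so the default 0
    is never taken for a code in [families]. *)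
Definition root_of (rt : Z * Z) : R :=
  xget 0 [set r | near_root rt (zr 5912 * r) /\
                  root (zpoly R (nth [::] coefs (family_of rt))) r].

Lemma root_ofP i rt : (i < 5)%N -> rt \in (nth (Z0, [::]) families i).2 ->
  near_root rt (zr 5912 * root_of rt) /\ root (zpoly R (nth [::] coefs i)) (root_of rt).
Proof.
move=> i5 rti; rewrite /root_of (family_ofE i5 rti).
set A := [set _ | _]; suff : A (xget 0 A) by [].
apply: xgetPex; apply: sign_change_root => //.
by have /and4P[/allP h _ _ _] := families_roots_check i5; exact: h.
Qed.

Lemma family_horner i x : (i < 5)%N ->
  (zpoly R (nth [::] coefs i)).[x] = root_poly (map root_of (nth (Z0, [::]) families i).2) x.
Proof.
move=> i5; apply: (root_poly_of_roots (D := 5912)) => //.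
  exact: families_roots_check.
by move=> rt; exact: root_ofP.
Qed.

(** The code locates a root only approximately, whereas the chain of blocks must start exactly at or
    below 0. *)
Lemma root_of_zero : root_of (Z0, Z0) = 0.
Proof.
have [_] := @root_ofP 0 (Z0, Z0) isT (mem_head _ _).
by rewrite /root /zpoly horner_Poly /= zr0 zr1 mul0r add0r mul1r addr0 => /eqP.
Qed.

Definition int_polys : seq {poly int} :=
  [:: 'X; 'X - 1; 'X - 2%:R; 'X^2 - 3%:R * 'X + 1; 'X^3 - 5%:R * 'X^2 + 6%:R * 'X - 1].

Lemma int_polysE i (x : R) : (i < 5)%N ->
  (map_poly intr (nth 0 int_polys i)).[x] = (zpoly R (nth [::] coefs i)).[x].
Proof.
have hn k : (k%:R : {poly R}).[x] = k%:R by rewrite -polyC_natr hornerC.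
have [e1 e2 e3] : [/\ zr (-1) = -1, zr (-2) = -2 & zr (-3) = -3] by rewrite !zrE.
have [e5 e6] : zr (-5) = -5 /\ zr 6 = 6 by rewrite !zrE.
rewrite /zpoly horner_Poly; case: i => [|[|[|[|[|]]]]] // _;
  cbn [nth int_polys coefs map horner_rec];
  rewrite ?(rmorphB, rmorphD, rmorphN, rmorphM, rmorphXn, rmorph_nat, rmorph1) /= ?map_polyX;
  rewrite ?(hornerD, hornerN, hornerM, hornerX, hornerXn, hn, hornerC) ?(zr0, zr1, e1, e2, e3, e5, e6);
  ring.
Qed.

End FamilyRoots.

(** * Decimal form of the bounds *)

Section DecimalBounds.
Context (R : realType).
Local Open Scope ring_scope.
Notation zr := (@zr R).

(** The two integers are [1.7997 * 2 ^ 44] rounded up and [1.7999 * 2 ^ 44] rounded down; they are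
    compared with the decimals among binary integers, after multiplication by [10 ^ 4]. *)
Lemma decimal_bounds (x : R) :
  zr 31660657224136 / zr fscale <= x <= zr 31664175661344 / zr fscale ->
  `|x - (1 + 7 / 10 + 9 / 10 ^+ 2 + 9 / 10 ^+ 3 + 8 / 10 ^+ 4)| <= 10 ^- 4.
Proof.
have S0 := fscale_gt0 R.
rewrite ler_pdivrMr// ler_pdivlMr// => /andP[h1 h2].
have [e7 e9 e10] : [/\ zr 7 = 7, zr 9 = 9 & zr 10 = 10] by rewrite !zrE.
have e17999 : zr 17999 = ((10 + 7) * 10 + 9) * 10 * 10 + 9 * 10 + 9.
  by rewrite -e7 -e9 -e10 -?(zrD, zrM).
have e10000 : zr 10000 = 10 * 10 * 10 * 10 by rewrite -e10 -!zrM.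
have lo : (zr 17999 - 2) * zr fscale <= zr 10000 * zr 31660657224136.
  by rewrite -zr2 -zrB -!zrM; exact: zr_le.
have hi : zr 10000 * zr 31664175661344 <= zr 17999 * zr fscale.
  by rewrite -!zrM; exact: zr_le.
move: S0 h1 h2 lo hi; rewrite e17999 e10000.
move: (zr fscale) (zr 31660657224136) (zr 31664175661344) => S a b S0 h1 h2 lo hi.
have x_ge : ((10 + 7) * 10 + 9) * 10 * 10 + 9 * 10 + 9 - 2 <= 10 * 10 * 10 * 10 * x.
  by rewrite -(ler_pM2r S0); nra.
have x_le : 10 * 10 * 10 * 10 * x <= ((10 + 7) * 10 + 9) * 10 * 10 + 9 * 10 + 9.
  by rewrite -(ler_pM2r S0); nra.
have i10 : (10 : R)^-1 * 10 = 1 by rewrite mulVf.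
rewrite ler_norml !exprS expr0 mulr1.
by apply/andP; split; lra.
Qed.

End DecimalBounds.

Local Close Scope ereal_scope.
Local Close Scope classical_set_scope.

Theorem corollary1p8 (R : realType) (A : {fset {poly int}})
    (hA : A = [fset 'X;
                     ('X - 1)%R;
                     ('X - 2%:R)%R;
                     ('X^2 - 3%:R * 'X + 1)%R;
                     ('X^3 - 5%:R * 'X^2 + 6%:R * 'X - 1)%R]%fset) :
  (`| lambda R A
      - (1 + 7 / 10 + 9 / 10 ^+ 2 + 9 / 10 ^+ 3 + 8 / 10 ^+ 4 : R)%:E |
     <= (10 ^- 4 : R)%:E)%E.
Proof.
have index_of f : f \in families -> exists2 i, (i < 5)%N & nth (Z0, [::]) families i = f.
  by move=> /(nthP (Z0, [::]))[i]; exists i.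
have A_int_polys i : (i < 5)%N -> nth 0 int_polys i \in A.
  by rewrite hA !inE; case: i => [|[|[|[|[|]]]]] //= _; rewrite eqxx ?orbT.
have int_polys_A Q : Q \in A -> exists2 i, (i < 5)%N & nth 0 int_polys i = Q.
  rewrite hA !inE => /orP[/orP[/orP[/orP[]|]|]|] /eqP ->.
  - by exists 0%N.
  - by exists 1%N.
  - by exists 2%N.
  - by exists 3%N.
  - by exists 4%N.
have polyE i (x : R) : (i < 5)%N -> (map_poly intr (nth 0 int_polys i)).[x] =
    root_poly (map (root_of R) (nth (Z0, [::]) families i).2) x.
  by move=> i5; rewrite int_polysE// family_horner.
have near f rt : f \in families -> rt \in f.2 -> near_root rt (zr R 5912 * root_of R rt).
  by move=> /index_of[i i5 <-] rti; have [] := root_ofP R i5 rti.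
have root0 : root_of R (nth (Z0, (Z0, Z0)) (family_roots families) 0).2 <= 0.
  by rewrite [nth _ _ _]/= root_of_zero.
have A_fam Q : Q \in A -> exists2 f, f \in families &
    forall x : R, (map_poly intr Q).[x] = root_poly (map (root_of R) f.2) x.
  move=> /int_polys_A[i i5 <-]; exists (nth (Z0, [::]) families i); first exact: mem_nth.
  by move=> x; exact: polyE.
have fam_A f : f \in families -> exists2 Q, Q \in A &
    forall x : R, (map_poly intr Q).[x] = root_poly (map (root_of R) f.2) x.
  move=> /index_of[i i5 <-]; exists (nth 0 int_polys i); first exact: A_int_polys.
  by move=> x; exact: polyE.
have ok := @log_tableP R log_table erefl.
(* The table is generalised to an arbitrary list before the certificate is used, so that nothing
   below evaluates it. *)
have := certificate_holds; move: ok; move: log_table => l ok; rewrite /certificate => cert.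
have := certificate_bounds ok cert near root0 A_fam fam_A.
case: (lambda R A) => [x||]; first by rewrite !lee_fin => /decimal_bounds; rewrite -lee_fin.
  by rewrite leye_eq andbF.
by rewrite leeNy_eq.
Qed.
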